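(* Let $M_m$ be a von Mangoldt plane and let $0<x<y$ be such that $m'>0$ on $[0,y]$ and $m'<\tfrac12$ on $[x,y]$. Let $b$ be the maximum of $m'$ on $[x,y]$ and set $f_{m,x}(y):=m^{-1}(\cos(\pi b)\,m(y))$, where $m^{-1}$ is the inverse of the increasing function $m|_{[0,y]}$. If $x\le f_{m,x}(y)$, then $r(\mathfrak C_m)$ and $[x,f_{m,x}(y)]$ are disjoint.
   Context: For a smooth function $m\colon[0,\infty)\to[0,\infty)$ with $m(0)=0$, $m'(0)=1$, $m>0$ on $(0,\infty)$ and smooth odd extension, $M_m$ is $\mathbb R^2$ with metric $dr^2+m(r)^2d\theta^2$ (polar coordinates about origin $o$; $r$ is distance to $o$), curvature $G_m=-m''/m$; von Mangoldt means $G_m$ non-increasing in $r$. A ray is a unit speed geodesic on $[0,\infty)$ minimizing between any two of its points. $\mathfrak C_m$ is the set of points $q$ such that every unit tangent vector at $q$ makes angle $\le\pi/2$ with some ray from $q$. *)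

(* Defs.v *)
From Stdlib Require Import Reals Lra.
From Coquelicot Require Import Coquelicot.
Open Scope R_scope.

(* The plane M_m is modelled as R^2 with Cartesian coordinates (p1,p2);
   the polar coordinate r is the Euclidean norm, theta the polar angle. *)

Definition smooth (f : R -> R) : Prop := forall (n : nat) (x : R), ex_derive_n f n x.

(* m : R -> R is the smooth odd extension of the profile function;
   m(0)=0 follows from oddness *)
Definition model_fun (m : R -> R) : Prop :=
  smooth m /\ (forall r, m (- r) = - m r) /\ Derive m 0 = 1 /\
  (forall r, 0 < r -> 0 < m r).

Definition curvG (m : R -> R) (r : R) : R := - Derive_n m 2 r / m r.

Definition von_mangoldt (m : R -> R) : Prop :=
  forall r s, 0 < r -> r <= s -> curvG m s <= curvG m r.

Definition rad (p1 p2 : R) : R := sqrt (p1 ^ 2 + p2 ^ 2).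

(* The metric dr^2 + m(r)^2 dtheta^2 written in Cartesian coordinates:
   g_p(w,u) = <w,e_r><u,e_r> + (m(r)/r)^2 (<w,u> - <w,e_r><u,e_r>) for p <> 0,
   and Euclidean at the origin (since m'(0)=1). *)
Definition metric (m : R -> R) (p1 p2 w1 w2 u1 u2 : R) : R :=
  let r := rad p1 p2 in
  if Req_EM_T r 0 then w1 * u1 + w2 * u2
  else
    let a := (p1 * w1 + p2 * w2) / r in
    let b := (p1 * u1 + p2 * u2) / r in
    a * b + (m r / r) ^ 2 * (w1 * u1 + w2 * u2 - a * b).

Definition C1 (c : R -> R) : Prop :=
  forall t, ex_derive c t /\ continuous (Derive c) t.

Definition curve_length (m : R -> R) (c1 c2 : R -> R) : R :=
  RInt (fun t => sqrt (metric m (c1 t) (c2 t) (Derive c1 t) (Derive c2 t)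
                                 (Derive c1 t) (Derive c2 t))) 0 1.

Definition dist (m : R -> R) (p1 p2 q1 q2 : R) : Rbar :=
  Glb_Rbar (fun L => exists c1 c2 : R -> R,
    C1 c1 /\ C1 c2 /\ c1 0 = p1 /\ c2 0 = p2 /\ c1 1 = q1 /\ c2 1 = q2 /\
    L = curve_length m c1 c2).

(* A ray: a unit speed curve on [0,oo) minimizing between any two of its
   points (its restriction to [0,oo) is what matters). *)
Definition is_ray (m : R -> R) (g1 g2 : R -> R) : Prop :=
  (forall t, 0 < t ->
     ex_derive g1 t /\ ex_derive g2 t /\
     metric m (g1 t) (g2 t) (Derive g1 t) (Derive g2 t) (Derive g1 t) (Derive g2 t) = 1) /\
  (forall s t, 0 <= s -> s <= t ->
     dist m (g1 s) (g2 s) (g1 t) (g2 t) = Finite (t - s)).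

Definition init_vel (g : R -> R) (v : R) : Prop :=
  filterlim (fun h => (g h - g 0) / h) (at_right 0) (locally v).

Definition angle (m : R -> R) (p1 p2 v1 v2 w1 w2 : R) : R :=
  acos (metric m p1 p2 v1 v2 w1 w2).

Definition in_Cm (m : R -> R) (q1 q2 : R) : Prop :=
  forall v1 v2, metric m q1 q2 v1 v2 v1 v2 = 1 ->
  exists (g1 g2 : R -> R) (w1 w2 : R),
    is_ray m g1 g2 /\ g1 0 = q1 /\ g2 0 = q2 /\
    init_vel g1 w1 /\ init_vel g2 w2 /\
    angle m q1 q2 v1 v2 w1 w2 <= PI / 2.

(* Main.v *)
(* A point q of the critical set with x <= r(q) <= z would emit a ray g whose
   initial velocity makes angle <= PI/2 with the inward radial direction, so r
   does not increase initially. Since d(g(s), g(t)) = |t - s|, comparing g with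
   its rotated copies gives Clairaut's relation: c = m(r)^2 theta' is constant,
   hence r'^2 = 1 - c^2/m(r)^2. If c <> 0, then g cannot reach the meridian
   opposite to q, for otherwise reflecting an initial piece of g would produce a
   minimizing broken curve. But g turns by at least PI before leaving the disc of
   radius y: in terms of u = m(r) it turns at least as much as a geodesic with the
   same c in the surface made of the spherical cap m'^2 = 1 - K m^2 for r <= x
   (which bounds m'^2 because m'^2 is a convex function of m^2 when the curvature
   is nonincreasing) and of the cone m' = b for r >= x, where the angle is
   explicit. If c = 0, then g runs through the origin, and a curve passing beside
   the origin is strictly shorter. *)
From Stdlib Require Import Reals Lra Psatz.
From Coquelicot Require Import Coquelicot.
(* last, so that C1 is the one of Defs and not that of Stdlib's Cos_rel *)
Require Import Defs.
Open Scope R_scope.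


(** A ray is given only as a curve that is differentiable at positive times and realizes distances,
    and [dist] is an infimum over C1 curves. There is no geodesic equation to start from: every
    property of a ray comes from an upper bound of [dist] along an explicit competitor. Even then
    only r'^2 is known, not the sign of r', so angles are estimated in absolute value between first
    and last crossing times of parallels. With u = m(r) and a = |c|, Clairaut's relation reads |d
    theta| = a |du| / (m' u sqrt(u^2 - a^2)): an upper bound for m' is a lower bound for the
    turning. On the cone m' = b, which is flat, a geodesic tangent to the parallel u = a turns by
    arccos(a / m(y)) / b before radius y. This equals PI exactly when a = cos(PI b) m(y), whence the
    constant in f; a start at radius at most z has a <= m(z). If the geodesic dips below x, its two
    passages of the cap make up for what the cone no longer gives. The meridian is the limit a -> 0,
    where this bound degenerates to PI itself, so it needs a second-order comparison of its own. *)

(** * Continuity and calculus of real functions *)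

Section RealFunContinuity.
Context {U : UniformSpace}.
Implicit Types (f g : U -> R) (x : U).

Lemma continuous_Rplus f g x :
  continuous f x -> continuous g x -> continuous (fun u => f u + g u) x.
Proof. exact (@continuous_plus U R_AbsRing R_NormedModule f g x). Qed.

Lemma continuous_Rmult f g x :
  continuous f x -> continuous g x -> continuous (fun u => f u * g u) x.
Proof. exact (@continuous_mult U R_AbsRing f g x). Qed.

Lemma continuous_Rminus f g x :
  continuous f x -> continuous g x -> continuous (fun u => f u - g u) x.
Proof. exact (@continuous_minus U R_AbsRing R_NormedModule f g x). Qed.

Lemma continuous_Rcomp (h : R -> R) f x :
  continuous f x -> continuous h (f x) -> continuous (fun u => h (f u)) x.
Proof. exact (continuous_comp f h x). Qed.

Lemma continuous_Rsqrt f x :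
  continuous f x -> continuous (fun u => sqrt (f u)) x.
Proof. intros H. apply continuous_Rcomp; [exact H | apply continuous_sqrt]. Qed.

Lemma continuous_Rinv_fun f x :
  continuous f x -> f x <> 0 -> continuous (fun u => / f u) x.
Proof.
intros H H0. apply (continuous_Rcomp Rinv); [exact H | now apply continuous_Rinv].
Qed.

(** Handles the origin, where [pi * pj / r^2] has no limit: it stays bounded and its factor
    [1 - warp^2] tends to 0, so [g] may be discontinuous. *)
Lemma continuous_mult_vanishing f g x :
  continuous f x -> f x = 0 -> (forall u, Rabs (g u) <= 1) ->
  continuous (fun u => f u * g u) x.
Proof.
intros Hf H0 Hg. apply filterlim_locally. intros eps.
generalize (proj1 (filterlim_locally f (f x)) Hf eps).
apply filter_imp. intros u.
unfold ball; simpl; unfold AbsRing_ball, abs, minus, plus, opp; simpl.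
rewrite H0. intros Hu. replace (f u * g u + - (0 * g x)) with (f u * g u) by ring.
replace (f u + - 0) with (f u) in Hu by ring.
rewrite Rabs_mult. specialize (Hg u).
assert (0 <= Rabs (f u)) by apply Rabs_pos. assert (0 <= Rabs (g u)) by apply Rabs_pos. nra.
Qed.

End RealFunContinuity.

Lemma continuous_fst2 (x : R * R) : continuous (fun u : R * R => fst u) x.
Proof. apply continuous_fst. Qed.
Lemma continuous_snd2 (x : R * R) : continuous (fun u : R * R => snd u) x.
Proof. apply continuous_snd. Qed.

Lemma is_derive_Rconst (c t : R) : is_derive (fun _ : R => c) t 0.
Proof. exact (is_derive_const c t). Qed.

Lemma is_derive_eq (f : R -> R) (t l l' : R) : is_derive f t l -> l = l' -> is_derive f t l'.
Proof. now intros H <-. Qed.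

Lemma Derive_eq (f : R -> R) (t l : R) : is_derive f t l -> Derive f t = l.
Proof. exact (is_derive_unique f t l). Qed.

Lemma RInt_point_R (f : R -> R) (a : R) : RInt f a a = 0.
Proof. exact (RInt_point a f). Qed.

Lemma is_derive_continuous (f : R -> R) x l : is_derive f x l -> continuous f x.
Proof.
intros H. apply (@ex_derive_continuous R_AbsRing R_NormedModule). now exists l.
Qed.

Lemma continuous_pow2 {U : UniformSpace} (f : U -> R) x :
  continuous f x -> continuous (fun u => f u ^ 2) x.
Proof.
intros H. simpl. apply continuous_Rmult; [exact H|].
apply continuous_Rmult; [exact H|apply continuous_const].
Qed.

Ltac cont :=
  repeat match goal with
  | |- continuous (fun _ => _ + _) _ => apply continuous_Rplus
  | |- continuous (fun _ => _ - _) _ => apply continuous_Rminus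
  | |- continuous (fun _ => _ * _) _ => apply continuous_Rmult
  | |- continuous (fun _ => _ ^ 2) _ => apply continuous_pow2
  | |- continuous (fun _ => sqrt _) _ => apply continuous_Rsqrt
  | |- continuous (fun _ => ?c) _ => apply continuous_const
  | |- continuous (fun u => u) _ => apply continuous_id
  | |- continuous (fun u => fst u) _ => apply continuous_fst2
  | |- continuous (fun u => snd u) _ => apply continuous_snd2
  | |- continuous (Rplus ?c) _ => apply (continuous_Rplus (fun _ => c) (fun u => u))
  | |- continuous (Rminus ?c) _ => apply (continuous_Rminus (fun _ => c) (fun u => u))
  | |- continuous (Rmult ?c) _ => apply (continuous_Rmult (fun _ => c) (fun u => u))
  | |- continuous fst _ => apply continuous_fst2
  | |- continuous snd _ => apply continuous_snd2
  | _ => eassumption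
  end.

(* MVT_gen evaluates the derivative at a point of the closed interval;
   extending it by 0 outside the open interval makes this harmless. *)
Lemma nondecreasing_of_derive_nonneg (f df : R -> R) (a b : R) :
  a <= b ->
  (forall t, a <= t <= b -> continuous f t) ->
  (forall t, a < t < b -> is_derive f t (df t) /\ 0 <= df t) ->
  f a <= f b.
Proof.
intros Hab Hc Hd.
destruct (MVT_gen f a b (fun t => if Rlt_dec a t then if Rlt_dec t b then df t else 0 else 0))
  as [c [_ Hc2]].
- rewrite Rmin_left, Rmax_right by lra. intros t Ht.
  destruct (Rlt_dec a t); [|lra]. destruct (Rlt_dec t b); [|lra]. now apply Hd.
- rewrite Rmin_left, Rmax_right by lra. intros t Ht.
  apply continuity_pt_filterlim. now apply Hc.
- assert (0 <= if Rlt_dec a c then if Rlt_dec c b then df c else 0 else 0).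
  { destruct (Rlt_dec a c); [|lra]. destruct (Rlt_dec c b); [|lra]. apply Hd; lra. }
  nra.
Qed.

(** The point lies strictly inside, where the signs of derivatives are known. The radius along a ray
    has a derivative at positive times only. *)
Lemma MVT_open (f df : R -> R) (a b : R) :
  a < b -> (forall t, a <= t <= b -> continuous f t) ->
  (forall t, a < t < b -> is_derive f t (df t)) ->
  exists c, a < c < b /\ f b - f a = df c * (b - a).
Proof.
intros Hab Hc Hd.
set (pr := fun c (Hc : a < c < b) =>
  exist (fun l => derivable_pt_abs f c l) (df c) (proj1 (is_derive_Reals f c (df c)) (Hd c Hc))).
destruct (MVT f id a b pr (fun c _ => derivable_pt_id c) Hab) as (c & P & E).
- intros t Ht. apply continuity_pt_filterlim. now apply Hc.
- intros t _. apply derivable_continuous_pt, derivable_pt_id.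
- exists c. split; [exact P|]. rewrite derive_pt_id in E. unfold id in E. simpl in E. lra.
Qed.

Lemma RInt_le_primitive (f F dF : R -> R) (a b : R) :
  a <= b -> (forall t, continuous f t) ->
  (forall t, a <= t <= b -> is_derive F t (dF t) /\ f t <= dF t) ->
  RInt f a b <= F b - F a.
Proof.
intros Hab Hf HF.
assert (H : F a - RInt f a a <= F b - RInt f a b).
{ apply (nondecreasing_of_derive_nonneg (fun t => F t - RInt f a t) (fun t => dF t - f t) a b Hab).
  - intros t Ht. apply continuous_Rminus.
    + apply (is_derive_continuous _ _ (dF t)). now apply HF.
    + apply (is_derive_continuous _ _ (f t)).
      apply is_derive_RInt with a; [|apply Hf].
      apply filter_forall. intros u. apply (RInt_correct f), ex_RInt_continuous. intros; apply Hf.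
  - intros t Ht. split.
    + apply (is_derive_minus F (fun u => RInt f a u) t (dF t) (f t)); [apply HF; lra|].
      apply is_derive_RInt with a; [|apply Hf].
      apply filter_forall. intros u. apply (RInt_correct f), ex_RInt_continuous. intros; apply Hf.
    + assert (f t <= dF t) by (apply HF; lra). lra. }
rewrite RInt_point_R in H. lra.
Qed.

Lemma is_derive_RInt_cont (f : R -> R) (a t : R) :
  (forall u, continuous f u) -> is_derive (fun u => RInt f a u) t (f t).
Proof.
intros Hf. apply is_derive_RInt with a; [|apply Hf].
apply filter_forall. intros u. apply (RInt_correct f), ex_RInt_continuous. intros; apply Hf.
Qed.

(** * The metric *)

(** The stretching of the parallels relative to Euclidean circles, with its limit m'(0) = 1 at the
    origin. *)
Definition warp (m : R -> R) (r : R) : R := if Req_EM_T r 0 then 1 else m r / r.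

(* metric m p w w = k^2 |w|^2 + (1 - k^2) (p.w)^2 / r^2 with k = m(r)/r; the
   division by 0 at the origin is harmless because then the numerator is 0. *)
Definition gcoef (m : R -> R) (pi pj p1 p2 : R) : R :=
  (1 - warp m (rad p1 p2) ^ 2) * (pi * pj / rad p1 p2 ^ 2).

Lemma rad_sqr p1 p2 : rad p1 p2 ^ 2 = p1 ^ 2 + p2 ^ 2.
Proof. unfold rad. apply pow2_sqrt. nra. Qed.

Lemma rad_nonneg p1 p2 : 0 <= rad p1 p2.
Proof. apply sqrt_pos. Qed.

Lemma rad_unique p1 p2 r : 0 <= r -> p1 ^ 2 + p2 ^ 2 = r ^ 2 -> rad p1 p2 = r.
Proof. intros Hr H. unfold rad. rewrite H. now apply sqrt_pow2. Qed.

Lemma rad_eq0 p1 p2 : rad p1 p2 = 0 -> p1 = 0 /\ p2 = 0.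
Proof. intros H. generalize (rad_sqr p1 p2). rewrite H. intros. split; nra. Qed.

Lemma metric_quadratic m p1 p2 w1 w2 :
  metric m p1 p2 w1 w2 w1 w2 =
  warp m (rad p1 p2) ^ 2 * (w1 ^ 2 + w2 ^ 2) + gcoef m p1 p1 p1 p2 * w1 ^ 2 +
  2 * gcoef m p1 p2 p1 p2 * w1 * w2 + gcoef m p2 p2 p1 p2 * w2 ^ 2.
Proof.
unfold metric, gcoef, warp. cbv zeta.
destruct (Req_EM_T (rad p1 p2) 0) as [H|H].
- ring.
- field. exact H.
Qed.

Lemma metric_nonneg m p1 p2 w1 w2 : 0 <= metric m p1 p2 w1 w2 w1 w2.
Proof.
unfold metric. cbv zeta.
destruct (Req_EM_T (rad p1 p2) 0) as [H|H]; [nra|].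
set (r := rad p1 p2) in *.
assert (Hr : r ^ 2 = p1 ^ 2 + p2 ^ 2) by apply rad_sqr.
assert (E : w1 * w1 + w2 * w2 - (p1 * w1 + p2 * w2) / r * ((p1 * w1 + p2 * w2) / r)
   = ((p1 * w2 - p2 * w1) / r) ^ 2).
{ apply Rmult_eq_reg_r with (r ^ 2); [|now apply pow_nonzero].
  replace (((p1 * w2 - p2 * w1) / r) ^ 2 * r ^ 2) with ((p1 * w2 - p2 * w1) ^ 2) by (field; try exact H).
  replace ((w1 * w1 + w2 * w2 - (p1 * w1 + p2 * w2) / r * ((p1 * w1 + p2 * w2) / r)) * r ^ 2)
    with ((w1 * w1 + w2 * w2) * r ^ 2 - (p1 * w1 + p2 * w2) ^ 2) by (field; try exact H).
  rewrite Hr. ring. }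
rewrite E. generalize (pow2_ge_0 (m r / r)) (pow2_ge_0 ((p1 * w2 - p2 * w1) / r)).
generalize (Rle_0_sqr ((p1 * w1 + p2 * w2) / r)). unfold Rsqr. intros H1 H2 H3.
generalize (Rmult_le_pos _ _ H2 H3). lra.
Qed.

Lemma metric_polar m p1 p2 w1 w2 : rad p1 p2 <> 0 ->
  metric m p1 p2 w1 w2 w1 w2 =
  ((p1 * w1 + p2 * w2) / rad p1 p2) ^ 2 +
  (m (rad p1 p2) * ((p1 * w2 - p2 * w1) / rad p1 p2 ^ 2)) ^ 2.
Proof.
intros H. unfold metric. cbv zeta.
destruct (Req_EM_T (rad p1 p2) 0) as [H'|_]; [contradiction|].
assert (Hr : rad p1 p2 ^ 2 = p1 ^ 2 + p2 ^ 2) by apply rad_sqr.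
set (r := rad p1 p2) in *.
assert (E : (w1 * w1 + w2 * w2) * r ^ 2 = (p1 * w1 + p2 * w2) ^ 2 + (p1 * w2 - p2 * w1) ^ 2)
  by (rewrite Hr; ring).
replace (w1 * w1 + w2 * w2) with (((p1 * w1 + p2 * w2) ^ 2 + (p1 * w2 - p2 * w1) ^ 2) / r ^ 2)
  by (rewrite <- E; field; exact H).
field. exact H.
Qed.

Lemma metric_scale m p1 p2 w1 w2 l :
  metric m p1 p2 (l * w1) (l * w2) (l * w1) (l * w2) = l ^ 2 * metric m p1 p2 w1 w2 w1 w2.
Proof. rewrite !metric_quadratic. ring. Qed.

Lemma continuous_warp m : is_derive m 0 1 -> m 0 = 0 ->
  (forall r, continuous m r) -> forall r, continuous (warp m) r.
Proof.
intros Hd H0 Hc r. destruct (Req_EM_T r 0) as [->|Hr].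
- apply filterlim_locally. intros eps.
  apply is_derive_Reals in Hd.
  destruct (Hd eps (cond_pos eps)) as [d Hd'].
  exists d. intros h Hh. unfold ball in *; simpl in *.
  unfold AbsRing_ball, abs, minus, plus, opp in *; simpl in *.
  unfold warp. destruct (Req_EM_T 0 0) as [_|F]; [|now elim F].
  destruct (Req_EM_T h 0) as [->|Hh0].
  + rewrite Rplus_opp_r, Rabs_R0. apply cond_pos.
  + specialize (Hd' h Hh0). rewrite H0, Rplus_0_l in Hd'.
    replace (h + - 0) with h in Hh by ring. specialize (Hd' Hh).
    replace (m h / h + - (1)) with ((m h - 0) / h - 1) by (rewrite Rminus_0_r; reflexivity). exact Hd'.
- apply continuous_ext_loc with (fun u => m u * / u).
  + assert (Hp : 0 < Rabs r) by now apply Rabs_pos_lt.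
    exists (mkposreal _ Hp). intros u Hu. unfold ball in Hu; simpl in Hu.
    unfold AbsRing_ball, abs, minus, plus, opp in Hu; simpl in Hu.
    unfold warp. destruct (Req_EM_T u 0) as [->|]; [|reflexivity].
    rewrite Rplus_0_l, Rabs_Ropp in Hu. lra.
  + apply continuous_Rmult; [apply Hc|]. apply continuous_Rinv_fun; [apply continuous_id|exact Hr].
Qed.

Lemma continuous_rad (x : R * R) : continuous (fun p : R * R => rad (fst p) (snd p)) x.
Proof. unfold rad. cont. Qed.

Lemma Rabs_mul_le_rad2 p1 p2 a b : (a = p1 \/ a = p2) -> (b = p1 \/ b = p2) ->
  Rabs (a * b / rad p1 p2 ^ 2) <= 1.
Proof.
intros Ha Hb. destruct (Req_EM_T (rad p1 p2) 0) as [H|H].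
- destruct (rad_eq0 _ _ H) as [-> ->].
  assert (a = 0) by tauto. subst a. unfold Rdiv. rewrite !Rmult_0_l, Rabs_R0. lra.
- assert (0 < rad p1 p2 ^ 2) by (apply pow2_gt_0; exact H).
  unfold Rdiv. rewrite Rabs_mult, (Rabs_right (/ _)) by (apply Rle_ge, Rlt_le, Rinv_0_lt_compat; lra).
  apply Rmult_le_reg_r with (rad p1 p2 ^ 2); [lra|].
  rewrite Rmult_assoc, Rinv_l by lra. rewrite Rmult_1_r, Rmult_1_l, rad_sqr.
  apply Rabs_le. destruct Ha as [-> | ->], Hb as [-> | ->]; split; nra.
Qed.

(** What the theory of distances and rays asks of m apart from positivity; curvature enters only
    through the comparison surfaces. *)
Definition profile (m : R -> R) : Prop :=
  is_derive m 0 1 /\ m 0 = 0 /\ forall r, continuous m r.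

Lemma continuous_gcoef m (f g : R * R -> R) x : profile m ->
  (f = fst \/ f = snd) -> (g = fst \/ g = snd) ->
  continuous (fun p : R * R => gcoef m (f p) (g p) (fst p) (snd p)) x.
Proof.
intros (Hd & H0 & Hc) Hf Hg. unfold gcoef.
assert (Hw : continuous (fun p : R * R => 1 - warp m (rad (fst p) (snd p)) ^ 2) x).
{ cont. apply (continuous_Rcomp (warp m)); [apply continuous_rad|now apply continuous_warp]. }
destruct (Req_EM_T (rad (fst x) (snd x)) 0) as [H|H].
- apply (continuous_mult_vanishing (fun p => 1 - warp m (rad (fst p) (snd p)) ^ 2)); [exact Hw| |].
  + unfold warp. destruct (Req_EM_T _ 0); [ring|contradiction].
  + intros u. apply Rabs_mul_le_rad2; [destruct Hf as [-> | ->]|destruct Hg as [-> | ->]]; auto.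
- apply continuous_Rmult; [exact Hw|]. unfold Rdiv.
  apply continuous_Rmult.
  + destruct Hf as [-> | ->], Hg as [-> | ->]; cont.
  + apply continuous_Rinv_fun; [|now apply pow_nonzero].
    apply continuous_pow2, continuous_rad.
Qed.

Lemma continuous_metric m (U : UniformSpace) (c1 c2 d1 d2 : U -> R) t : profile m ->
  continuous c1 t -> continuous c2 t -> continuous d1 t -> continuous d2 t ->
  continuous (fun u => metric m (c1 u) (c2 u) (d1 u) (d2 u) (d1 u) (d2 u)) t.
Proof.
intros Hm H1 H2 H3 H4.
eapply continuous_ext; [intros u; symmetry; apply metric_quadratic|].
assert (HE : forall f g : R * R -> R, (f = fst \/ f = snd) -> (g = fst \/ g = snd) ->
  continuous (fun u => gcoef m (f (c1 u, c2 u)) (g (c1 u, c2 u)) (c1 u) (c2 u)) t).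
{ intros f g Hf Hg.
  apply (continuous_comp_2 c1 c2 (fun a b => gcoef m (f (a, b)) (g (a, b)) a b)); auto.
  eapply continuous_ext; [|apply (continuous_gcoef m f g); assumption].
  intros [a b]; reflexivity. }
assert (HW : continuous (fun u => warp m (rad (c1 u) (c2 u))) t).
{ apply (continuous_Rcomp (warp m)).
  - unfold rad; cont.
  - destruct Hm as (? & ? & ?); now apply continuous_warp. }
assert (X1 := HE fst fst (or_introl eq_refl) (or_introl eq_refl)).
assert (X2 := HE fst snd (or_introl eq_refl) (or_intror eq_refl)).
assert (X3 := HE snd snd (or_intror eq_refl) (or_intror eq_refl)).
simpl in X1, X2, X3. cont.
Qed.

(** * The distance function *)

Lemma continuous_Rmax (U : UniformSpace) (f : U -> R) c x :
  continuous f x -> continuous (fun u => Rmax c (f u)) x.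
Proof.
intros Hf. apply continuous_ext with (fun u => (c + f u + Rabs (c - f u)) * / 2).
- intros u. unfold Rmax, Rabs.
  destruct (Rle_dec c (f u)), (Rcase_abs (c - f u)); lra.
- apply continuous_Rmult; [|apply continuous_const].
  apply continuous_Rplus; [cont|].
  apply (continuous_Rcomp Rabs); [cont|]. apply continuous_Rabs.
Qed.

(** The positive part of the derivative of 3t^2 - 2t^3. Its primitive [smoothstep] rises from 0 to 1
    and is constant elsewhere, so a curve reparametrised by it rests at its ends, and can be
    extended or joined to another one at a corner while staying C1. *)
Definition bump (t : R) : R := Rmax 0 (6 * t * (1 - t)).

Lemma continuous_bump t : continuous bump t.
Proof. unfold bump. apply continuous_Rmax. cont. Qed.

Definition smoothstep (t : R) : R := RInt bump 0 t.

Lemma is_derive_smoothstep t : is_derive smoothstep t (bump t).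
Proof. apply is_derive_RInt_cont. apply continuous_bump. Qed.

Lemma bump_nonneg t : 0 <= bump t.
Proof. apply Rmax_l. Qed.

Lemma bump_out t : t <= 0 \/ 1 <= t -> bump t = 0.
Proof. intros H. unfold bump. apply Rmax_left. destruct H; nra. Qed.

Lemma smoothstep_le0 t : t <= 0 -> smoothstep t = 0.
Proof.
intros Ht. unfold smoothstep.
rewrite (RInt_ext _ (fun _ => 0)).
- rewrite RInt_const. unfold scal; simpl; unfold mult; simpl. ring.
- rewrite Rmin_right, Rmax_left by lra. intros u Hu. apply bump_out. lra.
Qed.

Lemma smoothstep_incr s t : s <= t -> smoothstep s <= smoothstep t.
Proof.
intros H. apply (nondecreasing_of_derive_nonneg smoothstep bump); [exact H| |].
- intros u _. apply (is_derive_continuous _ _ _ (is_derive_smoothstep u)).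
- intros u _. split; [apply is_derive_smoothstep|apply bump_nonneg].
Qed.

Lemma smoothstep_0 : smoothstep 0 = 0.
Proof. apply smoothstep_le0; lra. Qed.

Lemma smoothstep_1 : smoothstep 1 = 1.
Proof.
unfold smoothstep.
rewrite (RInt_ext _ (fun t => 6 * t * (1 - t))).
- apply is_RInt_unique.
  replace 1 with (minus (3 * 1 ^ 2 - 2 * 1 ^ 3) (3 * 0 ^ 2 - 2 * 0 ^ 3)) at 2
    by (unfold minus, plus, opp; simpl; ring).
  apply (is_RInt_derive (fun t => 3 * t ^ 2 - 2 * t ^ 3) (fun t => 6 * t * (1 - t))).
  + intros t _. auto_derive; [trivial|ring].
  + intros t _. cont.
- rewrite Rmin_left, Rmax_right by lra. intros t Ht. unfold bump. apply Rmax_right. nra.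
Qed.

Lemma smoothstep_ge1 t : 1 <= t -> smoothstep t = 1.
Proof.
intros Ht. apply Rle_antisym.
- assert (H : - smoothstep 1 <= - smoothstep t).
  { apply (nondecreasing_of_derive_nonneg (fun u => - smoothstep u) (fun u => - bump u)); [exact Ht| |].
    - intros u _. apply (is_derive_continuous _ _ (- bump u)).
      apply (is_derive_opp smoothstep u (bump u)), is_derive_smoothstep.
    - intros u Hu. split; [apply (is_derive_opp smoothstep u (bump u)), is_derive_smoothstep|].
      rewrite bump_out by lra. lra. }
  rewrite smoothstep_1 in H. lra.
- rewrite <- smoothstep_1. now apply smoothstep_incr.
Qed.

Lemma smoothstep_bounds t : 0 <= smoothstep t <= 1.
Proof.
destruct (Rle_dec t 0); [rewrite smoothstep_le0; lra|].
destruct (Rle_dec 1 t); [rewrite smoothstep_ge1; lra|].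
rewrite <- smoothstep_0 at 1. rewrite <- smoothstep_1. split; apply smoothstep_incr; lra.
Qed.

Lemma C1_intro (c d : R -> R) :
  (forall t : R, is_derive c t (d t)) -> (forall t, continuous d t) -> C1 c.
Proof.
intros H1 H2 t. split; [exists (d t); apply H1|].
apply (continuous_ext d); [|apply H2]. intros u. symmetry. apply is_derive_unique, H1.
Qed.

Lemma C1_derive (c : R -> R) (t : R) : C1 c -> is_derive c t (Derive c t).
Proof. intros H. apply Derive_correct, H. Qed.

Lemma C1_continuous c t : C1 c -> continuous c t.
Proof. intros H. exact (is_derive_continuous _ _ _ (C1_derive c t H)). Qed.

Definition speed m (c1 c2 : R -> R) t :=
  sqrt (metric m (c1 t) (c2 t) (Derive c1 t) (Derive c2 t) (Derive c1 t) (Derive c2 t)).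

Lemma continuous_speed m c1 c2 t : profile m -> C1 c1 -> C1 c2 ->
  continuous (speed m c1 c2) t.
Proof.
intros Hm H1 H2. unfold speed. apply continuous_Rsqrt.
apply (continuous_metric m _ c1 c2 (Derive c1) (Derive c2)); [exact Hm| | | |];
  try (now apply C1_continuous); [apply H1|apply H2].
Qed.

Lemma dist_le_primitive m (c1 c2 F dF : R -> R) : profile m -> C1 c1 -> C1 c2 ->
  (forall t, 0 <= t <= 1 -> is_derive F t (dF t) /\ speed m c1 c2 t <= dF t) ->
  Rbar_le (dist m (c1 0) (c2 0) (c1 1) (c2 1)) (F 1 - F 0).
Proof.
intros Hm H1 H2 HF. apply Rbar_le_trans with (curve_length m c1 c2).
- apply (proj1 (Glb_Rbar_correct _)). exists c1, c2. split; [exact H1|]. split; [exact H2|]. repeat split; reflexivity.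
- simpl. apply (RInt_le_primitive (speed m c1 c2) F dF); [lra| |exact HF].
  intros t. now apply continuous_speed.
Qed.

(** [C1] asks for derivatives on the whole line, while the curve is given on [a, b]. Composing with
    a map of the line into [a, b] that is flat at both ends supplies the extension. Bounding the
    speed by the derivative of [F] avoids evaluating a length. *)
Lemma dist_le_param m (a b : R) (c1 c2 d1 d2 F dF : R -> R) : profile m -> a <= b ->
  (forall t, a <= t <= b -> is_derive c1 t (d1 t) /\ is_derive c2 t (d2 t) /\
     continuous d1 t /\ continuous d2 t /\ is_derive F t (dF t) /\
     sqrt (metric m (c1 t) (c2 t) (d1 t) (d2 t) (d1 t) (d2 t)) <= dF t) ->
  Rbar_le (dist m (c1 a) (c2 a) (c1 b) (c2 b)) (F b - F a).
Proof.
intros Hm Hab H.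
set (s := fun t => a + (b - a) * smoothstep t).
set (ds := fun t => (b - a) * bump t).
assert (Hs : forall t, a <= s t <= b).
{ intros t. unfold s. generalize (smoothstep_bounds t). intros. split; nra. }
assert (Hds : forall t, is_derive s t (ds t)).
{ intros t. unfold s, ds.
  replace ((b - a) * bump t) with (0 + (b - a) * bump t) by ring.
  apply (is_derive_plus (fun _ => a) (fun u => (b - a) * smoothstep u));
    [apply is_derive_Rconst|].
  apply (is_derive_scal smoothstep), is_derive_smoothstep. }
assert (Cs : forall t, continuous s t) by (intros t; exact (is_derive_continuous _ _ _ (Hds t))).
assert (Cds : forall t, continuous ds t).
{ intros t. unfold ds. apply continuous_Rmult; [apply continuous_const|apply continuous_bump]. }
assert (Hcomp : forall f df : R -> R, (forall t, a <= t <= b -> is_derive f t (df t)) ->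
  forall t, is_derive (fun u : R => f (s u)) t (ds t * df (s t))).
{ intros f df Hf t. apply (is_derive_comp f s t (df (s t)) (ds t)); [now apply Hf|apply Hds]. }
assert (D1 := Hcomp c1 d1 (fun t Ht => proj1 (H t Ht))).
assert (D2 := Hcomp c2 d2 (fun t Ht => proj1 (proj2 (H t Ht)))).
replace a with (s 0) at 1 2 by (unfold s; rewrite smoothstep_0; ring).
replace b with (s 1) at 1 2 by (unfold s; rewrite smoothstep_1; ring).
replace (F b - F a) with (F (s 1) - F (s 0))
  by (unfold s; rewrite smoothstep_0, smoothstep_1; f_equal; [|f_equal]; f_equal; ring).
apply (dist_le_primitive m (fun t => c1 (s t)) (fun t => c2 (s t)) (fun t => F (s t))
         (fun t => ds t * dF (s t))); [exact Hm| | |].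
- apply (C1_intro _ _ D1). intros t. apply continuous_Rmult; [apply Cds|].
  apply (continuous_Rcomp d1); [apply Cs|now apply H].
- apply (C1_intro _ _ D2). intros t. apply continuous_Rmult; [apply Cds|].
  apply (continuous_Rcomp d2); [apply Cs|now apply H].
- intros t _. split.
  + apply Hcomp. intros; now apply H.
  + unfold speed. rewrite (Derive_eq _ _ _ (D1 t)), (Derive_eq _ _ _ (D2 t)).
    rewrite metric_scale, sqrt_mult, sqrt_pow2; [| |apply pow2_ge_0|apply metric_nonneg].
    * apply Rmult_le_compat_l; [|now apply H].
      unfold ds. generalize (bump_nonneg t). nra.
    * unfold ds. generalize (bump_nonneg t). nra.
Qed.

(** [real] would send an infinite distance to 0; [dist_finite] excludes this case for a
    [profile]. *)
Definition rdist m p1 p2 q1 q2 : R := real (dist m p1 p2 q1 q2).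

Lemma dist_nonneg m p1 p2 q1 q2 : profile m -> Rbar_le 0 (dist m p1 p2 q1 q2).
Proof.
intros Hm. apply (proj2 (Glb_Rbar_correct _)).
intros L (c1 & c2 & H1 & H2 & _ & _ & _ & _ & ->). simpl.
apply RInt_ge_0; [lra| |].
- apply (ex_RInt_continuous (speed m c1 c2)). intros; now apply continuous_speed.
- intros. apply sqrt_pos.
Qed.

Lemma C1_affine a b : C1 (fun t => a + t * b).
Proof.
apply (C1_intro _ (fun _ => b)).
- intros t. auto_derive; [trivial|ring].
- intros t. apply continuous_const.
Qed.

Lemma dist_finite m p1 p2 q1 q2 : profile m ->
  dist m p1 p2 q1 q2 = Finite (rdist m p1 p2 q1 q2).
Proof.
intros Hm. unfold rdist.
assert (H : Rbar_le (dist m p1 p2 q1 q2)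
   (curve_length m (fun t => p1 + t * (q1 - p1)) (fun t => p2 + t * (q2 - p2)))).
{ apply (proj1 (Glb_Rbar_correct _)).
  exists (fun t => p1 + t * (q1 - p1)), (fun t => p2 + t * (q2 - p2)).
  split; [apply C1_affine|]. split; [apply C1_affine|]. repeat split; ring. }
generalize (dist_nonneg m p1 p2 q1 q2 Hm).
destruct (dist m p1 p2 q1 q2); simpl in *; tauto.
Qed.

Lemma rdist_le m p1 p2 q1 q2 L : profile m ->
  Rbar_le (dist m p1 p2 q1 q2) (Finite L) -> rdist m p1 p2 q1 q2 <= L.
Proof. intros Hm. rewrite dist_finite by assumption. simpl. tauto. Qed.

Lemma rdist_nonneg m p1 p2 q1 q2 : profile m -> 0 <= rdist m p1 p2 q1 q2.
Proof.
intros Hm. generalize (dist_nonneg m p1 p2 q1 q2 Hm).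
rewrite dist_finite by assumption. simpl. tauto.
Qed.

Lemma rdist_approx m p1 p2 q1 q2 eps : profile m -> 0 < eps ->
  exists c1 c2, C1 c1 /\ C1 c2 /\ c1 0 = p1 /\ c2 0 = p2 /\ c1 1 = q1 /\ c2 1 = q2 /\
    curve_length m c1 c2 < rdist m p1 p2 q1 q2 + eps.
Proof.
intros Hm He. apply Classical_Prop.NNPP. intros Hn.
assert (H : Rbar_le (rdist m p1 p2 q1 q2 + eps) (dist m p1 p2 q1 q2)).
{ apply (proj2 (Glb_Rbar_correct _)).
  intros L (c1 & c2 & H1 & H2 & H3 & H4 & H5 & H6 & ->). simpl.
  apply Rnot_lt_le. intros Hlt. apply Hn. exists c1, c2. tauto. }
rewrite dist_finite in H by assumption. simpl in H. lra.
Qed.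

Lemma rdist_refl m p1 p2 : profile m -> rdist m p1 p2 p1 p2 = 0.
Proof.
intros Hm. apply Rle_antisym; [|now apply rdist_nonneg].
apply rdist_le; [exact Hm|].
assert (H := dist_le_param m 0 0 (fun _ => p1) (fun _ => p2) (fun _ => 0) (fun _ => 0)
   (fun _ => 0) (fun _ => 0) Hm (Rle_refl 0)).
cbv beta in H. rewrite Rminus_0_r in H. apply H. intros t _.
do 2 (split; [apply is_derive_Rconst|]). do 2 (split; [apply continuous_const|]).
split; [apply is_derive_Rconst|].
rewrite metric_quadratic, <- sqrt_0. apply Req_le. f_equal. rewrite sqrt_0. ring.
Qed.

Lemma rdist_sym m p1 p2 q1 q2 : profile m -> rdist m p1 p2 q1 q2 <= rdist m q1 q2 p1 p2.
Proof.
intros Hm. apply le_epsilon. intros eps He.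
destruct (rdist_approx m q1 q2 p1 p2 eps Hm He) as (c1 & c2 & H1 & H2 & E1 & E2 & E3 & E4 & HL).
apply rdist_le; [exact Hm|]. apply Rbar_le_trans with (curve_length m c1 c2); [|simpl; lra].
assert (HLd : forall t, is_derive (fun u : R => RInt (speed m c1 c2) 0 u) t (speed m c1 c2 t)).
{ intros t. apply is_derive_RInt_cont. intros; now apply continuous_speed. }
assert (HD : forall c t, C1 c -> is_derive (fun u : R => c (- u)) t (-1 * Derive c (- t))).
{ intros c t Hc. apply (is_derive_comp c (fun u => - u) t (Derive c (- t)) (-1)).
  - now apply C1_derive.
  - auto_derive; [trivial|ring]. }
assert (HCd : forall c t, C1 c -> continuous (fun u => -1 * Derive c (- u)) t).
{ intros c t Hc. apply continuous_Rmult; [apply continuous_const|].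
  apply (continuous_Rcomp (Derive c)); [|apply Hc].
  apply (is_derive_continuous _ _ (-1)). auto_derive; [trivial|ring]. }
assert (H := dist_le_param m (-1) 0 (fun t => c1 (- t)) (fun t => c2 (- t))
  (fun t => -1 * Derive c1 (- t)) (fun t => -1 * Derive c2 (- t))
  (fun t => - RInt (speed m c1 c2) 0 (- t)) (fun t => speed m c1 c2 (- t)) Hm ltac:(lra)).
cbv beta in H. replace (- -1) with 1 in H by ring. rewrite Ropp_0 in H.
rewrite E1, E2, E3, E4 in H.
rewrite RInt_point_R in H. replace (- 0 - - RInt (speed m c1 c2) 0 1) with (curve_length m c1 c2) in H.
2:{ change (curve_length m c1 c2 = - 0 - - curve_length m c1 c2). ring. }
apply H. intros t _. do 2 (split; [now apply HD|]). do 2 (split; [now apply HCd|]). split.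
- replace (speed m c1 c2 (- t)) with (- (-1 * speed m c1 c2 (- t))) by ring.
  apply (is_derive_opp (fun t => RInt (speed m c1 c2) 0 (- t)) t (-1 * speed m c1 c2 (- t))).
  apply (is_derive_comp (fun u => RInt (speed m c1 c2) 0 u) (fun u => - u) t (speed m c1 c2 (- t)) (-1)).
  + apply HLd.
  + auto_derive; [trivial|ring].
- rewrite metric_scale. unfold speed. apply Req_le. f_equal. ring.
Qed.

(** The concatenation is written as the sum [c (s u) + d (s' u) - q], where [s] moves on [0, 1/2]
    and [s'] on [1/2, 1]. At each time one summand rests at [q], so one formula is C1 and only the
    speed needs a case distinction. *)
Lemma rdist_triangle m p1 p2 q1 q2 u1 u2 : profile m ->
  rdist m p1 p2 u1 u2 <= rdist m p1 p2 q1 q2 + rdist m q1 q2 u1 u2.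
Proof.
intros Hm. apply le_epsilon. intros eps He.
destruct (rdist_approx m p1 p2 q1 q2 (eps / 2) Hm ltac:(lra))
  as (c1 & c2 & H1 & H2 & E1 & E2 & E3 & E4 & HL).
destruct (rdist_approx m q1 q2 u1 u2 (eps / 2) Hm ltac:(lra))
  as (d1 & d2 & K1 & K2 & G1 & G2 & G3 & G4 & KL).
apply rdist_le; [exact Hm|].
set (s := fun t => smoothstep (2 * t)). set (s' := fun t => smoothstep (2 * t - 1)).
set (ds := fun t => 2 * bump (2 * t)). set (ds' := fun t => 2 * bump (2 * t - 1)).
assert (Ds : forall t, is_derive s t (ds t)).
{ intros t. apply (is_derive_comp smoothstep (fun u => 2 * u) t (bump (2 * t)) 2).
  - apply is_derive_smoothstep.
  - auto_derive; [trivial|ring]. }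
assert (Ds' : forall t, is_derive s' t (ds' t)).
{ intros t. apply (is_derive_comp smoothstep (fun u => 2 * u - 1) t (bump (2 * t - 1)) 2).
  - apply is_derive_smoothstep.
  - auto_derive; [trivial|ring]. }
assert (Cds : forall t, continuous ds t).
{ intros t. apply continuous_Rmult; [cont|]. apply (continuous_Rcomp bump); [cont|apply continuous_bump]. }
assert (Cds' : forall t, continuous ds' t).
{ intros t. apply continuous_Rmult; [cont|]. apply (continuous_Rcomp bump); [cont|apply continuous_bump]. }
assert (Hcomp : forall (f df g dg : R -> R) (k : R), (forall t, is_derive f t (df t)) -> (forall t, is_derive g t (dg t)) ->
  forall t, is_derive (fun u : R => f (s u) + g (s' u) - k) t (ds t * df (s t) + ds' t * dg (s' t))).
{ intros f df g dg k Hf Hg t.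
  replace (ds t * df (s t) + ds' t * dg (s' t)) with (ds t * df (s t) + ds' t * dg (s' t) - 0) by ring.
  apply (is_derive_minus (fun u => f (s u) + g (s' u)) (fun _ => k)); [|apply is_derive_Rconst].
  apply (is_derive_plus (fun u => f (s u)) (fun u => g (s' u))).
  - apply (is_derive_comp f s); auto.
  - apply (is_derive_comp g s'); auto. }
assert (HC1 : forall f g k, C1 f -> C1 g -> C1 (fun u => f (s u) + g (s' u) - k)).
{ intros f g k Hf Hg. eapply C1_intro.
  - apply (Hcomp f (Derive f) g (Derive g)); intros; now apply C1_derive.
  - intros t. apply continuous_Rplus; apply continuous_Rmult; auto.
    + apply (continuous_Rcomp (Derive f)); [exact (is_derive_continuous _ _ _ (Ds t))|apply Hf].
    + apply (continuous_Rcomp (Derive g)); [exact (is_derive_continuous _ _ _ (Ds' t))|apply Hg]. }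
assert (HL1 : forall t, is_derive (fun u : R => RInt (speed m c1 c2) 0 u) t (speed m c1 c2 t)).
{ intros t. apply is_derive_RInt_cont. intros; now apply continuous_speed. }
assert (HL2 : forall t, is_derive (fun u : R => RInt (speed m d1 d2) 0 u) t (speed m d1 d2 t)).
{ intros t. apply is_derive_RInt_cont. intros; now apply continuous_speed. }
assert (s0 : s 0 = 0) by (apply smoothstep_le0; lra).
assert (s0' : s' 0 = 0) by (apply smoothstep_le0; lra).
assert (s1 : s 1 = 1) by (apply smoothstep_ge1; lra).
assert (s1' : s' 1 = 1) by (apply smoothstep_ge1; lra).
assert (H := dist_le_primitive m (fun u => c1 (s u) + d1 (s' u) - q1) (fun u => c2 (s u) + d2 (s' u) - q2)
  (fun u => RInt (speed m c1 c2) 0 (s u) + RInt (speed m d1 d2) 0 (s' u) - 0)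
  (fun t => ds t * speed m c1 c2 (s t) + ds' t * speed m d1 d2 (s' t)) Hm
  (HC1 c1 d1 q1 H1 K1) (HC1 c2 d2 q2 H2 K2)).
cbv beta in H. rewrite s0, s0', s1, s1', E1, E2, E3, E4, G1, G2, G3, G4 in H.
rewrite !RInt_point_R in H.
apply Rbar_le_trans with (curve_length m c1 c2 + curve_length m d1 d2); [|simpl; lra].
replace (p1 + q1 - q1) with p1 in H by ring. replace (p2 + q2 - q2) with p2 in H by ring.
replace (q1 + u1 - q1) with u1 in H by ring. replace (q2 + u2 - q2) with u2 in H by ring.
replace (RInt (speed m c1 c2) 0 1 + RInt (speed m d1 d2) 0 1 - 0 - (0 + 0 - 0))
  with (curve_length m c1 c2 + curve_length m d1 d2) in H
  by (change (RInt (speed m c1 c2) 0 1) with (curve_length m c1 c2);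
      change (RInt (speed m d1 d2) 0 1) with (curve_length m d1 d2); ring).
apply H. intros t _. split; [now apply Hcomp|].
unfold speed at 1.
rewrite (Derive_eq _ _ _ (Hcomp c1 (Derive c1) d1 (Derive d1) q1
   (fun t => C1_derive c1 t H1) (fun t => C1_derive d1 t K1) t)).
rewrite (Derive_eq _ _ _ (Hcomp c2 (Derive c2) d2 (Derive d2) q2
   (fun t => C1_derive c2 t H2) (fun t => C1_derive d2 t K2) t)).
destruct (Rle_dec t (1 / 2)) as [Ht|Ht].
- assert (Z : ds' t = 0) by (unfold ds'; rewrite bump_out; lra).
  assert (Z' : s' t = 0) by (apply smoothstep_le0; lra).
  rewrite Z, Z', G1, G2. replace (c1 (s t) + q1 - q1) with (c1 (s t)) by ring.
  replace (c2 (s t) + q2 - q2) with (c2 (s t)) by ring.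
  rewrite !Rmult_0_l, !Rplus_0_r.
  rewrite metric_scale, sqrt_mult, sqrt_pow2; [apply Rle_refl| |apply pow2_ge_0|apply metric_nonneg].
  unfold ds. generalize (bump_nonneg (2 * t)). lra.
- assert (Z : ds t = 0) by (unfold ds; rewrite bump_out; lra).
  assert (Z' : s t = 1) by (apply smoothstep_ge1; lra).
  rewrite Z, Z', E3, E4. replace (q1 + d1 (s' t) - q1) with (d1 (s' t)) by ring.
  replace (q2 + d2 (s' t) - q2) with (d2 (s' t)) by ring.
  rewrite !Rmult_0_l, !Rplus_0_l.
  rewrite metric_scale, sqrt_mult, sqrt_pow2; [apply Rle_refl| |apply pow2_ge_0|apply metric_nonneg].
  unfold ds'. generalize (bump_nonneg (2 * t - 1)). lra.
Qed.

(** * Isometries and first-order bounds for the distance *)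

Lemma metric_ext m p1 p2 w1 w2 p1' p2' w1' w2' :
  p1 ^ 2 + p2 ^ 2 = p1' ^ 2 + p2' ^ 2 -> w1 ^ 2 + w2 ^ 2 = w1' ^ 2 + w2' ^ 2 ->
  p1 * w1 + p2 * w2 = p1' * w1' + p2' * w2' ->
  metric m p1 p2 w1 w2 w1 w2 = metric m p1' p2' w1' w2' w1' w2'.
Proof.
intros H1 H2 H3. unfold metric, rad. rewrite H1, H3.
replace (w1 * w1 + w2 * w2) with (w1' * w1' + w2' * w2') by lra. reflexivity.
Qed.

(* (al, be) is a unit vector and sg = 1 or -1: a rotation or a reflection. *)
Lemma rdist_isometry m al be sg p1 p2 q1 q2 : profile m ->
  al ^ 2 + be ^ 2 = 1 -> sg ^ 2 = 1 ->
  rdist m (al * p1 - sg * be * p2) (be * p1 + sg * al * p2)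
          (al * q1 - sg * be * q2) (be * q1 + sg * al * q2) <= rdist m p1 p2 q1 q2.
Proof.
intros Hm Hab Hsg. apply le_epsilon. intros eps He.
destruct (rdist_approx m p1 p2 q1 q2 eps Hm He) as (c1 & c2 & H1 & H2 & E1 & E2 & E3 & E4 & HL).
apply rdist_le; [exact Hm|]. apply Rbar_le_trans with (curve_length m c1 c2); [|simpl; lra].
assert (HD : forall a b t, is_derive (fun u : R => a * c1 u + b * c2 u) t (a * Derive c1 t + b * Derive c2 t)).
{ intros a b t. generalize (C1_derive c1 t H1) (C1_derive c2 t H2). intros D1 D2.
  apply (is_derive_plus (fun u => a * c1 u) (fun u => b * c2 u));
    [exact (is_derive_scal c1 t a _ D1)|exact (is_derive_scal c2 t b _ D2)]. }
assert (H := dist_le_primitive m (fun u => al * c1 u + (- (sg * be)) * c2 u)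
  (fun u => be * c1 u + (sg * al) * c2 u)
  (fun u => RInt (speed m c1 c2) 0 u) (speed m c1 c2) Hm).
cbv beta in H. rewrite E1, E2, E3, E4, RInt_point_R in H.
replace (al * p1 - sg * be * p2) with (al * p1 + (- (sg * be)) * p2) by ring.
replace (al * q1 - sg * be * q2) with (al * q1 + (- (sg * be)) * q2) by ring.
replace (RInt (speed m c1 c2) 0 1 - 0) with (curve_length m c1 c2) in H
  by (change (RInt (speed m c1 c2) 0 1) with (curve_length m c1 c2); ring).
apply H.
- eapply C1_intro; [apply HD|]. intros t.
  apply continuous_Rplus; (apply continuous_Rmult; [apply continuous_const|]); [apply H1|apply H2].
- eapply C1_intro; [apply HD|]. intros t.
  apply continuous_Rplus; (apply continuous_Rmult; [apply continuous_const|]); [apply H1|apply H2].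
- intros t _. split; [apply is_derive_RInt_cont; intros; now apply continuous_speed|].
  unfold speed. rewrite !(Derive_eq _ _ _ (HD _ _ _)).
  apply Req_le. f_equal. apply metric_ext.
  + transitivity ((al ^ 2 + be ^ 2) * (c1 t ^ 2 + sg ^ 2 * c2 t ^ 2)); [ring|rewrite Hab, Hsg; ring].
  + transitivity ((al ^ 2 + be ^ 2) * (Derive c1 t ^ 2 + sg ^ 2 * Derive c2 t ^ 2)); [ring|rewrite Hab, Hsg; ring].
  + transitivity ((al ^ 2 + be ^ 2) * (c1 t * Derive c1 t + sg ^ 2 * (c2 t * Derive c2 t))); [ring|rewrite Hab, Hsg; ring].
Qed.

Lemma continuous_R2 (f : R * R -> R) p1 p2 : continuous f (p1, p2) ->
  forall eps, 0 < eps -> exists d, 0 < d /\ forall x1 x2,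
    Rabs (x1 - p1) < d -> Rabs (x2 - p2) < d -> Rabs (f (x1, x2) - f (p1, p2)) < eps.
Proof.
intros Hf eps He.
destruct (proj1 (filterlim_locally f (f (p1, p2))) Hf (mkposreal eps He)) as [d Hd].
exists d. split; [apply cond_pos|]. intros x1 x2 H1 H2.
exact (Hd (x1, x2) (conj H1 H2)).
Qed.

Lemma sqrt_add_sqr_le a b : 0 <= a -> 0 <= b -> sqrt (a + b ^ 2) <= sqrt a + b.
Proof.
intros Ha Hb. rewrite <- (sqrt_pow2 (sqrt a + b)) by (generalize (sqrt_pos a); lra).
apply sqrt_le_1_alt. generalize (pow2_sqrt a Ha) (sqrt_pos a). intros. nra.
Qed.

(** An additive error requires no positive lower bound of the form: by [sqrt_add_sqr_le] it suffices
    that the forms differ by at most [kap^2 * N], with N the square of |w1| + |w2|. Each of three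
    coefficients contributes a quarter of this. *)
Lemma metric_near m p1 p2 kap : profile m -> 0 < kap ->
  exists d, 0 < d /\ forall x1 x2 w1 w2, Rabs (x1 - p1) < d -> Rabs (x2 - p2) < d ->
    sqrt (metric m x1 x2 w1 w2 w1 w2) <=
    sqrt (metric m p1 p2 w1 w2 w1 w2) + kap * (Rabs w1 + Rabs w2).
Proof.
intros Hm Hk.
assert (HC : forall u1 u2, continuous (fun p : R * R => metric m (fst p) (snd p) u1 u2 u1 u2) (p1, p2)).
{ intros u1 u2. apply continuous_metric; [exact Hm|cont|cont|cont|cont]. }
assert (Hk2 : 0 < kap ^ 2 / 4) by nra.
destruct (continuous_R2 _ _ _ (HC 1 0) _ Hk2) as (d1 & Hd1 & K1).
destruct (continuous_R2 _ _ _ (HC 0 1) _ Hk2) as (d2 & Hd2 & K2).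
destruct (continuous_R2 _ _ _ (HC 1 1) _ Hk2) as (d3 & Hd3 & K3).
exists (Rmin d1 (Rmin d2 d3)). split; [now repeat apply Rmin_pos|].
intros x1 x2 w1 w2 H1 H2.
generalize (Rmin_l d1 (Rmin d2 d3)) (Rmin_r d1 (Rmin d2 d3)) (Rmin_l d2 d3) (Rmin_r d2 d3).
intros.
specialize (K1 x1 x2 ltac:(lra) ltac:(lra)). specialize (K2 x1 x2 ltac:(lra) ltac:(lra)).
specialize (K3 x1 x2 ltac:(lra) ltac:(lra)). simpl in K1, K2, K3.
apply Rle_trans with (sqrt (metric m p1 p2 w1 w2 w1 w2 + (kap * (Rabs w1 + Rabs w2)) ^ 2)).
2:{ apply sqrt_add_sqr_le; [apply metric_nonneg|].
    generalize (Rabs_pos w1) (Rabs_pos w2). intros. nra. }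
apply sqrt_le_1_alt.
(* polarization: the three test vectors (1,0), (0,1), (1,1) determine the form *)
assert (P : forall y1 y2, metric m y1 y2 w1 w2 w1 w2 =
  metric m y1 y2 1 0 1 0 * (w1 ^ 2 - w1 * w2) + metric m y1 y2 0 1 0 1 * (w2 ^ 2 - w1 * w2)
  + metric m y1 y2 1 1 1 1 * (w1 * w2)).
{ intros y1 y2. rewrite !metric_quadratic. ring. }
rewrite (P x1 x2), (P p1 p2).
set (A1 := metric m x1 x2 1 0 1 0) in *. set (A2 := metric m x1 x2 0 1 0 1) in *.
set (A3 := metric m x1 x2 1 1 1 1) in *.
set (B1 := metric m p1 p2 1 0 1 0) in *. set (B2 := metric m p1 p2 0 1 0 1) in *.
set (B3 := metric m p1 p2 1 1 1 1) in *.
assert (Q1 : Rabs (w1 ^ 2 - w1 * w2) <= (Rabs w1 + Rabs w2) ^ 2).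
{ unfold Rabs; destruct (Rcase_abs w1), (Rcase_abs w2), (Rcase_abs _); nra. }
assert (Q2 : Rabs (w2 ^ 2 - w1 * w2) <= (Rabs w1 + Rabs w2) ^ 2).
{ unfold Rabs; destruct (Rcase_abs w1), (Rcase_abs w2), (Rcase_abs _); nra. }
assert (Q3 : Rabs (w1 * w2) <= (Rabs w1 + Rabs w2) ^ 2).
{ rewrite Rabs_mult. generalize (Rabs_pos w1) (Rabs_pos w2). intros. nra. }
set (N := (Rabs w1 + Rabs w2) ^ 2) in *.
assert (T : forall u v, Rabs u < kap ^ 2 / 4 -> Rabs v <= N -> u * v <= kap ^ 2 / 4 * N).
{ intros u v Hu Hv. apply Rle_trans with (Rabs (u * v)); [apply Rle_abs|]. rewrite Rabs_mult.
  apply Rmult_le_compat; try apply Rabs_pos; lra. }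
generalize (T _ _ K1 Q1) (T _ _ K2 Q2) (T _ _ K3 Q3).
replace ((kap * (Rabs w1 + Rabs w2)) ^ 2) with (kap ^ 2 * N) by (unfold N; ring).
assert (0 <= N) by (unfold N; apply pow2_ge_0). intros. nra.
Qed.

Lemma Rabs_convex_lt t u v d : 0 <= t <= 1 -> Rabs u < d -> Rabs v < d ->
  Rabs ((1 - t) * u + t * v) < d.
Proof.
intros Ht Hu Hv. assert (Hw : Rmax (Rabs u) (Rabs v) < d) by now apply Rmax_lub_lt.
generalize (Rmax_l (Rabs u) (Rabs v)) (Rmax_r (Rabs u) (Rabs v)). intros H1 H2.
eapply Rle_lt_trans; [|exact Hw]. eapply Rle_trans; [apply Rabs_triang|].
rewrite !Rabs_mult, (Rabs_pos_eq (1 - t)), (Rabs_pos_eq t) by lra. nra.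
Qed.

Lemma rdist_near m p1 p2 kap : profile m -> 0 < kap ->
  exists d, 0 < d /\ forall a1 a2 b1 b2,
    Rabs (a1 - p1) < d -> Rabs (a2 - p2) < d -> Rabs (b1 - p1) < d -> Rabs (b2 - p2) < d ->
    rdist m a1 a2 b1 b2 <=
    sqrt (metric m p1 p2 (b1 - a1) (b2 - a2) (b1 - a1) (b2 - a2))
    + kap * (Rabs (b1 - a1) + Rabs (b2 - a2)).
Proof.
intros Hm Hk. destruct (metric_near m p1 p2 kap Hm Hk) as (d & Hd & H).
exists d. split; [exact Hd|]. intros a1 a2 b1 b2 H1 H2 H3 H4.
set (C := sqrt _ + _). apply rdist_le; [exact Hm|].
assert (HL : forall (a b t : R), is_derive (fun t => a + t * b) t b).
{ intros a b t. auto_derive; [trivial|ring]. }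
assert (K := dist_le_param m 0 1 (fun t => a1 + t * (b1 - a1)) (fun t => a2 + t * (b2 - a2))
  (fun _ => b1 - a1) (fun _ => b2 - a2) (fun t => 0 + t * C) (fun _ => C) Hm ltac:(lra)).
cbv beta in K.
replace (a1 + 0 * (b1 - a1)) with a1 in K by ring. replace (a2 + 0 * (b2 - a2)) with a2 in K by ring.
replace (a1 + 1 * (b1 - a1)) with b1 in K by ring. replace (a2 + 1 * (b2 - a2)) with b2 in K by ring.
replace (0 + 1 * C - (0 + 0 * C)) with C in K by ring.
apply K. intros t Ht.
do 2 (split; [apply HL|]). do 2 (split; [apply continuous_const|]). split; [apply HL|].
apply H.
- replace (a1 + t * (b1 - a1) - p1) with ((1 - t) * (a1 - p1) + t * (b1 - p1)) by ring.
  now apply Rabs_convex_lt.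
- replace (a2 + t * (b2 - a2) - p2) with ((1 - t) * (a2 - p2) + t * (b2 - p2)) by ring.
  now apply Rabs_convex_lt.
Qed.

Lemma derive_near (f : R -> R) (l mu d : R) : is_derive f 0 l -> 0 < mu -> 0 < d ->
  exists e0, 0 < e0 /\ forall e, 0 < e < e0 ->
    Rabs ((f e - f 0) / e - l) < mu /\ Rabs (f e - f 0) < d.
Proof.
intros Hf Hmu Hd.
assert (Hc := is_derive_continuous _ _ _ Hf).
destruct (proj1 (filterlim_locally f (f 0)) Hc (mkposreal d Hd)) as [d1 Hd1].
apply is_derive_Reals in Hf. destruct (Hf mu Hmu) as [d2 Hd2].
exists (Rmin d1 d2). split; [apply Rmin_pos; apply cond_pos|].
intros e He. generalize (Rmin_l d1 d2) (Rmin_r d1 d2). intros.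
split.
- specialize (Hd2 e ltac:(lra)). rewrite Rplus_0_l in Hd2. apply Hd2.
  rewrite Rabs_pos_eq; lra.
- apply (Hd1 e). change (Rabs (e - 0) < d1). rewrite Rminus_0_r, Rabs_pos_eq; lra.
Qed.

(** Two curves leaving the same point separate at most at the speed of the difference of their
    velocities. This is the upper half of the first variation; the lower bounds on distances come
    from the ray itself. *)
Lemma rdist_first_order m (a1 a2 b1 b2 : R -> R) al1 al2 be1 be2 kap : profile m ->
  is_derive a1 0 al1 -> is_derive a2 0 al2 -> is_derive b1 0 be1 -> is_derive b2 0 be2 ->
  a1 0 = b1 0 -> a2 0 = b2 0 -> 0 < kap ->
  exists e0, 0 < e0 /\ forall e, 0 < e < e0 ->
    rdist m (a1 e) (a2 e) (b1 e) (b2 e) <=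
    e * (sqrt (metric m (a1 0) (a2 0) (be1 - al1) (be2 - al2) (be1 - al1) (be2 - al2)) + kap).
Proof.
intros Hm A1 A2 B1 B2 E1 E2 Hk.
set (w1 := be1 - al1). set (w2 := be2 - al2).
assert (HN : continuous (fun v : R * R => sqrt (metric m (a1 0) (a2 0) (fst v) (snd v) (fst v) (snd v))) (w1, w2)).
{ apply continuous_Rsqrt. apply (continuous_metric m _ (fun _ => a1 0) (fun _ => a2 0)); [exact Hm|cont|cont|cont|cont]. }
destruct (continuous_R2 _ _ _ HN (kap / 2) ltac:(lra)) as (d1 & Hd1 & K1). simpl in K1.
set (W := Rabs w1 + Rabs w2 + 2).
assert (HW : 0 < W) by (unfold W; generalize (Rabs_pos w1) (Rabs_pos w2); lra).
destruct (rdist_near m (a1 0) (a2 0) (kap / 2 / W) Hm) as (d2 & Hd2 & K2).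
{ apply Rdiv_lt_0_compat; lra. }
set (mu := Rmin d1 1 / 2).
assert (Hmu : 0 < mu) by (unfold mu; generalize (Rmin_pos d1 1 Hd1 ltac:(lra)); lra).
assert (Hmu1 : 2 * mu <= d1) by (unfold mu; generalize (Rmin_l d1 1); lra).
assert (Hmu2 : 2 * mu <= 1) by (unfold mu; generalize (Rmin_r d1 1); lra).
destruct (derive_near _ _ _ _ A1 Hmu Hd2) as (e1 & He1 & F1).
destruct (derive_near _ _ _ _ A2 Hmu Hd2) as (e2 & He2 & F2).
destruct (derive_near _ _ _ _ B1 Hmu Hd2) as (e3 & He3 & F3).
destruct (derive_near _ _ _ _ B2 Hmu Hd2) as (e4 & He4 & F4).
exists (Rmin (Rmin e1 e2) (Rmin e3 e4)). split; [now repeat apply Rmin_pos|].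
intros e He.
generalize (Rmin_l (Rmin e1 e2) (Rmin e3 e4)) (Rmin_r (Rmin e1 e2) (Rmin e3 e4))
  (Rmin_l e1 e2) (Rmin_r e1 e2) (Rmin_l e3 e4) (Rmin_r e3 e4). intros.
destruct (F1 e ltac:(lra)) as [G1 G1']. destruct (F2 e ltac:(lra)) as [G2 G2'].
destruct (F3 e ltac:(lra)) as [G3 G3']. destruct (F4 e ltac:(lra)) as [G4 G4'].
rewrite <- E1 in G3, G3'. rewrite <- E2 in G4, G4'.
eapply Rle_trans; [apply K2; assumption|].
set (v1 := (b1 e - a1 e) / e). set (v2 := (b2 e - a2 e) / e).
assert (V1 : b1 e - a1 e = e * v1) by (unfold v1; field; lra).
assert (V2 : b2 e - a2 e = e * v2) by (unfold v2; field; lra).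
assert (D1 : Rabs (v1 - w1) < 2 * mu).
{ replace (v1 - w1) with (((b1 e - a1 0) / e - be1) - ((a1 e - a1 0) / e - al1))
    by (unfold v1, w1; field; lra).
  apply Rabs_def2 in G1, G3. apply Rabs_def1; lra. }
assert (D2 : Rabs (v2 - w2) < 2 * mu).
{ replace (v2 - w2) with (((b2 e - a2 0) / e - be2) - ((a2 e - a2 0) / e - al2))
    by (unfold v2, w2; field; lra).
  apply Rabs_def2 in G2, G4. apply Rabs_def1; lra. }
rewrite V1, V2, metric_scale, sqrt_mult, sqrt_pow2; [|lra|apply pow2_ge_0|apply metric_nonneg].
rewrite !Rabs_mult, (Rabs_pos_eq e) by lra.
specialize (K1 v1 v2 ltac:(lra) ltac:(lra)). apply Rabs_def2 in K1.
assert (X1 : Rabs v1 <= Rabs w1 + 1).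
{ replace v1 with (w1 + (v1 - w1)) by ring. eapply Rle_trans; [apply Rabs_triang|]. lra. }
assert (X2 : Rabs v2 <= Rabs w2 + 1).
{ replace v2 with (w2 + (v2 - w2)) by ring. eapply Rle_trans; [apply Rabs_triang|]. lra. }
assert (X3 : kap / 2 / W * (Rabs v1 + Rabs v2) <= kap / 2).
{ apply Rle_trans with (kap / 2 / W * W); [|right; field; lra].
  apply Rmult_le_compat_l; [|unfold W; lra]. apply Rlt_le, Rdiv_lt_0_compat; lra. }
replace (kap / 2 / W * (e * Rabs v1 + e * Rabs v2)) with (e * (kap / 2 / W * (Rabs v1 + Rabs v2))) by ring.
rewrite <- Rmult_plus_distr_l. apply Rmult_le_compat_l; lra.
Qed.

Lemma rdist_rot m phi p1 p2 q1 q2 : profile m ->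
  rdist m (cos phi * p1 - sin phi * p2) (sin phi * p1 + cos phi * p2)
          (cos phi * q1 - sin phi * q2) (sin phi * q1 + cos phi * q2) <= rdist m p1 p2 q1 q2.
Proof.
intros Hm.
assert (H := rdist_isometry m (cos phi) (sin phi) 1 p1 p2 q1 q2 Hm).
replace (1 * sin phi * p2) with (sin phi * p2) in H by ring.
replace (1 * sin phi * q2) with (sin phi * q2) in H by ring.
rewrite !(Rmult_1_l (cos phi)) in H. apply H; [|ring].
generalize (sin2_cos2 phi). unfold Rsqr. nra.
Qed.

Lemma rdist_rot_l m phi p1 p2 q1 q2 : profile m ->
  rdist m p1 p2 (cos phi * q1 - sin phi * q2) (sin phi * q1 + cos phi * q2) <=
  rdist m (cos (- phi) * p1 - sin (- phi) * p2) (sin (- phi) * p1 + cos (- phi) * p2) q1 q2.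
Proof.
intros Hm.
assert (H := rdist_rot m phi (cos (- phi) * p1 - sin (- phi) * p2)
  (sin (- phi) * p1 + cos (- phi) * p2) q1 q2 Hm).
rewrite cos_neg, sin_neg in *.
assert (S := sin2_cos2 phi). unfold Rsqr in S.
replace (cos phi * (cos phi * p1 - - sin phi * p2) - sin phi * (- sin phi * p1 + cos phi * p2))
  with p1 in H by (transitivity ((sin phi * sin phi + cos phi * cos phi) * p1); [rewrite S|]; ring).
replace (sin phi * (cos phi * p1 - - sin phi * p2) + cos phi * (- sin phi * p1 + cos phi * p2))
  with p2 in H by (transitivity ((sin phi * sin phi + cos phi * cos phi) * p2); [rewrite S|]; ring).
exact H.
Qed.

(** * Clairaut's relation *)

Section Ray.
Variables (m g1 g2 : R -> R).
Hypothesis Hm : profile m.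
Hypothesis Hray : is_ray m g1 g2.

Definition radius t := rad (g1 t) (g2 t).
(** The derivative of the polar angle, written without choosing a branch of it. *)
Definition angvel t := (g1 t * Derive g2 t - g2 t * Derive g1 t) / radius t ^ 2.
Definition clairaut t := m (radius t) ^ 2 * angvel t.

Lemma ray_rdist s t : 0 <= s <= t -> rdist m (g1 s) (g2 s) (g1 t) (g2 t) = t - s.
Proof.
intros [H1 H2]. destruct Hray as [_ H]. specialize (H s t H1 H2).
unfold rdist. now rewrite H.
Qed.

Lemma ray_derive1 t : 0 < t -> is_derive g1 t (Derive g1 t).
Proof. intros Ht. apply Derive_correct, (proj1 Hray t Ht). Qed.

Lemma ray_derive2 t : 0 < t -> is_derive g2 t (Derive g2 t).
Proof. intros Ht. apply Derive_correct, (proj1 Hray t Ht). Qed.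

Lemma ray_unit_speed t : 0 < t -> radius t <> 0 ->
  ((g1 t * Derive g1 t + g2 t * Derive g2 t) / radius t) ^ 2 + (m (radius t) * angvel t) ^ 2 = 1.
Proof.
intros Ht Hr. destruct (proj1 Hray t Ht) as (_ & _ & H).
rewrite metric_polar in H by exact Hr. exact H.
Qed.

(** Rotating the start at rate [eta] replaces theta' by theta' - eta in the relative velocity. With
    unit speed its length is sqrt(1 - 2 eta c + eta^2 m^2), and sqrt(1 + z) <= 1 + z/2. *)
Lemma first_variation t eta kap : 0 < t -> radius t <> 0 -> 0 < kap ->
  exists e0, 0 < e0 /\ forall e, 0 < e < e0 ->
    rdist m (cos (eta * e) * g1 t - sin (eta * e) * g2 t)
            (sin (eta * e) * g1 t + cos (eta * e) * g2 t) (g1 (t + e)) (g2 (t + e)) <=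
    e * (1 - eta * clairaut t + eta ^ 2 * (m (radius t) ^ 2 / 2) + kap).
Proof.
intros Ht Hr Hk.
destruct (rdist_first_order m (fun e => cos (eta * e) * g1 t - sin (eta * e) * g2 t)
  (fun e => sin (eta * e) * g1 t + cos (eta * e) * g2 t) (fun e => g1 (t + e)) (fun e => g2 (t + e))
  (- eta * g2 t) (eta * g1 t) (Derive g1 t) (Derive g2 t) kap Hm) as (e0 & He0 & H).
- auto_derive; [trivial|]. rewrite Rmult_0_r, cos_0, sin_0. ring.
- auto_derive; [trivial|]. rewrite Rmult_0_r, cos_0, sin_0. ring.
- replace (Derive g1 t) with (1 * Derive g1 t) by ring.
  apply (is_derive_comp g1 (fun e => t + e) 0 (Derive g1 t) 1).
  + rewrite Rplus_0_r. now apply ray_derive1.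
  + auto_derive; [trivial|ring].
- replace (Derive g2 t) with (1 * Derive g2 t) by ring.
  apply (is_derive_comp g2 (fun e => t + e) 0 (Derive g2 t) 1).
  + rewrite Rplus_0_r. now apply ray_derive2.
  + auto_derive; [trivial|ring].
- rewrite Rmult_0_r, cos_0, sin_0, Rplus_0_r. ring.
- rewrite Rmult_0_r, cos_0, sin_0, Rplus_0_r. ring.
- exact Hk.
- exists e0. split; [exact He0|]. intros e He. eapply Rle_trans; [apply H, He|].
  apply Rmult_le_compat_l; [lra|]. apply Rplus_le_compat_r.
  rewrite Rmult_0_r, cos_0, sin_0.
  replace (1 * g1 t - 0 * g2 t) with (g1 t) by ring.
  replace (0 * g1 t + 1 * g2 t) with (g2 t) by ring.
  rewrite metric_polar by exact Hr. fold (radius t).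
  assert (U := ray_unit_speed t Ht Hr).
  replace (g1 t * (Derive g1 t - - eta * g2 t) + g2 t * (Derive g2 t - eta * g1 t))
    with (g1 t * Derive g1 t + g2 t * Derive g2 t) by ring.
  assert (R2 : radius t ^ 2 = g1 t ^ 2 + g2 t ^ 2) by apply rad_sqr.
  replace ((g1 t * (Derive g2 t - eta * g1 t) - g2 t * (Derive g1 t - - eta * g2 t)) / radius t ^ 2)
    with (angvel t - eta).
  2:{ unfold angvel. apply Rmult_eq_reg_r with (radius t ^ 2); [|now apply pow_nonzero].
      transitivity (g1 t * Derive g2 t - g2 t * Derive g1 t - eta * radius t ^ 2); [field; exact Hr|].
      transitivity (g1 t * (Derive g2 t - eta * g1 t) - g2 t * (Derive g1 t - - eta * g2 t)).
      - rewrite R2. ring.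
      - field. exact Hr. }
  set (X := _ / radius t) in *.
  replace (X ^ 2 + (m (radius t) * (angvel t - eta)) ^ 2) with
    (X ^ 2 + (m (radius t) * angvel t) ^ 2 + (- (2 * eta * clairaut t) + eta ^ 2 * m (radius t) ^ 2))
    by (unfold clairaut; ring).
  assert (P : 0 <= X ^ 2 + (m (radius t) * (angvel t - eta)) ^ 2)
    by (generalize (pow2_ge_0 X) (pow2_ge_0 (m (radius t) * (angvel t - eta))); lra).
  assert (Q : X ^ 2 + (m (radius t) * (angvel t - eta)) ^ 2 =
    X ^ 2 + (m (radius t) * angvel t) ^ 2 + (- (2 * eta * clairaut t) + eta ^ 2 * m (radius t) ^ 2))
    by (unfold clairaut; ring).
  rewrite Q, U in P. rewrite U.
  set (z := - (2 * eta * clairaut t) + eta ^ 2 * m (radius t) ^ 2) in *.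
  replace (1 - eta * clairaut t + eta ^ 2 * (m (radius t) ^ 2 / 2)) with (1 + z / 2) by (unfold z; field).
  rewrite <- (sqrt_pow2 (1 + z / 2)) by lra. apply sqrt_le_1_alt.
  generalize (pow2_ge_0 z). intros. nra.
Qed.

Lemma rotated_start_le s t eta kap : 0 < s < t -> radius s <> 0 -> 0 < kap ->
  exists e0, 0 < e0 /\ forall e, 0 < e < e0 ->
    rdist m (cos (eta * e) * g1 s - sin (eta * e) * g2 s)
            (sin (eta * e) * g1 s + cos (eta * e) * g2 s) (g1 t) (g2 t) <=
    t - s + e * (- eta * clairaut s + eta ^ 2 * (m (radius s) ^ 2 / 2) + kap).
Proof.
intros Hst Hr Hk. destruct (first_variation s eta kap) as (e0 & He0 & H); try tauto.
exists (Rmin e0 (t - s)). split; [apply Rmin_pos; lra|]. intros e He.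
generalize (Rmin_l e0 (t - s)) (Rmin_r e0 (t - s)). intros.
eapply Rle_trans; [apply (rdist_triangle m _ _ (g1 (s + e)) (g2 (s + e))), Hm|].
rewrite (ray_rdist (s + e) t) by lra. specialize (H e ltac:(lra)). lra.
Qed.

(** Going from g(s) to g(t) rotated by [eta * e], and then to g(t + 1), is not shorter than the ray.
    To first order in [e] the detour costs [eta * clairaut s] at the first end and
    [- eta * clairaut t] at the second. *)
Lemma clairaut_le s t eta : 0 < s < t -> radius s <> 0 -> radius t <> 0 ->
  0 <= eta * (clairaut s - clairaut t) + eta ^ 2 * (m (radius s) ^ 2 / 2 + m (radius t) ^ 2 / 2).
Proof.
intros Hst Hs Ht. apply le_epsilon. intros eps He.
destruct (rotated_start_le s t (- eta) (eps / 2)) as (e1 & He1 & H1); [lra|exact Hs|lra|].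
destruct (rotated_start_le t (t + 1) eta (eps / 2)) as (e2 & He2 & H2); [lra|exact Ht|lra|].
set (e := Rmin e1 e2 / 2).
assert (E0 : 0 < Rmin e1 e2) by (now apply Rmin_pos).
generalize (Rmin_l e1 e2) (Rmin_r e1 e2). intros.
assert (Ee : 0 < e) by (unfold e; lra).
specialize (H1 e ltac:(unfold e in *; lra)). specialize (H2 e ltac:(unfold e in *; lra)).
replace (- eta * e) with (- (eta * e)) in H1 by ring.
assert (H3 := rdist_rot_l m (eta * e) (g1 s) (g2 s) (g1 t) (g2 t) Hm).
assert (H4 := rdist_triangle m (g1 s) (g2 s) (cos (eta * e) * g1 t - sin (eta * e) * g2 t)
            (sin (eta * e) * g1 t + cos (eta * e) * g2 t) (g1 (t + 1)) (g2 (t + 1)) Hm).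
rewrite (ray_rdist s (t + 1)) in H4 by lra.
assert (H5 : 0 <= e * (eta * (clairaut s - clairaut t) +
  eta ^ 2 * (m (radius s) ^ 2 / 2 + m (radius t) ^ 2 / 2) + eps)) by nra.
apply Rmult_le_reg_l with e; [exact Ee|]. lra.
Qed.

(** A quadratic in [eta] that vanishes at 0 and is never negative has no linear term. Only the two
    ends enter, so the ray may cross the origin in between. *)
Lemma clairaut_const s t : 0 < s -> 0 < t -> radius s <> 0 -> radius t <> 0 -> clairaut s = clairaut t.
Proof.
assert (W : forall s t, 0 < s < t -> radius s <> 0 -> radius t <> 0 -> clairaut s = clairaut t).
{ clear s t. intros s t Hst Hs Ht.
  set (D := clairaut s - clairaut t). set (M := m (radius s) ^ 2 / 2 + m (radius t) ^ 2 / 2).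
  assert (HM : 0 <= M) by (unfold M; generalize (pow2_ge_0 (m (radius s))) (pow2_ge_0 (m (radius t))); lra).
  (* For this [eta] the quadratic equals -D^2 / (M + 1)^2; the added 1 keeps the denominator away
     from 0. *)
  assert (H := clairaut_le s t (- D / (M + 1)) Hst Hs Ht). fold D M in H.
  assert (H' : 0 <= - (D ^ 2) * / (M + 1) ^ 2).
  { eapply Rle_trans; [exact H|]. right. field. lra. }
  assert (0 < / (M + 1) ^ 2) by (apply Rinv_0_lt_compat; nra).
  destruct (Req_dec D 0) as [HD|HD]; [unfold D in HD; lra|exfalso].
  generalize (Rmult_lt_0_compat _ _ (pow2_gt_0 D HD) H0). lra. }
intros Hs Ht Rs Rt. destruct (Rtotal_order s t) as [L|[->|L]]; [|reflexivity|symmetry]; apply W; auto.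
Qed.

(* Otherwise the reflection of the ray in the meridian of its origin would
   meet the ray at time t, and the broken curve so obtained could be shortened. *)
Lemma no_opposite_point t lam : 0 < t -> 0 < lam -> radius 0 <> 0 ->
  g1 t = - lam * g1 0 -> g2 t = - lam * g2 0 ->
  (exists s, 0 < s < t /\ radius s <> 0) -> radius t <> 0 -> clairaut t = 0.
Proof.
intros Ht Hlam Hr0 E1 E2 (s & Hs & Hrs) Hrt.
destruct (Req_dec (clairaut t) 0) as [Hc|Hc]; [exact Hc|exfalso].
assert (Cs : clairaut s = clairaut t) by (apply clairaut_const; auto; lra).
set (c := clairaut t) in *.
set (M := m (radius s) ^ 2 / 2 + m (radius t) ^ 2 / 2).
assert (HM : 0 <= M) by (unfold M; generalize (pow2_ge_0 (m (radius s))) (pow2_ge_0 (m (radius t))); lra).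
(* In [clairaut_le] the two corners contribute with opposite signs; after the reflection both gain
   [eta * c]. As [eta * (M + 1) = c], the quadratic term is below one [eta * c], and the two errors
   take half of the rest. *)
set (eta := c / (M + 1)).
assert (Hprod : eta * (M + 1) = c) by (unfold eta; field; lra).
assert (Heta : 0 < eta * c).
{ replace (eta * c) with (c ^ 2 / (M + 1)) by (unfold eta; field; lra).
  apply Rdiv_lt_0_compat; [now apply pow2_gt_0|lra]. }
destruct (rotated_start_le s t eta (eta * c / 4)) as (e1 & He1 & H1); [lra|exact Hrs|lra|].
destruct (rotated_start_le t (t + 1) eta (eta * c / 4)) as (e2 & He2 & H2); [lra|exact Hrt|lra|].
set (e := Rmin e1 e2 / 2).
assert (E0 : 0 < Rmin e1 e2) by (now apply Rmin_pos).
generalize (Rmin_l e1 e2) (Rmin_r e1 e2). intros.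
assert (Ee : 0 < e) by (unfold e; lra).
specialize (H1 e ltac:(unfold e in *; lra)). specialize (H2 e ltac:(unfold e in *; lra)).
assert (H3 := rdist_rot_l m (- (eta * e)) (g1 s) (g2 s) (g1 t) (g2 t) Hm).
rewrite Ropp_involutive in H3.
assert (H4 := rdist_triangle m (g1 0) (g2 0) (g1 s) (g2 s)
   (cos (- (eta * e)) * g1 t - sin (- (eta * e)) * g2 t)
   (sin (- (eta * e)) * g1 t + cos (- (eta * e)) * g2 t) Hm).
rewrite (ray_rdist 0 s) in H4 by lra.
assert (H5 := rdist_triangle m (g1 0) (g2 0) (cos (eta * e) * g1 t - sin (eta * e) * g2 t)
            (sin (eta * e) * g1 t + cos (eta * e) * g2 t) (g1 (t + 1)) (g2 (t + 1)) Hm).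
rewrite (ray_rdist 0 (t + 1)) in H5 by lra.
assert (R2 : radius 0 ^ 2 = g1 0 ^ 2 + g2 0 ^ 2) by apply rad_sqr.
assert (R4 : radius 0 ^ 2 <> 0) by now apply pow_nonzero.
(* The cosine and sine of twice the polar angle of g(0): with sign -1 the isometry is the reflection
   in the line through g(0). It contains g(t), so rotations of g(t) by opposite angles are
   exchanged. *)
set (al := (g1 0 ^ 2 - g2 0 ^ 2) / radius 0 ^ 2). set (be := 2 * g1 0 * g2 0 / radius 0 ^ 2).
assert (Hab : al ^ 2 + be ^ 2 = 1).
{ transitivity ((g1 0 ^ 2 + g2 0 ^ 2) ^ 2 / (radius 0 ^ 2) ^ 2); [unfold al, be; field; exact Hr0|].
  rewrite <- R2. field. exact Hr0. }
assert (F1 : al * g1 0 + be * g2 0 = g1 0).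
{ transitivity (g1 0 * (g1 0 ^ 2 + g2 0 ^ 2) / radius 0 ^ 2); [unfold al, be; field; exact Hr0|].
  rewrite <- R2. field. exact Hr0. }
assert (F2 : be * g1 0 - al * g2 0 = g2 0).
{ transitivity (g2 0 * (g1 0 ^ 2 + g2 0 ^ 2) / radius 0 ^ 2); [unfold al, be; field; exact Hr0|].
  rewrite <- R2. field. exact Hr0. }
assert (H6 := rdist_isometry m al be (-1) (g1 0) (g2 0)
   (cos (- (eta * e)) * g1 t - sin (- (eta * e)) * g2 t)
   (sin (- (eta * e)) * g1 t + cos (- (eta * e)) * g2 t) Hm Hab ltac:(ring)).
replace (al * g1 0 - -1 * be * g2 0) with (g1 0) in H6 by (rewrite <- F1 at 1; ring).
replace (be * g1 0 + -1 * al * g2 0) with (g2 0) in H6 by (rewrite <- F2 at 1; ring).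
rewrite !cos_neg, !sin_neg in *. set (C := cos (eta * e)) in *. set (S := sin (eta * e)) in *.
replace (al * (C * g1 t - - S * g2 t) - -1 * be * (- S * g1 t + C * g2 t))
  with (C * g1 t - S * g2 t) in H6.
2:{ rewrite E1, E2. transitivity (- lam * (C * (al * g1 0 + be * g2 0) - S * (be * g1 0 - al * g2 0))).
    - rewrite F1, F2. ring.
    - ring. }
replace (be * (C * g1 t - - S * g2 t) + -1 * al * (- S * g1 t + C * g2 t))
  with (S * g1 t + C * g2 t) in H6.
2:{ rewrite E1, E2. transitivity (- lam * (C * (be * g1 0 - al * g2 0) + S * (al * g1 0 + be * g2 0))).
    - rewrite F1, F2. ring.
    - ring. }
rewrite Cs in H1. fold c in H2.
assert (H7 : 0 <= e * (- 2 * (eta * c) + eta ^ 2 * M + eta * c / 2)) by (unfold M; lra).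
assert (H8 : - 2 * (eta * c) + eta ^ 2 * M + eta * c / 2 < 0).
{ assert (H8 : eta ^ 2 * M = eta * (eta * (M + 1)) - eta ^ 2) by ring.
  rewrite Hprod in H8. generalize (pow2_ge_0 eta). lra. }
nra.
Qed.

End Ray.

(** * One-sided limits and crossing times *)

Lemma init_vel_eps g v : init_vel g v -> forall eps, 0 < eps ->
  exists d, 0 < d /\ forall h, 0 < h < d -> Rabs ((g h - g 0) / h - v) < eps.
Proof.
intros H eps He.
destruct (proj1 (filterlim_locally _ v) H (mkposreal eps He)) as [d Hd].
exists d. split; [apply cond_pos|]. intros h Hh.
apply (Hd h); [|lra]. change (Rabs (h - 0) < d). rewrite Rminus_0_r, Rabs_pos_eq; lra.
Qed.

Lemma continuous_eps (f : R -> R) (x : R) :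
  (forall eps, 0 < eps -> exists d, 0 < d /\ forall y, Rabs (y - x) < d -> Rabs (f y - f x) < eps) <->
  continuous f x.
Proof.
split.
- intros H. apply filterlim_locally. intros eps.
  destruct (H eps (cond_pos eps)) as (d & Hd & K). exists (mkposreal d Hd). exact K.
- intros H eps He.
  destruct (proj1 (filterlim_locally f (f x)) H (mkposreal eps He)) as [d Hd].
  exists d. split; [apply cond_pos|]. exact Hd.
Qed.

Lemma last_zero (f : R -> R) (s t : R) : (forall u, continuous f u) -> s <= t ->
  f s <= 0 -> 0 < f t -> exists u, s <= u < t /\ f u = 0 /\ forall v, u < v <= t -> 0 < f v.
Proof.
intros Hf Hst Hs Ht.
destruct (completeness (fun v => s <= v <= t /\ f v <= 0)) as [u [Hub Hlub]].
- exists t. intros v [Hv _]. lra.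
- exists s. split; [lra|exact Hs].
- assert (Hu1 : s <= u) by (apply Hub; split; [lra|exact Hs]).
  assert (Hu2 : u <= t) by (apply Hlub; intros v [Hv _]; lra).
  assert (Hafter : forall v, u < v <= t -> 0 < f v).
  { intros v Hv. apply Rnot_le_lt. intros Hle.
    assert (v <= u) by (apply Hub; split; [lra|exact Hle]). lra. }
  assert (Hu3 : f u <= 0).
  { apply Rnot_lt_le. intros Hlt.
    destruct (proj2 (continuous_eps f u) (Hf u) (f u) Hlt) as (d & Hd & K).
    assert (u <= u - d).
    { apply Hlub. intros v [Hv Hv0]. apply Rnot_lt_le. intros Hv1.
      assert (v <= u) by (apply Hub; split; assumption).
      specialize (K v ltac:(apply Rabs_def1; lra)). apply Rabs_def2 in K. lra. }
    lra. }
  assert (Hu4 : u < t) by (destruct Hu2 as [|E]; [assumption|rewrite E in Hu3; lra]).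
  exists u. split; [lra|]. split; [|exact Hafter].
  apply Rle_antisym; [exact Hu3|]. apply Rnot_lt_le. intros Hlt.
  destruct (proj2 (continuous_eps f u) (Hf u) (- f u) ltac:(lra)) as (d & Hd & K).
  set (v := Rmin t (u + d / 2)).
  assert (Hv : u < v <= t).
  { unfold v. split; [apply Rmin_glb_lt; lra|apply Rmin_l]. }
  assert (v <= u + d / 2) by apply Rmin_r.
  specialize (K v ltac:(apply Rabs_def1; lra)). apply Rabs_def2 in K.
  specialize (Hafter v Hv). lra.
Qed.

Lemma first_zero (f : R -> R) (s t : R) : (forall u, continuous f u) -> s <= t ->
  0 < f s -> f t <= 0 -> exists u, s < u <= t /\ f u = 0 /\ forall v, s <= v < u -> 0 < f v.
Proof.
intros Hf Hst Hs Ht.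
destruct (last_zero (fun u => f (- u)) (- t) (- s)) as (u & Hu & E & H).
- intros u. apply (continuous_Rcomp f); [|apply Hf].
  apply (continuous_opp (V := R_NormedModule) (fun u => u)). apply continuous_id.
- lra.
- now rewrite Ropp_involutive.
- now rewrite Ropp_involutive.
- exists (- u). split; [lra|]. split; [exact E|].
  intros v Hv. rewrite <- (Ropp_involutive v). apply H. lra.
Qed.

Lemma continuous_clamp (g : R -> R) (w : R) :
  (forall t, 0 < t -> ex_derive g t) -> init_vel g w ->
  forall t, continuous (fun u => g (Rmax 0 u)) t.
Proof.
intros Hd Hw t. destruct (Rtotal_order t 0) as [Ht|[->|Ht]].
- apply continuous_ext_loc with (fun _ => g 0); [|apply continuous_const].
  exists (mkposreal (- t) ltac:(lra)). intros u Hu. change (Rabs (u - t) < - t) in Hu.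
  apply Rabs_def2 in Hu. rewrite Rmax_left by lra. reflexivity.
- apply continuous_eps. intros eps He.
  destruct (init_vel_eps g w Hw 1 Rlt_0_1) as (d & Hd0 & H).
  assert (HW : 0 < Rabs w + 1) by (generalize (Rabs_pos w); lra).
  exists (Rmin d (eps / (Rabs w + 1))).
  split; [apply Rmin_pos; [lra|now apply Rdiv_lt_0_compat]|].
  intros y Hy. rewrite Rminus_0_r in Hy. rewrite (Rmax_left 0 0) by lra.
  destruct (Rle_dec y 0) as [Hy0|Hy0].
  { rewrite Rmax_left by lra. rewrite Rminus_diag, Rabs_R0. exact He. }
  rewrite Rmax_right by lra. rewrite Rabs_pos_eq in Hy by lra.
  generalize (Rmin_l d (eps / (Rabs w + 1))) (Rmin_r d (eps / (Rabs w + 1))). intros.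
  specialize (H y ltac:(lra)).
  assert (Hb : Rabs ((g y - g 0) / y) <= Rabs w + 1).
  { replace ((g y - g 0) / y) with (w + ((g y - g 0) / y - w)) by ring.
    eapply Rle_trans; [apply Rabs_triang|]. lra. }
  replace (g y - g 0) with (y * ((g y - g 0) / y)) by (field; lra).
  rewrite Rabs_mult, (Rabs_pos_eq y) by lra.
  apply Rle_lt_trans with (y * (Rabs w + 1)); [apply Rmult_le_compat_l; lra|].
  replace eps with (eps / (Rabs w + 1) * (Rabs w + 1)) by (field; lra).
  apply Rmult_lt_compat_r; lra.
- apply continuous_ext_loc with g.
  + exists (mkposreal t Ht). intros u Hu. change (Rabs (u - t) < t) in Hu.
    apply Rabs_def2 in Hu. rewrite Rmax_right by lra. reflexivity.
  + apply (@ex_derive_continuous R_AbsRing R_NormedModule). now apply Hd.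
Qed.

Lemma constant_of_derive_0 (f : R -> R) (a b : R) : a <= b ->
  (forall t, a <= t <= b -> continuous f t) -> (forall t, a < t < b -> is_derive f t 0) -> f a = f b.
Proof.
intros Hab Hc Hd. apply Rle_antisym.
- apply (nondecreasing_of_derive_nonneg f (fun _ => 0)); auto. intros; split; [auto|lra].
- assert (H : - f a <= - f b); [|lra].
  apply (nondecreasing_of_derive_nonneg (fun t => - f t) (fun _ => 0)); auto.
  + intros t Ht. apply (continuous_opp (V := R_NormedModule) f). auto.
  + intros t Ht. split; [|lra]. rewrite <- Ropp_0.
    apply (is_derive_opp f t 0). auto.
Qed.

(** * Polar coordinates along a ray *)

Section RayPolar.
Variables (m g1 g2 : R -> R) (w1 w2 c : R).
Hypothesis Hm : profile m.
Hypothesis Hpos : forall r, 0 < r -> 0 < m r.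
Hypothesis Hray : is_ray m g1 g2.
Hypothesis Hw1 : init_vel g1 w1.
Hypothesis Hw2 : init_vel g2 w2.
Hypothesis Hr0 : 0 < radius g1 g2 0.
Hypothesis Hdot : g1 0 * w1 + g2 0 * w2 <= 0.

Notation r := (radius g1 g2).
(* Constant for t <= 0, so that one-sided continuity at 0 becomes continuity. *)
Definition cradius t := r (Rmax 0 t).
Definition radvel t := (g1 t * Derive g1 t + g2 t * Derive g2 t) / r t.

Lemma cradius_pos_eq t : 0 <= t -> cradius t = r t.
Proof. intros Ht. unfold cradius. now rewrite Rmax_right. Qed.

Lemma continuous_c1 t : continuous (fun u => g1 (Rmax 0 u)) t.
Proof. apply (continuous_clamp g1 w1); [|exact Hw1]. intros. now apply Hray. Qed.

Lemma continuous_c2 t : continuous (fun u => g2 (Rmax 0 u)) t.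
Proof. apply (continuous_clamp g2 w2); [|exact Hw2]. intros. now apply Hray. Qed.

Lemma continuous_cradius t : continuous cradius t.
Proof.
unfold cradius, radius, rad. assert (H1 := continuous_c1 t). assert (H2 := continuous_c2 t).
apply continuous_Rsqrt, continuous_Rplus; now apply continuous_pow2.
Qed.

Lemma locally_pos_clamp (f : R -> R) (t : R) : 0 < t -> locally t (fun u => f u = f (Rmax 0 u)).
Proof.
intros Ht. exists (mkposreal t Ht). intros u Hu. change (Rabs (u - t) < t) in Hu.
apply Rabs_def2 in Hu. rewrite Rmax_right by lra. reflexivity.
Qed.

Lemma is_derive_cradius t : 0 < t -> r t <> 0 -> is_derive cradius t (radvel t).
Proof.
intros Ht Hr. apply is_derive_ext_loc with r; [now apply (locally_pos_clamp r)|].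
assert (D1 := ray_derive1 m g1 g2 Hray t Ht). assert (D2 := ray_derive2 m g1 g2 Hray t Ht).
assert (P : 0 < g1 t ^ 2 + g2 t ^ 2).
{ rewrite <- rad_sqr. apply pow2_gt_0. exact Hr. }
replace (radvel t) with ((2 * Derive g1 t * g1 t ^ 1 + 2 * Derive g2 t * g2 t ^ 1) / (2 * sqrt (g1 t ^ 2 + g2 t ^ 2))).
2:{ unfold radvel. change (sqrt (g1 t ^ 2 + g2 t ^ 2)) with (r t). field. exact Hr. }
apply (is_derive_sqrt (fun u => g1 u ^ 2 + g2 u ^ 2)); [|exact P].
apply (is_derive_plus (fun u => g1 u ^ 2) (fun u => g2 u ^ 2)).
- exact (is_derive_pow g1 2 t _ D1).
- exact (is_derive_pow g2 2 t _ D2).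
Qed.

(** A weak form of r'(0) <= 0, at some arbitrarily small times. It is proved for r^2, whose
    difference quotient is 2 g(0).v + h |v|^2 with v the difference quotient of the ray. *)
Lemma cradius_inward sig d : 0 < sig -> 0 < d -> exists h, 0 < h < d /\ cradius h - r 0 < sig * h.
Proof.
intros Hs Hd. apply Classical_Prop.NNPP. intros Hn.
assert (HN : forall h, 0 < h < d -> sig * h <= r h - r 0).
{ intros h Hh. apply Rnot_lt_le. intros Hlt. apply Hn. exists h. split; [exact Hh|].
  rewrite cradius_pos_eq by lra. exact Hlt. }
assert (HN2 : forall h, 0 < h < d -> sig * r 0 <= (r h ^ 2 - r 0 ^ 2) / h).
{ intros h Hh. specialize (HN h Hh). apply Rmult_le_reg_r with h; [lra|].
  replace ((r h ^ 2 - r 0 ^ 2) / h * h) with ((r h - r 0) * (r h + r 0)) by (field; lra).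
  assert (0 < sig * h) by nra. nra. }
(* With this [eps] the error in the velocity contributes at most [sig * r 0 / 2] to the quotient of
   r^2; the choice of [h] below keeps the term h |v|^2 under [sig * r 0 / 4]. Together they stay
   below the assumed [sig * r 0]. *)
set (eps := Rmin 1 (sig * r 0 / (4 * (Rabs (g1 0) + Rabs (g2 0) + Rabs w1 + Rabs w2 + 1)))).
set (N := Rabs (g1 0) + Rabs (g2 0) + Rabs w1 + Rabs w2 + 1) in *.
assert (HNp : 1 <= N).
{ unfold N. generalize (Rabs_pos (g1 0)) (Rabs_pos (g2 0)) (Rabs_pos w1) (Rabs_pos w2). lra. }
assert (Hsr : 0 < sig * r 0) by nra.
assert (He : 0 < eps) by (apply Rmin_pos; [lra|apply Rdiv_lt_0_compat; lra]).
destruct (init_vel_eps _ _ Hw1 eps He) as (d1 & Hd1 & K1).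
destruct (init_vel_eps _ _ Hw2 eps He) as (d2 & Hd2 & K2).
set (L := (Rabs w1 + 1) ^ 2 + (Rabs w2 + 1) ^ 2).
assert (HL : 0 < L) by (unfold L; generalize (Rabs_pos w1) (Rabs_pos w2); intros; nra).
set (h := Rmin (Rmin d (sig * r 0 / (2 * L))) (Rmin d1 d2) / 2).
assert (Hmin : 0 < Rmin (Rmin d (sig * r 0 / (2 * L))) (Rmin d1 d2)).
{ repeat apply Rmin_pos; try lra. apply Rdiv_lt_0_compat; lra. }
generalize (Rmin_l (Rmin d (sig * r 0 / (2 * L))) (Rmin d1 d2)) (Rmin_r (Rmin d (sig * r 0 / (2 * L))) (Rmin d1 d2))
  (Rmin_l d (sig * r 0 / (2 * L))) (Rmin_r d (sig * r 0 / (2 * L))) (Rmin_l d1 d2) (Rmin_r d1 d2). intros.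
assert (Hh : 0 < h) by (unfold h; lra).
specialize (K1 h ltac:(unfold h in *; lra)). specialize (K2 h ltac:(unfold h in *; lra)).
specialize (HN2 h ltac:(unfold h in *; lra)).
set (v1 := (g1 h - g1 0) / h) in *. set (v2 := (g2 h - g2 0) / h) in *.
assert (E : (r h ^ 2 - r 0 ^ 2) / h = 2 * (g1 0 * v1 + g2 0 * v2) + h * (v1 ^ 2 + v2 ^ 2)).
{ unfold radius. rewrite !rad_sqr. unfold v1, v2. field. lra. }
rewrite E in HN2.
assert (He1 : eps <= 1) by apply Rmin_l.
assert (He2 : eps * (4 * N) <= sig * r 0).
{ apply Rle_trans with (sig * r 0 / (4 * N) * (4 * N)); [|right; field; lra].
  apply Rmult_le_compat_r; [lra|apply Rmin_r]. }
assert (X1 : Rabs v1 <= Rabs w1 + 1).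
{ replace v1 with (w1 + (v1 - w1)) by ring. eapply Rle_trans; [apply Rabs_triang|]. lra. }
assert (X2 : Rabs v2 <= Rabs w2 + 1).
{ replace v2 with (w2 + (v2 - w2)) by ring. eapply Rle_trans; [apply Rabs_triang|]. lra. }
assert (Y : v1 ^ 2 + v2 ^ 2 <= L).
{ unfold L. rewrite <- (pow2_abs v1), <- (pow2_abs v2).
  generalize (Rabs_pos v1) (Rabs_pos v2). intros.
  apply Rplus_le_compat; apply pow_incr; lra. }
assert (Z1 : g1 0 * (v1 - w1) <= Rabs (g1 0) * eps).
{ apply Rle_trans with (Rabs (g1 0 * (v1 - w1))); [apply Rle_abs|]. rewrite Rabs_mult.
  apply Rmult_le_compat_l; [apply Rabs_pos|lra]. }
assert (Z2 : g2 0 * (v2 - w2) <= Rabs (g2 0) * eps).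
{ apply Rle_trans with (Rabs (g2 0 * (v2 - w2))); [apply Rle_abs|]. rewrite Rabs_mult.
  apply Rmult_le_compat_l; [apply Rabs_pos|lra]. }
assert (Y2 : h * (v1 ^ 2 + v2 ^ 2) <= sig * r 0 / (2 * L) / 2 * L).
{ apply Rle_trans with (h * L); [apply Rmult_le_compat_l; lra|].
  apply Rmult_le_compat_r; [lra|]. unfold h. lra. }
replace (sig * r 0 / (2 * L) / 2 * L) with (sig * r 0 / 4) in Y2 by (field; lra).
assert (Y3 : eps * (4 * N) >= 4 * (Rabs (g1 0) * eps + Rabs (g2 0) * eps)).
{ unfold N. generalize (Rabs_pos (g1 0)) (Rabs_pos (g2 0)) (Rabs_pos w1) (Rabs_pos w2). intros.
  assert (0 <= eps * Rabs w1) by (apply Rmult_le_pos; lra).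
  assert (0 <= eps * Rabs w2) by (apply Rmult_le_pos; lra). lra. }
clear - HN2 Hdot Z1 Z2 Y2 Y3 He2 Hsr He. lra.
Qed.

(** The unit position vector replaces the polar angle, which has no global branch; it rotates at
    rate [angvel]. *)
Lemma unit_derive t : 0 < t -> r t <> 0 ->
  is_derive (fun u => g1 (Rmax 0 u) / cradius u) t (- (g2 t / r t * angvel g1 g2 t)) /\
  is_derive (fun u => g2 (Rmax 0 u) / cradius u) t (g1 t / r t * angvel g1 g2 t).
Proof.
intros Ht Hr.
assert (R2 : r t ^ 2 = g1 t ^ 2 + g2 t ^ 2) by apply rad_sqr.
assert (D := is_derive_cradius t Ht Hr).
assert (Hcr : cradius t <> 0) by (rewrite cradius_pos_eq; lra).
assert (D1 : is_derive (fun u => g1 (Rmax 0 u)) t (Derive g1 t)).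
{ apply (is_derive_ext_loc g1); [now apply (locally_pos_clamp g1)|now apply (ray_derive1 m g1 g2)]. }
assert (D2 : is_derive (fun u => g2 (Rmax 0 u)) t (Derive g2 t)).
{ apply (is_derive_ext_loc g2); [now apply (locally_pos_clamp g2)|now apply (ray_derive2 m g1 g2)]. }
split.
- replace (- (g2 t / r t * angvel g1 g2 t)) with
    ((Derive g1 t * cradius t - g1 (Rmax 0 t) * radvel t) / cradius t ^ 2).
  + exact (is_derive_div (fun u => g1 (Rmax 0 u)) cradius t _ _ D1 D Hcr).
  + rewrite Rmax_right, cradius_pos_eq by lra.
    transitivity ((Derive g1 t * r t ^ 2 - g1 t * (g1 t * Derive g1 t + g2 t * Derive g2 t)) / r t ^ 3).
    * unfold radvel. field. exact Hr.
    * rewrite R2 at 1. unfold angvel. field. exact Hr.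
- replace (g1 t / r t * angvel g1 g2 t) with
    ((Derive g2 t * cradius t - g2 (Rmax 0 t) * radvel t) / cradius t ^ 2).
  + exact (is_derive_div (fun u => g2 (Rmax 0 u)) cradius t _ _ D2 D Hcr).
  + rewrite Rmax_right, cradius_pos_eq by lra.
    transitivity ((Derive g2 t * r t ^ 2 - g2 t * (g1 t * Derive g1 t + g2 t * Derive g2 t)) / r t ^ 3).
    * unfold radvel. field. exact Hr.
    * rewrite R2 at 1. unfold angvel. field. exact Hr.
Qed.

Lemma r_nonneg t : 0 <= r t.
Proof. apply rad_nonneg. Qed.

Lemma r_zero_unique s t : 0 <= s <= t -> r s = 0 -> r t = 0 -> s = t.
Proof.
intros Hst Hs Ht. assert (H := ray_rdist m g1 g2 Hray s t Hst).
destruct (rad_eq0 _ _ Hs) as [E1 E2]. destruct (rad_eq0 _ _ Ht) as [E3 E4].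
rewrite E1, E2, E3, E4, rdist_refl in H by exact Hm. lra.
Qed.

(** * Rays along a meridian *)

Section Radial.
Hypothesis Hcl0 : forall t, 0 < t -> r t <> 0 -> clairaut m g1 g2 t = 0.

Lemma cradius_nonneg t : 0 <= cradius t.
Proof. apply r_nonneg. Qed.

Lemma angvel_0 t : 0 < t -> r t <> 0 -> angvel g1 g2 t = 0.
Proof.
intros Ht Hr. assert (E := Hcl0 t Ht Hr). unfold clairaut in E.
assert (P : 0 < m (r t)) by (apply Hpos; generalize (r_nonneg t); lra).
apply Rmult_integral in E. destruct E as [E|E]; [|exact E].
exfalso. revert E. apply pow_nonzero. lra.
Qed.

Lemma unit_const s t : 0 <= s <= t -> (forall u, s <= u <= t -> 0 < cradius u) ->
  g1 t / r t = g1 s / r s /\ g2 t / r t = g2 s / r s.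
Proof.
intros Hst Hp.
assert (C : forall g : R -> R, (forall u, continuous (fun v => g (Rmax 0 v)) u) ->
  forall u, s <= u <= t -> continuous (fun v => g (Rmax 0 v) / cradius v) u).
{ intros g Hg u Hu. unfold Rdiv. apply continuous_Rmult; [apply Hg|].
  apply continuous_Rinv_fun; [apply continuous_cradius|]. generalize (Hp u Hu). lra. }
assert (Dz : forall u, s < u < t -> r u <> 0).
{ intros u Hu. generalize (Hp u ltac:(lra)). rewrite cradius_pos_eq by lra. lra. }
split.
- assert (X := constant_of_derive_0 (fun u => g1 (Rmax 0 u) / cradius u) s t ltac:(lra) (C g1 continuous_c1)).
  cbv beta in X. rewrite !Rmax_right, !cradius_pos_eq in X by lra. symmetry. apply X.
  intros u Hu. destruct (unit_derive u ltac:(lra) (Dz u Hu)) as [U _].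
  apply (is_derive_eq _ _ _ _ U). rewrite angvel_0; [ring|lra|now apply Dz].
- assert (X := constant_of_derive_0 (fun u => g2 (Rmax 0 u) / cradius u) s t ltac:(lra) (C g2 continuous_c2)).
  cbv beta in X. rewrite !Rmax_right, !cradius_pos_eq in X by lra. symmetry. apply X.
  intros u Hu. destruct (unit_derive u ltac:(lra) (Dz u Hu)) as [_ U].
  apply (is_derive_eq _ _ _ _ U). rewrite angvel_0; [ring|lra|now apply Dz].
Qed.

(** Without angular velocity r' is 1 or -1 at each time, but r' is not known to be continuous. One
    mean value point already decides between the two increments. *)
Lemma cradius_unit_slope s t : 0 <= s < t -> (forall u, s < u < t -> 0 < cradius u) ->
  cradius t - cradius s = t - s \/ cradius t - cradius s = - (t - s).
Proof.
intros Hst Hp.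
assert (Dz : forall u, s < u < t -> r u <> 0).
{ intros u Hu. generalize (Hp u Hu). rewrite cradius_pos_eq by lra. lra. }
destruct (MVT_open cradius radvel s t) as (u & Hu & E).
- lra.
- intros; apply continuous_cradius.
- intros; apply is_derive_cradius; [lra|now apply Dz].
- assert (U := ray_unit_speed m g1 g2 Hray u ltac:(lra) (Dz u Hu)).
  fold (radvel u) in U. rewrite angvel_0 in U by (try apply Dz; lra).
  assert (F : (radvel u - 1) * (radvel u + 1) = 0) by (ring_simplify; lra).
  rewrite E. apply Rmult_integral in F. destruct F as [F|F].
  + left. replace (radvel u) with 1 by lra. ring.
  + right. replace (radvel u) with (-1) by lra. ring.
Qed.

Lemma cradius_decreasing t : 0 < t -> (forall u, 0 < u < t -> 0 < cradius u) -> cradius t = r 0 - t.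
Proof.
intros Ht Hp.
destruct (cradius_inward (1 / 2) t ltac:(lra) Ht) as (h & Hh & Hlow).
assert (E0 : cradius 0 = r 0) by (apply cradius_pos_eq; lra).
assert (Sh : cradius h - cradius 0 = - (h - 0)).
{ destruct (cradius_unit_slope 0 h) as [E|E]; [lra|intros; apply Hp; lra|lra|exact E]. }
destruct (cradius_unit_slope 0 t) as [E|E]; [lra|exact Hp| |lra].
(* The radius went down until [h]; if it were above its initial value at [t], it would take that
   value again at some [u], where the increment from 0 would be neither [u] nor [- u]. *)
exfalso. destruct (IVT_gen cradius h t (cradius 0)) as (u & Hu & Eu).
- intros u. apply continuity_pt_filterlim, continuous_cradius.
- rewrite Rmin_left, Rmax_right by lra. lra.
- rewrite Rmin_left, Rmax_right in Hu by lra.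
  destruct (cradius_unit_slope 0 u) as [F|F]; [lra|intros; apply Hp; lra|lra|lra].
Qed.

Lemma cradius_before t : 0 < t <= r 0 -> cradius t = r 0 - t.
Proof.
assert (Hz : exists T, 0 <= T <= r 0 /\ cradius T <= 0).
{ apply Classical_Prop.NNPP. intros Hn.
  assert (Hp : forall u, 0 <= u <= r 0 -> 0 < cradius u).
  { intros u Hu. apply Rnot_le_lt. intros Hle. apply Hn. now exists u. }
  assert (E := cradius_decreasing (r 0) Hr0 ltac:(intros; apply Hp; lra)).
  generalize (Hp (r 0) ltac:(lra)). lra. }
destruct Hz as (T & HT & HT0).
destruct (first_zero cradius 0 T continuous_cradius) as (t0 & Ht0 & E0 & Hbef);
  [lra|rewrite cradius_pos_eq; lra|exact HT0|].
assert (E := cradius_decreasing t0 ltac:(lra) ltac:(intros; apply Hbef; lra)).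
intros Ht. apply cradius_decreasing; [lra|]. intros; apply Hbef; lra.
Qed.

Lemma cradius_after t : r 0 < t -> cradius t = t - r 0.
Proof.
intros Ht. assert (E0 : cradius (r 0) = 0) by (rewrite cradius_before; lra).
assert (Hp : forall u, r 0 < u -> 0 < cradius u).
{ intros u Hu. destruct (Rle_lt_or_eq_dec _ _ (cradius_nonneg u)) as [|E]; [assumption|exfalso].
  assert (r 0 = u); [|lra]. rewrite cradius_pos_eq in E, E0 by lra.
  apply r_zero_unique; [lra|exact E0|now symmetry]. }
specialize (Hp t Ht) as Hpt.
destruct (cradius_unit_slope (r 0) t) as [E|E]; [lra|intros; apply Hp; lra|lra|lra].
Qed.

(** At the origin a vanishing Clairaut constant leaves the outgoing direction free;
    differentiability there forces the ray to go straight on. *)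
Lemma derive_corner (g : R -> R) (rho e f l : R) : 0 < rho -> is_derive g rho l -> g rho = 0 ->
  (forall t, 0 < t < rho -> g t = (rho - t) * e) -> (forall t, rho < t -> g t = (t - rho) * f) -> f = - e.
Proof.
intros Hrho Hd H0 H1 H2. apply is_derive_Reals in Hd.
assert (X : forall eps, 0 < eps -> Rabs (f + e) <= 0 + eps).
{ intros eps He. destruct (Hd (eps / 2) ltac:(lra)) as [d K]. assert (Hdp := cond_pos d).
  set (h := Rmin d rho / 2).
  assert (0 < Rmin d rho) by (now apply Rmin_pos).
  generalize (Rmin_l d rho) (Rmin_r d rho). intros. assert (Hh : 0 < h) by (unfold h; lra).
  assert (K1 := K h ltac:(lra) ltac:(rewrite Rabs_pos_eq; unfold h in *; lra)).
  assert (K2 := K (- h) ltac:(lra) ltac:(rewrite Rabs_Ropp, Rabs_pos_eq; unfold h in *; lra)).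
  rewrite H0, H2 in K1 by lra. rewrite H0, H1 in K2 by (unfold h in *; lra).
  replace (((rho + h - rho) * f - 0) / h) with f in K1 by (field; lra).
  replace (((rho - (rho + - h)) * e - 0) / - h) with (- e) in K2 by (field; lra).
  apply Rabs_def2 in K1, K2. apply Rabs_le. lra. }
assert (Y : Rabs (f + e) <= 0) by (apply le_epsilon; exact X).
generalize (Rabs_pos (f + e)). intros.
assert (f + e = 0) by (apply Rabs_eq_0; lra). lra.
Qed.

Lemma radial_ray t : 0 < t -> rdist m (g1 0) (g2 0) (- t / r 0 * g1 0) (- t / r 0 * g2 0) = r 0 + t.
Proof.
intros Ht.
assert (E0 : r (r 0) = 0) by (rewrite <- cradius_pos_eq, cradius_before; lra).
destruct (rad_eq0 _ _ E0) as [Z1 Z2].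
assert (Before : forall u, 0 < u < r 0 ->
  g1 u = (r 0 - u) * (g1 0 / r 0) /\ g2 u = (r 0 - u) * (g2 0 / r 0)).
{ intros u Hu. destruct (unit_const 0 u) as [X1 X2]; [lra| |].
  - intros v Hv. destruct (proj1 Hv) as [Hv0| <-]; [rewrite cradius_before; lra|rewrite cradius_pos_eq; lra].
  - rewrite <- X1, <- X2. replace (r 0 - u) with (r u) by (rewrite <- cradius_pos_eq, cradius_before; lra).
    assert (r u <> 0) by (rewrite <- cradius_pos_eq, cradius_before; lra). split; field; assumption. }
assert (After : forall s u, r 0 < s <= u -> 
  g1 u = (u - r 0) * (g1 s / r s) /\ g2 u = (u - r 0) * (g2 s / r s)).
{ intros s u Hsu. destruct (unit_const s u) as [X1 X2]; [lra| |].
  - intros v Hv. rewrite cradius_after; lra.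
  - rewrite <- X1, <- X2. replace (u - r 0) with (r u) by (rewrite <- cradius_pos_eq, cradius_after; lra).
    assert (r u <> 0) by (rewrite <- cradius_pos_eq, cradius_after; lra). split; field; assumption. }
set (u1 := r 0 + t).
assert (Ru : r u1 = t) by (unfold u1; rewrite <- cradius_pos_eq, cradius_after; lra).
assert (After' : forall u, r 0 < u ->
  g1 u = (u - r 0) * (g1 u1 / t) /\ g2 u = (u - r 0) * (g2 u1 / t)).
{ intros u Hu. destruct (Rle_dec u1 u) as [L|L].
  - rewrite <- Ru. apply After. unfold u1 in *; lra.
  - destruct (After u u1) as [X1 X2]; [lra|].
    assert (Eu : r u = u - r 0) by (rewrite <- cradius_pos_eq, cradius_after; lra).
    rewrite X1, X2, Eu. unfold u1. split; field; lra. }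
assert (F1 := derive_corner g1 (r 0) (g1 0 / r 0) (g1 u1 / t) _ Hr0
  (ray_derive1 m g1 g2 Hray _ Hr0) Z1 (fun u Hu => proj1 (Before u Hu)) (fun u Hu => proj1 (After' u Hu))).
assert (F2 := derive_corner g2 (r 0) (g2 0 / r 0) (g2 u1 / t) _ Hr0
  (ray_derive2 m g1 g2 Hray _ Hr0) Z2 (fun u Hu => proj2 (Before u Hu)) (fun u Hu => proj2 (After' u Hu))).
replace (- t / r 0 * g1 0) with (g1 u1).
2:{ transitivity (t * (g1 u1 / t)); [field; lra|]. rewrite F1. field. lra. }
replace (- t / r 0 * g2 0) with (g2 u1).
2:{ transitivity (t * (g2 u1 / t)); [field; lra|]. rewrite F2. field. lra. }
rewrite (ray_rdist m g1 g2 Hray); unfold u1; lra.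
Qed.

End Radial.

(** * Rays that are not along a meridian *)

Hypothesis Hc : c <> 0.
Hypothesis Hcl : forall t, 0 < t -> r t <> 0 -> clairaut m g1 g2 t = c.

Let a := Rabs c.

Lemma a_pos : 0 < a.
Proof. unfold a. now apply Rabs_pos_lt. Qed.

Lemma clairaut_bound t : 0 < t -> r t <> 0 -> a <= m (r t).
Proof.
intros Ht Hr. assert (U := ray_unit_speed m g1 g2 Hray t Ht Hr).
assert (E := Hcl t Ht Hr). unfold clairaut in E.
set (om := angvel g1 g2 t) in *.
assert (P : 0 < m (r t)) by (apply Hpos; generalize (r_nonneg t); lra).
assert (Q : (m (r t) * om) ^ 2 <= 1).
{ generalize (pow2_ge_0 ((g1 t * Derive g1 t + g2 t * Derive g2 t) / r t)). lra. }
assert (Q' : Rabs (m (r t) * om) <= 1).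
{ apply Rabs_le. split; nra. }
unfold a. rewrite <- E. replace (m (r t) ^ 2 * om) with (m (r t) * (m (r t) * om)) by ring.
rewrite Rabs_mult, (Rabs_pos_eq (m (r t))) by lra. nra.
Qed.

Lemma continuous_m_cradius t : continuous (fun u => m (cradius u)) t.
Proof. apply (continuous_Rcomp m); [apply continuous_cradius|apply Hm]. Qed.

(** A minimizing curve visits the origin at most once, so just after such a visit [clairaut_bound]
    gives m(r) >= a, while m(r) tends to m(0) = 0. *)
Lemma r_pos t : 0 <= t -> 0 < r t.
Proof.
intros Ht. destruct (Rle_lt_or_eq_dec 0 t Ht) as [Ht'|<-]; [|exact Hr0].
destruct (Rle_lt_or_eq_dec _ _ (r_nonneg t)) as [|E]; [assumption|exfalso].
symmetry in E.
destruct (proj2 (continuous_eps (fun u => m (cradius u)) t) (continuous_m_cradius t) a a_pos) as (d & Hd & H).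
set (u := t + d / 2).
specialize (H u). rewrite !cradius_pos_eq, E in H by (unfold u; lra).
replace (m 0) with 0 in H by (symmetry; apply Hm).
assert (Hu : r u <> 0).
{ intros Hu. assert (t = u) by (apply r_zero_unique; auto; unfold u; lra). unfold u in *; lra. }
assert (B : a <= m (r u)) by (apply clairaut_bound; auto; unfold u; lra).
rewrite Rminus_0_r in H. assert (Rabs (m (r u)) < a).
{ apply H. unfold u. replace (t + d / 2 - t) with (d / 2) by ring. rewrite Rabs_pos_eq; lra. }
generalize (Rle_abs (m (r u))). lra.
Qed.

Lemma cradius_pos t : 0 < cradius t.
Proof. apply r_pos, Rmax_l. Qed.

Lemma m_cradius_ge t : a <= m (cradius t).
Proof.
assert (W : forall t, 0 < t -> a <= m (cradius t)).
{ intros u Hu. rewrite cradius_pos_eq by lra. apply clairaut_bound; [exact Hu|].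
  generalize (r_pos u). lra. }
destruct (Rlt_dec 0 t) as [Ht|Ht]; [auto|].
replace (cradius t) with (cradius 0) by (unfold cradius; rewrite !Rmax_left by lra; reflexivity).
apply Rnot_lt_le. intros Hlt.
destruct (proj2 (continuous_eps (fun u => m (cradius u)) 0) (continuous_m_cradius 0) (a - m (cradius 0)) ltac:(lra))
  as (d & Hd & H).
specialize (H (d / 2)). specialize (W (d / 2) ltac:(lra)).
assert (K : Rabs (m (cradius (d / 2)) - m (cradius 0)) < a - m (cradius 0)).
{ apply H. rewrite Rminus_0_r, Rabs_pos_eq; lra. }
generalize (Rle_abs (m (cradius (d / 2)) - m (cradius 0))). lra.
Qed.

Lemma radvel_sqr t : 0 < t -> radvel t ^ 2 = 1 - a ^ 2 / m (cradius t) ^ 2.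
Proof.
intros Ht. assert (Hr := r_pos t (Rlt_le _ _ Ht)). rewrite cradius_pos_eq by lra.
assert (U := ray_unit_speed m g1 g2 Hray t Ht ltac:(lra)).
assert (E := Hcl t Ht ltac:(lra)). unfold clairaut in E.
assert (P : 0 < m (r t)) by (apply Hpos; lra).
fold (radvel t) in U. unfold a. rewrite pow2_abs, <- E.
replace ((m (r t) ^ 2 * angvel g1 g2 t) ^ 2 / m (r t) ^ 2) with ((m (r t) * angvel g1 g2 t) ^ 2)
  by (field; lra). lra.
Qed.

(** By Clairaut theta' = c / m^2, so [c * sweep t] is the angle turned since time 0, counted with
    full turns. *)
Definition sweep t := RInt (fun u => / m (cradius u) ^ 2) 0 t.

Lemma is_derive_sweep t : is_derive sweep t (/ m (cradius t) ^ 2).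
Proof.
apply (is_derive_RInt_cont (fun u => / m (cradius u) ^ 2)). intros u.
apply continuous_Rinv_fun; [apply continuous_pow2, continuous_m_cradius|].
apply pow_nonzero. generalize (m_cradius_ge u) a_pos. lra.
Qed.

Lemma unit_derive_clairaut t : 0 < t ->
  is_derive (fun u => g1 (Rmax 0 u) / cradius u) t (- (g2 (Rmax 0 t) / cradius t * (c * / m (cradius t) ^ 2))) /\
  is_derive (fun u => g2 (Rmax 0 u) / cradius u) t (g1 (Rmax 0 t) / cradius t * (c * / m (cradius t) ^ 2)).
Proof.
intros Ht. assert (Hr := r_pos t (Rlt_le _ _ Ht)).
assert (E := Hcl t Ht ltac:(lra)). unfold clairaut in E.
assert (P : 0 < m (r t)) by (apply Hpos; lra).
assert (Ec : c * / m (cradius t) ^ 2 = angvel g1 g2 t).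
{ rewrite cradius_pos_eq, <- E by lra. field. lra. }
rewrite Ec. rewrite Rmax_right, (cradius_pos_eq t) by lra.
apply unit_derive; lra.
Qed.

(** The unit position vector turned back by [c * sweep t] has derivative 0, so it keeps its initial
    value. *)
Lemma ray_rotation t : 0 <= t ->
  g1 t / r t * cos (c * sweep t) + g2 t / r t * sin (c * sweep t) = g1 0 / r 0 /\
  g2 t / r t * cos (c * sweep t) - g1 t / r t * sin (c * sweep t) = g2 0 / r 0.
Proof.
intros Ht.
set (e1 := fun u => g1 (Rmax 0 u) / cradius u). set (e2 := fun u => g2 (Rmax 0 u) / cradius u).
assert (C1 : forall u, continuous e1 u).
{ intros u. unfold e1, Rdiv. apply continuous_Rmult; [apply continuous_c1|].
  apply continuous_Rinv_fun; [apply continuous_cradius|]. generalize (cradius_pos u). lra. }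
assert (C2 : forall u, continuous e2 u).
{ intros u. unfold e2, Rdiv. apply continuous_Rmult; [apply continuous_c2|].
  apply continuous_Rinv_fun; [apply continuous_cradius|]. generalize (cradius_pos u). lra. }
assert (DC : forall u, is_derive (fun u => cos (c * sweep u)) u (c * / m (cradius u) ^ 2 * - sin (c * sweep u))).
{ intros u. apply (is_derive_comp cos (fun u => c * sweep u)).
  - apply is_derive_cos.
  - apply is_derive_scal, is_derive_sweep. }
assert (DS : forall u, is_derive (fun u => sin (c * sweep u)) u (c * / m (cradius u) ^ 2 * cos (c * sweep u))).
{ intros u. apply (is_derive_comp sin (fun u => c * sweep u)).
  - apply is_derive_sin.
  - apply is_derive_scal, is_derive_sweep. }
assert (K : forall (f g : R -> R) u df dg, is_derive f u df -> is_derive g u dg ->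
  is_derive (fun v => f v * g v) u (df * g u + f u * dg)).
{ intros f g u df dg Hf Hg. apply (is_derive_mult f g u df dg); auto. intros; apply Rmult_comm. }
assert (CC := fun u => is_derive_continuous _ _ _ (DC u)).
assert (CS := fun u => is_derive_continuous _ _ _ (DS u)).
assert (S0 : sweep 0 = 0) by apply RInt_point_R.
assert (X1 := constant_of_derive_0 (fun u => e1 u * cos (c * sweep u) + e2 u * sin (c * sweep u)) 0 t Ht).
assert (X2 := constant_of_derive_0 (fun u => e2 u * cos (c * sweep u) - e1 u * sin (c * sweep u)) 0 t Ht).
cbv beta in X1, X2. unfold e1, e2 in X1, X2. rewrite (Rmax_left 0 0), !(Rmax_right 0 t) in X1, X2 by lra.
rewrite S0, Rmult_0_r, cos_0, sin_0, (cradius_pos_eq 0), (cradius_pos_eq t) in X1, X2 by lra.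
split.
- rewrite <- X1; [ring| |].
  + intros u _. apply continuous_Rplus; apply continuous_Rmult; [apply C1|apply CC|apply C2|apply CS].
  + intros u Hu. destruct (unit_derive_clairaut u ltac:(lra)) as [U1 U2].
    assert (Y1 := K _ _ _ _ _ U1 (DC u)). assert (Y2 := K _ _ _ _ _ U2 (DS u)).
    assert (Y := is_derive_plus _ _ _ _ _ Y1 Y2).
    apply (is_derive_eq _ _ _ _ Y).
    unfold plus; simpl. ring.
- rewrite <- X2; [ring| |].
  + intros u _. apply continuous_Rminus; apply continuous_Rmult; [apply C2|apply CC|apply C1|apply CS].
  + intros u Hu. destruct (unit_derive_clairaut u ltac:(lra)) as [U1 U2].
    assert (Y1 := K _ _ _ _ _ U2 (DC u)). assert (Y2 := K _ _ _ _ _ U1 (DS u)).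
    assert (Y := is_derive_minus _ _ _ _ _ Y1 Y2).
    apply (is_derive_eq _ _ _ _ Y).
    unfold minus, plus, opp; simpl. ring.
Qed.

Lemma sweep_neq_PI t : 0 < t -> a * sweep t <> PI.
Proof.
intros Ht E. destruct (ray_rotation t (Rlt_le _ _ Ht)) as [X1 X2].
assert (Hcs : cos (c * sweep t) = -1 /\ sin (c * sweep t) = 0).
{ unfold a in E. destruct (Rcase_abs c) as [H|H].
  - rewrite Rabs_left in E by exact H. replace (c * sweep t) with (- PI) by lra.
    rewrite cos_neg, sin_neg, cos_PI, sin_PI. split; ring.
  - rewrite Rabs_right in E by exact H. rewrite E, cos_PI, sin_PI. split; ring. }
destruct Hcs as [Ec Es]. rewrite Ec, Es in X1, X2.
assert (Pt := r_pos t (Rlt_le _ _ Ht)).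
assert (Z := no_opposite_point m g1 g2 Hm Hray t (r t / r 0) Ht).
rewrite Hcl in Z by lra. apply Hc, Z.
- now apply Rdiv_lt_0_compat.
- lra.
- replace (- (r t / r 0) * g1 0) with (- r t * (g1 0 / r 0)) by (field; lra).
  rewrite <- X1. field. lra.
- replace (- (r t / r 0) * g2 0) with (- r t * (g2 0 / r 0)) by (field; lra).
  rewrite <- X2. field. lra.
- exists (t / 2). split; [lra|]. generalize (r_pos (t / 2)). lra.
- lra.
Qed.

Lemma sweep_lt_PI t : 0 <= t -> a * sweep t < PI.
Proof.
intros Ht. apply Rnot_le_lt. intros Hle.
assert (S0 : sweep 0 = 0) by apply RInt_point_R.
destruct (IVT_gen (fun u => a * sweep u) 0 t PI) as (u & Hu & E).
- intros u. apply continuity_pt_filterlim. apply continuous_Rmult; [apply continuous_const|].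
  exact (is_derive_continuous _ _ _ (is_derive_sweep u)).
- rewrite S0, Rmult_0_r. generalize PI_RGT_0. intros.
  rewrite Rmin_left, Rmax_right by lra. lra.
- rewrite Rmin_left, Rmax_right in Hu by lra.
  apply (sweep_neq_PI u); [|exact E].
  destruct (Rle_lt_or_eq_dec 0 u (proj1 Hu)) as [|E0]; [assumption|].
  rewrite <- E0, S0, Rmult_0_r in E. generalize PI_RGT_0. lra.
Qed.

End RayPolar.

(** * Turning angles in the comparison surfaces *)

(* The angle swept by a geodesic with Clairaut constant a, from its closest
   point to the origin up to the parallel of radius m^{-1}(u), in the surface
   where m' = sqrt (1 - K m^2): a sphere, or a flat disc if K = 0. *)
Definition model_angle (K a u : R) : R :=
  atan (sqrt (u ^ 2 - a ^ 2) / (a * sqrt (1 - K * u ^ 2))).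

(** Clairaut's rate d theta / dr = a / (m sqrt(m^2 - a^2)), divided by m' = sqrt(1 - K m^2) to pass
    from r to u = m(r). *)
Lemma is_derive_model_angle K a u : 0 <= K -> 0 < a < u -> K * u ^ 2 < 1 ->
  is_derive (model_angle K a) u (a / (u * sqrt (u ^ 2 - a ^ 2) * sqrt (1 - K * u ^ 2))).
Proof.
intros HK Ha Hu.
assert (P2 : 0 < u ^ 2 - a ^ 2) by nra. assert (Q2 : 0 < 1 - K * u ^ 2) by lra.
assert (HP := sqrt_lt_R0 _ P2). assert (HQ := sqrt_lt_R0 _ Q2).
assert (EP := pow2_sqrt _ (Rlt_le _ _ P2)). assert (EQ := pow2_sqrt _ (Rlt_le _ _ Q2)).
assert (DP : is_derive (fun v => sqrt (v ^ 2 - a ^ 2)) u ((2 * u) / (2 * sqrt (u ^ 2 - a ^ 2)))).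
{ apply (is_derive_sqrt (fun v => v ^ 2 - a ^ 2) u (2 * u)); [auto_derive; [trivial|ring]|exact P2]. }
assert (DQ : is_derive (fun v => a * sqrt (1 - K * v ^ 2)) u (a * ((- 2 * K * u) / (2 * sqrt (1 - K * u ^ 2))))).
{ apply is_derive_scal.
  apply (is_derive_sqrt (fun v => 1 - K * v ^ 2) u (- 2 * K * u)); [auto_derive; [trivial|ring]|exact Q2]. }
set (P := sqrt (u ^ 2 - a ^ 2)) in *. set (Q := sqrt (1 - K * u ^ 2)) in *.
assert (HaQ : a * Q <> 0) by (apply Rmult_integral_contrapositive_currified; lra).
assert (D := is_derive_div _ _ _ _ _ DP DQ HaQ).
assert (D2 := is_derive_comp atan _ u _ _ (is_derive_atan _) D).
unfold model_angle. apply (is_derive_eq _ _ _ _ D2).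
change (sqrt (u ^ 2 - a ^ 2)) with P. change (sqrt (1 - K * u ^ 2)) with Q.
unfold scal; simpl; unfold mult; simpl. unfold Rsqr.
assert (HKa : 0 < 1 - K * a ^ 2) by nra.
assert (E1 : a ^ 2 * Q ^ 2 + P ^ 2 = u ^ 2 * (1 - K * a ^ 2)) by (rewrite EP, EQ; ring).
assert (E2 : Q ^ 2 + K * P ^ 2 = 1 - K * a ^ 2) by (rewrite EP, EQ; ring).
transitivity ((u * a * (Q ^ 2 + K * P ^ 2)) / (P * Q * (a ^ 2 * Q ^ 2 + P ^ 2))).
- field. repeat split; try lra. generalize (pow2_ge_0 (a * Q)) (pow2_gt_0 P ltac:(lra)). lra.
- rewrite E1, E2. field. repeat split; lra.
Qed.

Lemma continuous_model_angle (U : UniformSpace) K a (f : U -> R) t : 0 < a ->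
  K * f t ^ 2 < 1 -> continuous f t -> continuous (fun v => model_angle K a (f v)) t.
Proof.
intros Ha HK Hf. unfold model_angle. apply (continuous_Rcomp atan).
- unfold Rdiv. apply continuous_Rmult; [cont|]. apply continuous_Rinv_fun; [cont|].
  apply Rmult_integral_contrapositive_currified; [lra|].
  apply Rgt_not_eq, sqrt_lt_R0. lra.
- exact (is_derive_continuous _ _ _ (is_derive_atan _)).
Qed.

(** * Turning of a ray compared with the models *)

Section Sweep.
Variables (m R0 D Th : R -> R) (a : R).
Hypothesis Hdm : forall u, is_derive m u (Derive m u).
Hypothesis Ha : 0 < a.
Hypothesis HR : forall t, continuous R0 t.
Hypothesis HD : forall t, 0 < t -> is_derive R0 t (D t).
Hypothesis HD2 : forall t, 0 < t -> D t ^ 2 = 1 - a ^ 2 / m (R0 t) ^ 2.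
Hypothesis HTh : forall t, is_derive Th t (/ m (R0 t) ^ 2).

Lemma sweep_mono s t : s <= t -> Th s <= Th t.
Proof.
intros Hst. apply (nondecreasing_of_derive_nonneg Th (fun t => / m (R0 t) ^ 2)); [exact Hst| |].
- intros u _. exact (is_derive_continuous _ _ _ (HTh u)).
- intros u _. split; [apply HTh|].
  destruct (Req_dec (m (R0 u)) 0) as [E|E].
  + rewrite E. replace (0 ^ 2) with 0 by ring. rewrite Rinv_0. lra.
  + apply Rlt_le, Rinv_0_lt_compat, pow2_gt_0, E.
Qed.

(** Since |r'| = sqrt(m^2 - a^2) / m, the model angle changes along the ray at a rate of at most B a
    / m^2: the slower m grows, the more the ray turns. The absolute value serves inward and outward
    passages alike. At m = a the model angle is only continuous, hence the strict inequality inside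
    the interval. *)
Lemma sweep_gain K B s t : 0 <= K -> 0 < B -> 0 <= s <= t ->
  (forall u, s <= u <= t -> K * m (R0 u) ^ 2 < 1) ->
  (forall u, s < u < t -> a < m (R0 u) /\ 0 <= Derive m (R0 u) <= B * sqrt (1 - K * m (R0 u) ^ 2)) ->
  Rabs (model_angle K a (m (R0 t)) - model_angle K a (m (R0 s))) <= B * a * (Th t - Th s).
Proof.
intros HK HB Hst H1 H2.
assert (Cm : forall u, continuous (fun v => m (R0 v)) u).
{ intros u. apply (continuous_Rcomp m); [apply HR|]. exact (is_derive_continuous _ _ _ (Hdm _)). }
set (dS := fun u => Derive m (R0 u) * D u *
  (a / (m (R0 u) * sqrt (m (R0 u) ^ 2 - a ^ 2) * sqrt (1 - K * m (R0 u) ^ 2)))).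
assert (DS : forall u, s < u < t -> is_derive (fun v => model_angle K a (m (R0 v))) u (dS u)).
{ intros u Hu. destruct (H2 u Hu) as [K1 K2].
  apply (is_derive_comp (model_angle K a) (fun v => m (R0 v)) u).
  - apply is_derive_model_angle; auto. apply H1; lra.
  - replace (Derive m (R0 u) * D u) with (D u * Derive m (R0 u)) by ring.
    apply (is_derive_comp m R0 u); [apply Hdm|apply HD; lra]. }
assert (Bd : forall u, s < u < t -> Rabs (dS u) <= B * a * / m (R0 u) ^ 2).
{ intros u Hu. destruct (H2 u Hu) as [K1 K2]. unfold dS.
  assert (K3 : K * m (R0 u) ^ 2 < 1) by (apply H1; lra).
  assert (E := HD2 u ltac:(lra)).
  set (M := m (R0 u)) in *. set (M' := Derive m (R0 u)) in *.
  assert (P2 : 0 < M ^ 2 - a ^ 2) by nra. assert (Q2 : 0 < 1 - K * M ^ 2) by lra.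
  assert (HP := sqrt_lt_R0 _ P2). assert (HQ := sqrt_lt_R0 _ Q2).
  assert (EP := pow2_sqrt _ (Rlt_le _ _ P2)).
  set (P := sqrt (M ^ 2 - a ^ 2)) in *. set (Q := sqrt (1 - K * M ^ 2)) in *.
  assert (ED : Rabs (D u) = P / M).
  { rewrite <- (sqrt_pow2 (P / M)) by (apply Rlt_le, Rdiv_lt_0_compat; lra).
    rewrite <- (sqrt_pow2 (Rabs (D u))) by apply Rabs_pos. f_equal.
    rewrite pow2_abs, E. unfold Rdiv. rewrite Rpow_mult_distr, EP. field. lra. }
  rewrite !Rabs_mult, ED, (Rabs_pos_eq M') by lra.
  rewrite (Rabs_pos_eq (a / (M * P * Q))).
  2:{ apply Rlt_le, Rdiv_lt_0_compat; [lra|]. repeat apply Rmult_lt_0_compat; lra. }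
  apply Rle_trans with (B * Q * (P / M) * (a / (M * P * Q))).
  - apply Rmult_le_compat_r.
    { apply Rlt_le, Rdiv_lt_0_compat; [lra|]. repeat apply Rmult_lt_0_compat; lra. }
    apply Rmult_le_compat_r; [|lra]. apply Rlt_le, Rdiv_lt_0_compat; lra.
  - right. field. repeat split; lra. }
assert (X : forall sg, Rabs sg = 1 ->
  B * a * Th s - sg * model_angle K a (m (R0 s)) <= B * a * Th t - sg * model_angle K a (m (R0 t))).
{ intros sg Hsg.
  apply (nondecreasing_of_derive_nonneg (fun u => B * a * Th u - sg * model_angle K a (m (R0 u)))
    (fun u => B * a * / m (R0 u) ^ 2 - sg * dS u)); [lra| |].
  - intros u Hu. apply continuous_Rminus; apply continuous_Rmult; try apply continuous_const.
    + exact (is_derive_continuous _ _ _ (HTh u)).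
    + apply continuous_model_angle; [exact Ha|now apply H1|apply Cm].
  - intros u Hu. split.
    + apply (is_derive_minus (fun u => B * a * Th u) (fun u => sg * model_angle K a (m (R0 u)))).
      * apply is_derive_scal, HTh.
      * apply (is_derive_scal (fun u => model_angle K a (m (R0 u)))), DS, Hu.
    + assert (Y : sg * dS u <= Rabs (dS u)).
      { eapply Rle_trans; [apply Rle_abs|]. rewrite Rabs_mult, Hsg. lra. }
      specialize (Bd u Hu). lra. }
apply Rabs_le.
assert (X1 := X 1 Rabs_R1). assert (X2 := X (-1) ltac:(rewrite Rabs_left; lra)). lra.
Qed.

End Sweep.

(** * Inequalities for the cap and the cone *)

Lemma tan_sqr_add_1 al : cos al <> 0 -> 1 + tan al ^ 2 = / cos al ^ 2.
Proof.
intros H. unfold tan. assert (S := sin2_cos2 al). unfold Rsqr in S.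
apply Rmult_eq_reg_r with (cos al ^ 2); [|now apply pow_nonzero].
transitivity (cos al * cos al + sin al * sin al); [field; exact H|].
rewrite Rinv_l by (now apply pow_nonzero). lra.
Qed.

Lemma atan_le_id u : 0 <= u -> atan u <= u.
Proof.
intros Hu. assert (H : 0 - atan 0 <= u - atan u).
{ apply (nondecreasing_of_derive_nonneg (fun v => v - atan v) (fun v => 1 - / (1 + v ^ 2))); [exact Hu| |].
  - intros v _. apply continuous_Rminus; [apply continuous_id|].
    exact (is_derive_continuous _ _ _ (is_derive_atan v)).
  - intros v Hv. split.
    + apply (is_derive_minus (fun v => v) atan); [exact (is_derive_id v)|].
      apply (is_derive_eq _ _ _ _ (is_derive_atan v)). unfold Rsqr. f_equal. ring.
    + assert (1 <= 1 + v ^ 2) by nra. assert (/ (1 + v ^ 2) <= / 1) by (apply Rinv_le_contravar; lra). lra. }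
rewrite atan_0 in H. lra.
Qed.

(* As a function of T the left-hand side equals PI at 0 and tends to PI at
   infinity; its derivative has the sign of a function whose quotient by T^2 is
   decreasing, so it increases and then decreases. *)
Lemma cap_cone_angle b T : 0 < b < 1 / 2 -> 0 < T ->
  PI <= 2 * atan (T / b) +
    / b * (atan (sqrt ((1 + tan (PI * b) ^ 2) * T ^ 2 + tan (PI * b) ^ 2)) - atan T).
Proof.
intros Hb HT.
assert (Hpi := PI_RGT_0).
assert (HB : 0 < PI * b < PI / 2) by (split; nra).
assert (Htan : 0 < tan (PI * b)) by (apply tan_gt_0; lra).
set (q := tan (PI * b) ^ 2). assert (Hq : 0 < q) by (apply pow2_gt_0; lra).
(* If T is the tangent of the flat model angle at X, then [w T] is its tangent at X / cos(PI b): the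
   square of the secant is u^2 / a^2, and it gets multiplied by 1 + q. *)
set (w := fun T => sqrt ((1 + q) * T ^ 2 + q)).
set (f := fun T => 2 * atan (T / b) + / b * (atan (w T) - atan T)).
assert (W2 : forall t, 0 < (1 + q) * t ^ 2 + q) by (intros; nra).
assert (Ew : forall t, w t ^ 2 = (1 + q) * t ^ 2 + q) by (intros; apply pow2_sqrt, Rlt_le, W2).
assert (Hw : forall t, 0 < w t) by (intros; apply sqrt_lt_R0, W2).
assert (Hwt : forall t, 0 <= t -> t < w t).
{ intros t Ht. rewrite <- (sqrt_pow2 t) at 1 by exact Ht. apply sqrt_lt_1_alt. nra. }
(* The last two terms of the derivative combine because w^2 - t^2 = q (1 + t^2) and 1 + w^2 = (1 +
   q)(1 + t^2). *)
set (df := fun t => / b * (2 * b ^ 2 / (b ^ 2 + t ^ 2) - q / (w t * (w t + t)))).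
assert (Df : forall t, 0 <= t -> is_derive f t (df t)).
{ intros t Ht.
  assert (D1 : is_derive (fun t => 2 * atan (t / b)) t (2 * (/ b * / (1 + (t / b) ^ 2)))).
  { apply is_derive_scal. apply (is_derive_comp atan (fun t => t / b)).
    - apply (is_derive_eq _ _ _ _ (is_derive_atan _)). unfold Rsqr. f_equal. ring.
    - auto_derive; [trivial|]. ring. }
  assert (D2 : is_derive w t (2 * (1 + q) * t / (2 * w t))).
  { apply (is_derive_sqrt (fun v => (1 + q) * v ^ 2 + q)); [auto_derive; [trivial|ring]|apply W2]. }
  assert (D3 : is_derive (fun t => atan (w t)) t (2 * (1 + q) * t / (2 * w t) * / (1 + w t ^ 2))).
  { apply (is_derive_comp atan w); [|exact D2].
    apply (is_derive_eq _ _ _ _ (is_derive_atan _)). unfold Rsqr. f_equal. ring. }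
  assert (D4 : is_derive atan t (/ (1 + t ^ 2))).
  { apply (is_derive_eq _ _ _ _ (is_derive_atan _)). unfold Rsqr. f_equal. ring. }
  apply (is_derive_eq _ _ _ _ (is_derive_plus _ _ _ _ _ D1
     (is_derive_scal _ _ (/ b) _ (is_derive_minus _ _ _ _ _ D3 D4)))).
  unfold minus, plus, opp; simpl. unfold df. specialize (Ew t). specialize (Hw t). specialize (Hwt t Ht).
  set (W := w t) in *.
  assert (E1 : 1 + W ^ 2 = (1 + q) * (1 + t ^ 2)) by (rewrite Ew; ring).
  change (1 + W * (W * 1)) with (1 + W ^ 2). change (1 + t * (t * 1)) with (1 + t ^ 2).
  rewrite E1.
  assert (E2 : q / (W * (W + t)) = (W - t) / (W * (1 + t ^ 2))).
  { assert (E3 : q = (W ^ 2 - t ^ 2) / (1 + t ^ 2)) by (rewrite Ew; field; nra).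
    rewrite E3. field. repeat split; nra. }
  rewrite E2. field. repeat split; nra. }
assert (F0 : f 0 = PI).
{ unfold f, w. replace ((1 + q) * 0 ^ 2 + q) with q by ring. unfold q.
  rewrite sqrt_pow2 by lra. rewrite atan_tan by lra.
  replace (0 / b) with 0 by (field; lra). rewrite atan_0. field. lra. }
change (PI <= f T). apply Rnot_lt_le. intros Hlt.
destruct (MVT_open f df 0 T HT) as (T2 & HT2 & E2).
{ intros t Ht. exact (is_derive_continuous _ _ _ (Df t ltac:(lra))). }
{ intros; apply Df; lra. }
rewrite F0 in E2. assert (N2 : df T2 < 0) by nra.
assert (Nafter : forall t, T2 <= t -> df t <= 0).
{ intros t Ht. unfold df in *.
  assert (Hib : 0 < / b) by (apply Rinv_0_lt_compat; lra).
  assert (Aux : forall s, 0 < s -> 2 * b ^ 2 / (b ^ 2 + s ^ 2) - q / (w s * (w s + s)) =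
    (2 * b ^ 2 * (w s * (w s + s)) - q * (b ^ 2 + s ^ 2)) / ((b ^ 2 + s ^ 2) * (w s * (w s + s)))).
  { intros s Hs. field. specialize (Hw s). repeat split; nra. }
  assert (Den : forall s, 0 < s -> 0 < (b ^ 2 + s ^ 2) * (w s * (w s + s))).
  { intros s Hs. specialize (Hw s). apply Rmult_lt_0_compat; [nra|]. apply Rmult_lt_0_compat; lra. }
  (* As v^2 = 1 + q + q / s^2, the numerator of [df] divided by s^2 is a constant plus q b^2 / s^2 +
     2 b^2 v, which decreases in s. So [df] stays nonpositive after [T2]. *)
  set (v := fun s => w s / s).
  assert (Fac : forall s, 0 < s -> 2 * b ^ 2 * (w s * (w s + s)) - q * (b ^ 2 + s ^ 2) =
    s ^ 2 * (2 * b ^ 2 * (v s ^ 2 + v s) - q * (b ^ 2 / s ^ 2 + 1))).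
  { intros s Hs. unfold v. field. lra. }
  assert (Ev : forall s, 0 < s -> v s ^ 2 = 1 + q + q / s ^ 2).
  { intros s Hs. unfold v. replace ((w s / s) ^ 2) with (w s ^ 2 / s ^ 2) by (field; lra).
    rewrite Ew. field. lra. }
  assert (Hv0 : forall s, 0 < s -> 0 < v s) by (intros; unfold v; apply Rdiv_lt_0_compat; auto).
  assert (Inv : / t ^ 2 <= / T2 ^ 2).
  { apply Rinv_le_contravar; [nra|]. apply pow_incr. lra. }
  assert (Hv : v t <= v T2).
  { apply Rsqr_incr_0; [|apply Rlt_le, Hv0; lra|apply Rlt_le, Hv0; lra].
    unfold Rsqr. generalize (Ev t ltac:(lra)) (Ev T2 ltac:(lra)). unfold Rdiv. intros. nra. }
  assert (G2 : 2 * b ^ 2 * (v T2 ^ 2 + v T2) - q * (b ^ 2 / T2 ^ 2 + 1) < 0).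
  { rewrite (Aux T2 ltac:(lra)), (Fac T2 ltac:(lra)) in N2.
    apply Rnot_le_lt. intros Hge.
    assert (0 <= / b * (T2 ^ 2 * (2 * b ^ 2 * (v T2 ^ 2 + v T2) - q * (b ^ 2 / T2 ^ 2 + 1)) /
       ((b ^ 2 + T2 ^ 2) * (w T2 * (w T2 + T2))))); [|lra].
    apply Rmult_le_pos; [lra|]. apply Rmult_le_pos; [|apply Rlt_le, Rinv_0_lt_compat, Den; lra].
    apply Rmult_le_pos; [nra|exact Hge]. }
  assert (G : 2 * b ^ 2 * (v t ^ 2 + v t) - q * (b ^ 2 / t ^ 2 + 1) <= 0).
  { rewrite Ev in * by lra. unfold Rdiv in *.
    assert (0 < b ^ 2) by nra. assert (0 < q * b ^ 2) by nra.
    assert (b ^ 2 * v t <= b ^ 2 * v T2) by (apply Rmult_le_compat_l; lra).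
    assert (q * b ^ 2 * / t ^ 2 <= q * b ^ 2 * / T2 ^ 2) by (apply Rmult_le_compat_l; lra). lra. }
  rewrite (Aux t ltac:(lra)), (Fac t ltac:(lra)).
  assert (0 < / ((b ^ 2 + t ^ 2) * (w t * (w t + t)))) by (apply Rinv_0_lt_compat, Den; lra).
  assert (t ^ 2 * (2 * b ^ 2 * (v t ^ 2 + v t) - q * (b ^ 2 / t ^ 2 + 1)) <= 0) by nra.
  unfold Rdiv at 1. set (N := t ^ 2 * _) in *. set (I := / (_ * _)) in *.
  assert (0 <= / b * (- N * I)) by (apply Rmult_le_pos; [|apply Rmult_le_pos]; lra). lra. }
(* Beyond T, and so large that 2 b / U, by which [f U] can fall short of PI, is at most half of
   [PI - f T]. *)
set (U := Rmax (T + 1) (4 * b / (PI - f T))).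
assert (HU1 : T + 1 <= U) by apply Rmax_l. assert (HU2 : 4 * b / (PI - f T) <= U) by apply Rmax_r.
assert (Hdec : f U <= f T).
{ assert (- f T <= - f U); [|lra].
  apply (nondecreasing_of_derive_nonneg (fun t => - f t) (fun t => - df t)); [lra| |].
  - intros t Ht. apply (continuous_opp (V := R_NormedModule) f).
    apply (is_derive_continuous _ _ _ (Df t ltac:(lra))).
  - intros t Ht. split; [apply (is_derive_opp f t (df t)), Df; lra|].
    specialize (Nafter t ltac:(lra)). lra. }
assert (HfU : PI - 2 * (b / U) <= f U).
{ unfold f. assert (A1 : atan U < atan (w U)) by (apply atan_increasing, Hwt; lra).
  assert (0 < / b * (atan (w U) - atan U)).
  { apply Rmult_lt_0_compat; [apply Rinv_0_lt_compat|]; lra. }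
  assert (A2 := atan_inv (U / b) ltac:(apply Rdiv_lt_0_compat; lra)).
  replace (/ (U / b)) with (b / U) in A2 by (field; lra).
  assert (A3 := atan_le_id (b / U) ltac:(apply Rlt_le, Rdiv_lt_0_compat; lra)). lra. }
assert (A4 : b / U <= (PI - f T) / 4).
{ apply Rmult_le_reg_r with (U * (4 / (PI - f T))).
  - apply Rmult_lt_0_compat; [lra|]. apply Rdiv_lt_0_compat; lra.
  - replace (b / U * (U * (4 / (PI - f T)))) with (4 * b / (PI - f T)) by (field; lra).
    replace ((PI - f T) / 4 * (U * (4 / (PI - f T)))) with U by (field; lra). exact HU2. }
lra.
Qed.

(** Amounts to b < sin(PI b / 2). On [0, PI/4] the derivative of the sine exceeds 7/10, and PI > 3,
    so the right-hand side is above 21/20 b. *)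
Lemma two_sqr_lt_1_sub_cos b : 0 < b < 1 / 2 -> 2 * b ^ 2 < 1 - cos (PI * b).
Proof.
intros Hb. set (z := PI * b / 2).
assert (Hpi : 3 < PI) by (generalize PI2_3_2; lra).
assert (Hz : 0 < z) by (unfold z; nra).
assert (E : 1 - cos (PI * b) = 2 * sin z ^ 2).
{ replace (PI * b) with (2 * z) by (unfold z; field). rewrite cos_2a_sin. ring. }
rewrite E.
destruct (MVT_open sin cos 0 z Hz) as (xi & Hxi & Es).
{ intros t _. exact (is_derive_continuous _ _ _ (is_derive_sin t)). }
{ intros; apply is_derive_sin. }
rewrite sin_0, !Rminus_0_r in Es.
assert (Hc : cos (PI / 4) < cos xi) by (apply cos_decreasing_1; unfold z in *; nra).
rewrite cos_PI4 in Hc.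
assert (Hs2 : 7 / 10 < 1 / sqrt 2).
{ assert (S0 : 0 < sqrt 2) by (apply sqrt_lt_R0; lra).
  assert (S2 : sqrt 2 ^ 2 = 2) by (apply pow2_sqrt; lra).
  apply Rmult_lt_reg_r with (sqrt 2); [exact S0|].
  replace (1 / sqrt 2 * sqrt 2) with 1 by (field; lra). nra. }
assert (b < sin z).
{ rewrite Es. apply Rlt_le_trans with (7 / 10 * (3 * b / 2)); [lra|].
  apply Rmult_le_compat; unfold z; nra. }
nra.
Qed.

Lemma model_angle_start K a : model_angle K a a = 0.
Proof.
unfold model_angle. rewrite Rminus_diag, sqrt_0. unfold Rdiv. rewrite Rmult_0_l. apply atan_0.
Qed.

(** In the flat model 1 + tan^2 of the angle is u^2 / a^2, and passing from X to Y multiplies it by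
    at least 1 / cos(al)^2 = 1 + tan(al)^2. *)
Lemma model_angle_0_ge al a X Y : 0 < al < PI / 2 -> 0 < a <= X -> X <= cos al * Y ->
  atan (sqrt ((1 + tan al ^ 2) * (sqrt (X ^ 2 - a ^ 2) / a) ^ 2 + tan al ^ 2)) <= model_angle 0 a Y.
Proof.
intros Hal Ha HX. assert (Hc : 0 < cos al) by (apply cos_gt_0; lra).
assert (HY : 0 < Y) by (apply Rmult_lt_reg_l with (cos al); lra).
assert (Et := tan_sqr_add_1 al ltac:(lra)).
unfold model_angle.
replace (1 - 0 * Y ^ 2) with 1 by ring. rewrite sqrt_1, Rmult_1_r.
replace (sqrt (Y ^ 2 - a ^ 2) / a) with (sqrt ((Y ^ 2 - a ^ 2) / a ^ 2)).
2:{ rewrite sqrt_div_alt by nra. rewrite sqrt_pow2 by lra. reflexivity. }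
assert (Hmono : forall u v, u <= v -> atan u <= atan v).
{ intros u v [H| ->]; [apply Rlt_le, atan_increasing, H|apply Rle_refl]. }
apply Hmono, sqrt_le_1_alt.
replace ((sqrt (X ^ 2 - a ^ 2) / a) ^ 2) with ((X ^ 2 - a ^ 2) / a ^ 2).
2:{ unfold Rdiv. rewrite Rpow_mult_distr, pow2_sqrt by nra. field. lra. }
replace (tan al ^ 2) with (/ cos al ^ 2 - 1) by lra.
apply Rmult_le_reg_r with (a ^ 2 * cos al ^ 2); [apply Rmult_lt_0_compat; nra|].
replace (((1 + (/ cos al ^ 2 - 1)) * ((X ^ 2 - a ^ 2) / a ^ 2) + (/ cos al ^ 2 - 1)) * (a ^ 2 * cos al ^ 2))
  with (X ^ 2 - a ^ 2 * cos al ^ 2) by (field; lra).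
replace ((Y ^ 2 - a ^ 2) / a ^ 2 * (a ^ 2 * cos al ^ 2)) with ((cos al * Y) ^ 2 - a ^ 2 * cos al ^ 2) by (field; lra).
assert (X ^ 2 <= (cos al * Y) ^ 2) by (apply pow_incr; lra). lra.
Qed.

(** * The profile below radius y *)

Section Profile.
Variables (m : R -> R) (x y b z : R).
Hypothesis Hmodel : model_fun m.
Hypothesis Hvm : von_mangoldt m.
Hypothesis Hx : 0 < x.
Hypothesis Hxy : x < y.
Hypothesis Hm' : forall t, 0 <= t <= y -> 0 < Derive m t.
Hypothesis Hhalf : forall t, x <= t <= y -> Derive m t < 1 / 2.
Hypothesis Hbmax : exists t, x <= t <= y /\ Derive m t = b.
Hypothesis Hb' : forall t, x <= t <= y -> Derive m t <= b.
Hypothesis Hz : 0 <= z <= y.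
Hypothesis Hmz : m z = cos (PI * b) * m y.

Lemma is_derive_m u : is_derive m u (Derive m u).
Proof. apply Derive_correct. apply (proj1 Hmodel 1%nat u). Qed.

Lemma is_derive_m' u : is_derive (Derive m) u (Derive_n m 2 u).
Proof. apply Derive_correct. apply (proj1 Hmodel 2%nat u). Qed.

Lemma continuous_m u : continuous m u.
Proof. exact (is_derive_continuous _ _ _ (is_derive_m u)). Qed.

Lemma continuous_m' u : continuous (Derive m) u.
Proof. exact (is_derive_continuous _ _ _ (is_derive_m' u)). Qed.

Lemma m_0 : m 0 = 0.
Proof. destruct Hmodel as (_ & H & _). specialize (H 0). rewrite Ropp_0 in H. lra. Qed.

Lemma m_pos u : 0 < u -> 0 < m u.
Proof. apply Hmodel. Qed.

Lemma m_profile : profile m.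
Proof.
split; [|split; [apply m_0|apply continuous_m]].
apply (is_derive_eq _ _ _ _ (is_derive_m 0)). apply Hmodel.
Qed.

Lemma b_bounds : 0 < b < 1 / 2.
Proof. destruct Hbmax as (t & Ht & <-). split; [apply Hm'; lra|now apply Hhalf]. Qed.

Lemma angle_bounds : 0 < PI * b < PI / 2.
Proof. generalize b_bounds PI_RGT_0. intros. split; nra. Qed.

Lemma m_incr u v : 0 <= u -> u < v -> v <= y -> m u < m v.
Proof.
intros Hu Huv Hv. destruct (MVT_open m (Derive m) u v Huv) as (c & Hc & E).
- intros; apply continuous_m.
- intros; apply is_derive_m.
- assert (0 < Derive m c) by (apply Hm'; lra). nra.
Qed.

Lemma m_le u v : 0 <= u -> u <= v -> v <= y -> m u <= m v.
Proof. intros Hu [H| ->] Hv; [apply Rlt_le, m_incr; auto|apply Rle_refl]. Qed.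

Lemma lt_of_m_lt u v : 0 <= v -> u <= y -> m u < m v -> u < v.
Proof. intros Hu Hv H. apply Rnot_le_lt. intros Hle. assert (m v <= m u) by (apply m_le; auto). lra. Qed.

Lemma z_lt_y : z < y.
Proof.
apply lt_of_m_lt; [lra|lra|]. rewrite Hmz.
assert (0 < m y) by (apply m_pos; lra).
assert (cos (PI * b) < 1).
{ rewrite <- cos_0. generalize angle_bounds PI_RGT_0. intros. apply cos_decreasing_1; lra. }
nra.
Qed.

(** The curvature for which the model cap has slope b at the parallel m(x), where the cone is
    attached. *)
Definition capK : R := (1 - b ^ 2) / m x ^ 2.

Lemma capK_pos : 0 < capK.
Proof.
unfold capK. generalize b_bounds (m_pos x Hx). intros. apply Rdiv_lt_0_compat; nra.
Qed.

Lemma capK_x : 1 - capK * m x ^ 2 = b ^ 2.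
Proof. unfold capK. generalize (m_pos x Hx). intros. field. lra. Qed.

Lemma capK_lt_1 u : 0 <= u <= x -> capK * m u ^ 2 < 1.
Proof.
intros Hu. assert (H1 := capK_x). assert (H2 := capK_pos). assert (H3 := b_bounds).
assert (0 <= m u) by (rewrite <- m_0; apply m_le; lra).
assert (m u ^ 2 <= m x ^ 2) by (apply pow_incr; split; [assumption|apply m_le; lra]). nra.
Qed.

(* As a function of m^2, m'^2 has derivative - curvG m, which is nondecreasing:
   it is convex, hence below its chord over [0, m(x)^2]. *)
Lemma cap_bound u : 0 <= u <= x -> Derive m u <= sqrt (1 - capK * m u ^ 2).
Proof.
intros Hu.
set (f := fun v => 1 - capK * m v ^ 2 - Derive m v ^ 2).
set (df := fun v => 2 * m v * Derive m v * (curvG m v - capK)).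
assert (Df : forall v, 0 < v -> is_derive f v (df v)).
{ intros v Hv.
  assert (D1 := is_derive_pow m 2 v _ (is_derive_m v)).
  assert (D2 := is_derive_pow (Derive m) 2 v _ (is_derive_m' v)).
  assert (D3 := is_derive_minus _ _ _ _ _ (is_derive_minus _ _ _ _ _ (is_derive_Rconst 1 v)
     (is_derive_scal _ _ capK _ D1)) D2).
  apply (is_derive_eq _ _ _ _ D3). unfold df, curvG, minus, plus, opp; simpl.
  field. generalize (m_pos v Hv). lra. }
assert (Cf : forall v, continuous f v).
{ intros v. unfold f. apply continuous_Rminus.
  - apply continuous_Rminus; [apply continuous_const|].
    apply continuous_Rmult; [apply continuous_const|]. apply continuous_pow2, continuous_m.
  - apply continuous_pow2, continuous_m'. }
assert (F0 : f 0 = 0).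
{ unfold f. rewrite m_0. replace (Derive m 0) with 1 by (symmetry; apply Hmodel). ring. }
assert (Fx : 0 <= f x).
{ unfold f. rewrite capK_x. assert (H1 : 0 < Derive m x) by (apply Hm'; lra).
  assert (H2 : Derive m x <= b) by (apply Hb'; lra). nra. }
assert (Fu : 0 <= f u).
{ apply Rnot_lt_le. intros Hlt.
  assert (0 < u) by (destruct (proj1 Hu) as [|E]; [assumption|rewrite <- E in Hlt; lra]).
  assert (u < x) by (destruct (proj2 Hu) as [|E]; [assumption|rewrite E in Hlt; lra]).
  (* A negative value between 0 and [f x >= 0] forces [f] to decrease at [c1] and increase at [c2].
     So the curvature is below [capK] at [c1] and above it at the later [c2], against
     monotonicity. *)
  destruct (MVT_open f df 0 u) as (c1 & Hc1 & E1); [lra|intros; apply Cf|intros; apply Df; lra|].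
  destruct (MVT_open f df u x) as (c2 & Hc2 & E2); [lra|intros; apply Cf|intros; apply Df; lra|].
  assert (N1 : df c1 < 0) by nra. assert (N2 : 0 < df c2) by nra.
  assert (P1 : 0 < 2 * m c1 * Derive m c1).
  { apply Rmult_lt_0_compat; [generalize (m_pos c1); lra|apply Hm'; lra]. }
  assert (P2 : 0 < 2 * m c2 * Derive m c2).
  { apply Rmult_lt_0_compat; [generalize (m_pos c2); lra|apply Hm'; lra]. }
  assert (V := Hvm c1 c2 ltac:(lra) ltac:(lra)).
  unfold df in N1, N2.
  assert (curvG m c1 - capK < 0) by nra. assert (0 < curvG m c2 - capK) by nra. lra. }
assert (0 < Derive m u) by (apply Hm'; lra).
rewrite <- (sqrt_pow2 (Derive m u)) by lra. apply sqrt_le_1_alt. unfold f in Fu. lra.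
Qed.

Lemma cone_bound u : x <= u <= y -> Derive m u <= b * sqrt (1 - 0 * m u ^ 2).
Proof.
intros Hu. rewrite Rmult_0_l, Rminus_0_r, sqrt_1, Rmult_1_r. now apply Hb'.
Qed.

(** * Turning by PI before leaving the disc of radius y *)

Section Escape.
Variables (R0 D Th : R -> R) (a rho : R).
Hypothesis Ha : 0 < a.
Hypothesis HR : forall t, continuous R0 t.
Hypothesis HD : forall t, 0 < t -> is_derive R0 t (D t).
Hypothesis HD2 : forall t, 0 < t -> D t ^ 2 = 1 - a ^ 2 / m (R0 t) ^ 2.
Hypothesis HTh : forall t, is_derive Th t (/ m (R0 t) ^ 2).
Hypothesis HTh0 : Th 0 = 0.
Hypothesis HRpos : forall t, 0 < R0 t.
Hypothesis Hge : forall t, a <= m (R0 t).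
Hypothesis HR0 : R0 0 = rho.
Hypothesis Hrho : x <= rho <= z.
Hypothesis Hinward : forall sig d, 0 < sig -> 0 < d -> exists h, 0 < h < d /\ R0 h - rho < sig * h.

Lemma continuous_mR t : continuous (fun u => m (R0 u)) t.
Proof. apply (continuous_Rcomp m); [apply HR|apply continuous_m]. Qed.

(** At an interior minimum of the radius D = 0, which means m = a. A minimum at time 0 with m(rho) >
    a is impossible: the formula for D^2 keeps |D| away from 0 near time 0, while minimality and
    [Hinward] yield a time with small nonnegative D. *)
Lemma turning_point T : 0 < T -> R0 T = y -> (forall t, 0 <= t < T -> R0 t < y) ->
  exists t, 0 <= t <= T /\ m (R0 t) = a.
Proof.
intros HT ET Hbefore. assert (Hzy := z_lt_y).
destruct (Rle_lt_or_eq_dec a (m rho)) as [Hlt|E]; [rewrite <- HR0; apply Hge| |].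
2:{ exists 0. split; [lra|]. now rewrite HR0. }
destruct (continuity_ab_min R0 0 T (Rlt_le _ _ HT)) as (t & Hmin & Ht).
{ intros u _. apply continuity_pt_filterlim, HR. }
exists t. split; [exact Ht|].
assert (Ht2 : t < T).
{ destruct (proj2 Ht) as [|E]; [assumption|exfalso].
  specialize (Hmin 0 ltac:(lra)). rewrite E, ET, HR0 in Hmin. lra. }
destruct (proj1 Ht) as [Ht1|E].
- assert (pr : derivable_pt R0 t) by (exists (D t); apply is_derive_Reals, HD, Ht1).
  assert (DZ : D t = 0).
  { rewrite <- (Derive_eq R0 t (D t)) by (now apply HD).
    rewrite <- (Derive_Reals R0 t pr). apply (deriv_minimum R0 0 T); try assumption.
    intros; apply Hmin; lra. }
  assert (E := HD2 t Ht1). rewrite DZ in E.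
  assert (P := Hge t). assert (E3 : m (R0 t) ^ 2 = a ^ 2).
  { apply Rmult_eq_reg_r with (/ m (R0 t) ^ 2).
    - rewrite Rinv_r by (apply pow_nonzero; lra). unfold Rdiv in E. lra.
    - apply Rinv_neq_0_compat, pow_nonzero. lra. }
  assert ((m (R0 t) - a) * (m (R0 t) + a) = 0) by (ring_simplify; lra).
  apply Rmult_integral in H. lra.
- exfalso. subst t. rewrite HR0 in Hmin.
  (* Any value strictly between a and m(rho) would do; [sig] below is the value of |D| where m = a',
     hence a lower bound for |D| near time 0. *)
  set (a' := (a + m rho) / 2).
  assert (Ha' : a < a') by (unfold a'; lra).
  assert (S2 : 0 < 1 - a ^ 2 / a' ^ 2).
  { assert (a ^ 2 / a' ^ 2 < 1); [|lra]. apply Rmult_lt_reg_r with (a' ^ 2); [nra|].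
    replace (a ^ 2 / a' ^ 2 * a' ^ 2) with (a ^ 2) by (field; lra). nra. }
  assert (Hs := sqrt_lt_R0 _ S2). assert (Es := pow2_sqrt _ (Rlt_le _ _ S2)).
  set (sig := sqrt (1 - a ^ 2 / a' ^ 2)) in *.
  destruct (proj2 (continuous_eps (fun u => m (R0 u)) 0) (continuous_mR 0) (m rho - a') ltac:(unfold a'; lra))
    as (d & Hd & K).
  destruct (Hinward sig (Rmin d T) Hs ltac:(now apply Rmin_pos)) as (h & Hh & Hlow).
  generalize (Rmin_l d T) (Rmin_r d T). intros.
  destruct (MVT_open R0 D 0 h) as (xi & Hxi & E); [lra|intros; apply HR|intros; apply HD; lra|].
  rewrite HR0 in E. specialize (Hmin h ltac:(lra)).
  assert (B1 : 0 <= D xi) by nra. assert (B2 : D xi < sig) by nra.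
  assert (E2 := HD2 xi ltac:(lra)).
  specialize (K xi). rewrite HR0 in K.
  assert (K' : Rabs (m (R0 xi) - m rho) < m rho - a').
  { apply K. rewrite Rminus_0_r, Rabs_pos_eq; lra. }
  apply Rabs_def2 in K'.
  assert (B3 : / m (R0 xi) ^ 2 <= / a' ^ 2).
  { apply Rinv_le_contravar; [nra|]. apply pow_incr. lra. }
  assert (B4 : a ^ 2 * / m (R0 xi) ^ 2 <= a ^ 2 * / a' ^ 2) by (apply Rmult_le_compat_l; [nra|lra]).
  unfold Rdiv in *. nra.
Qed.

(** Only selected stretches of the ray are estimated: monotonicity of [Th] covers the others, on
    which the radius may oscillate. *)
Lemma sweep_reaches_PI : exists T, 0 <= T /\ PI <= a * Th T.
Proof.
assert (Hzy := z_lt_y). assert (Hb := b_bounds). assert (Hal := angle_bounds).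
assert (Hmy : 0 < m y) by (apply m_pos; lra).
assert (Hmx : 0 < m x) by (apply m_pos; lra).
destruct (Classical_Prop.classic (exists T, 0 <= T /\ y <= R0 T)) as [(T0 & HT0 & HyT)|Hno].
2:{ assert (Hlt : forall t, 0 <= t -> R0 t < y).
  { intros t Ht. apply Rnot_le_lt. intros Hle. apply Hno. now exists t. }
  assert (Hpi := PI_RGT_0).
  (* A ray that never leaves the disc turns at rate at least a / m(y)^2, so it has turned by PI at
     this time. *)
  set (T := PI * m y ^ 2 / a). assert (HT : 0 < T).
  { apply Rdiv_lt_0_compat; [|exact Ha]. apply Rmult_lt_0_compat; nra. }
  exists T. split; [lra|].
  assert (Hgrow : Th 0 - 0 * / m y ^ 2 <= Th T - T * / m y ^ 2).
  { apply (nondecreasing_of_derive_nonneg (fun t => Th t - t * / m y ^ 2)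
      (fun t => / m (R0 t) ^ 2 - / m y ^ 2)); [lra| |].
    - intros t _. apply continuous_Rminus; [exact (is_derive_continuous _ _ _ (HTh t))|].
      apply continuous_Rmult; [apply continuous_id|apply continuous_const].
    - intros t Ht. split.
      + apply (is_derive_minus Th (fun t => t * / m y ^ 2)); [apply HTh|].
        auto_derive; [trivial|]. apply Rmult_1_l.
      + specialize (Hlt t ltac:(lra)). specialize (HRpos t). specialize (Hge t).
        assert (/ m y ^ 2 <= / m (R0 t) ^ 2); [|lra].
        apply Rinv_le_contravar; [nra|]. apply pow_incr. split; [lra|apply m_le; lra]. }
  rewrite HTh0 in Hgrow.
  apply Rle_trans with (a * (T * / m y ^ 2)); [|apply Rmult_le_compat_l; lra].
  right. unfold T. field. lra. }
destruct (first_zero (fun t => y - R0 t) 0 T0) as (T & HT & ET & Hbef).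
{ intros u. apply continuous_Rminus; [apply continuous_const|apply HR]. }
{ exact HT0. } { rewrite HR0. lra. } { lra. }
assert (ET' : R0 T = y) by lra.
assert (Hbefore : forall t, 0 <= t < T -> R0 t < y) by (intros t Ht; specialize (Hbef t Ht); lra).
assert (Hle : forall t, 0 <= t <= T -> R0 t <= y).
{ intros t Ht. destruct (proj2 Ht) as [H| ->]; [apply Rlt_le, Hbefore; lra|lra]. }
exists T. split; [lra|].
destruct (turning_point T ltac:(lra) ET' Hbefore) as (ts & Hts & Ets).
assert (CmR : forall u, continuous (fun u => m (R0 u) - a) u).
{ intros u. apply continuous_Rminus; [apply continuous_mR|apply continuous_const]. }
assert (Hmrho : m x <= m rho) by (apply m_le; lra).
assert (Hmrz : m rho <= cos (PI * b) * m y) by (rewrite <- Hmz; apply m_le; lra).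
assert (Harho : a <= m rho) by (rewrite <- HR0; apply Hge).
assert (Hmrho' : m rho < m y) by (apply m_incr; lra).
(* After the last contact with the parallel m = a the model angle is differentiable along the
   ray. *)
destruct (last_zero (fun u => m (R0 u) - a) ts T CmR ltac:(lra) ltac:(lra)) as (tb & Htb & Etb & Hafter).
{ rewrite ET'. lra. }
assert (Mono := sweep_mono m R0 Th HTh).
assert (Gain := sweep_gain m R0 D Th a is_derive_m Ha HR HD HD2 HTh).
assert (H0 := Mono 0 tb ltac:(lra)). rewrite HTh0 in H0.
destruct (Rle_lt_dec (m x) a) as [Hax|Hax].
(* The ray stays in the cone. From a <= m(rho) <= cos(PI b) m(y), its model angle at radius y is at
   least PI b, that is, a turn by PI. *)
- assert (G := Gain 0 b tb T (Rle_refl 0) ltac:(lra) ltac:(lra)).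
  replace (m (R0 tb)) with a in G by lra. rewrite model_angle_start, ET', Rminus_0_r in G.
  assert (G' : PI * b <= model_angle 0 a (m y)).
  { assert (L := model_angle_0_ge (PI * b) a a (m y) Hal ltac:(lra) ltac:(lra)).
    rewrite Rminus_diag, sqrt_0 in L.
    replace ((1 + tan (PI * b) ^ 2) * (0 / a) ^ 2 + tan (PI * b) ^ 2) with (tan (PI * b) ^ 2) in L by (field; lra).
    rewrite sqrt_pow2, atan_tan in L; [exact L|lra|]. apply Rlt_le, tan_gt_0; lra. }
  assert (G2 : PI * b <= b * a * (Th T - Th tb)).
  { eapply Rle_trans; [exact G'|]. eapply Rle_trans; [apply Rle_abs|]. apply G.
    - intros; lra.
    - intros u Hu. specialize (Hafter u ltac:(lra)).
      assert (x <= R0 u <= y).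
      { split; [|apply Hle; lra]. apply Rnot_lt_le. intros Hlt.
        assert (m (R0 u) < m x); [|lra]. apply m_incr; [|exact Hlt|lra]. apply Rlt_le, HRpos. }
      split; [lra|]. split; [apply Rlt_le, Hm'; lra|now apply cone_bound]. }
  assert (a * Th tb >= 0) by nra.
  apply Rmult_le_reg_r with b; [lra|]. nra.
- assert (Hts0 : 0 < ts).
  { destruct (proj1 Hts) as [|E]; [assumption|]. rewrite <- E, HR0 in Ets. lra. }
  destruct (first_zero (fun u => m (R0 u) - a) 0 ts CmR ltac:(lra)) as (ta & Hta & Eta & Hbta);
    [rewrite HR0; lra|lra|].
  assert (Htab : ta <= tb).
  { apply Rnot_lt_le. intros Hlt. specialize (Hafter ta ltac:(lra)). lra. }
  assert (CxR : forall u, continuous (fun u => x - R0 u) u).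
  { intros u. apply continuous_Rminus; [apply continuous_const|apply HR]. }
  assert (CRx : forall u, continuous (fun u => R0 u - x) u).
  { intros u. apply continuous_Rminus; [apply HR|apply continuous_const]. }
  assert (Hra : R0 ta < x).
  { apply lt_of_m_lt; [lra|apply Hle; lra|lra]. }
  assert (Hrb : R0 tb < x).
  { apply lt_of_m_lt; [lra|apply Hle; lra|lra]. }
  (* The estimated stretches: [s1] to [ta] inward through the cap, [tb] to [s2] outward through it,
     [s3] to [T] outward through the cone. Last and first crossings of x keep each stretch on one
     side of x. *)
  destruct (last_zero (fun u => x - R0 u) 0 ta CxR ltac:(lra)) as (s1 & Hs1 & Es1 & As1);
    [rewrite HR0; lra|lra|].
  destruct (first_zero (fun u => x - R0 u) tb T CxR ltac:(lra)) as (s2 & Hs2 & Es2 & Bs2);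
    [lra|lra|].
  destruct (last_zero (fun u => R0 u - x) s2 T CRx ltac:(lra)) as (s3 & Hs3 & Es3 & As3);
    [lra|lra|].
  assert (HKp := capK_pos).
  (* The tangent of the flat angle at m(x). The cap angle there has tangent [tau / b], the cap
     having slope b at x. *)
  set (tau := sqrt (m x ^ 2 - a ^ 2) / a).
  assert (EX : model_angle capK a (m x) = atan (tau / b)).
  { unfold model_angle. rewrite capK_x, sqrt_pow2 by lra. f_equal. unfold tau. field. lra. }
  assert (Htau : 0 < tau).
  { apply Rdiv_lt_0_compat; [|exact Ha]. apply sqrt_lt_R0. nra. }
  assert (EX0 : model_angle 0 a (m x) = atan tau).
  { unfold model_angle. replace (1 - 0 * m x ^ 2) with 1 by ring. rewrite sqrt_1. f_equal. unfold tau. field. lra. }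
  assert (G1 := Gain capK 1 s1 ta ltac:(lra) ltac:(lra) ltac:(lra)).
  replace (m (R0 ta)) with a in G1 by lra. replace (R0 s1) with x in G1 by lra.
  rewrite model_angle_start, EX in G1.
  assert (G2 := Gain capK 1 tb s2 ltac:(lra) ltac:(lra) ltac:(lra)).
  replace (m (R0 tb)) with a in G2 by lra. replace (R0 s2) with x in G2 by lra.
  rewrite model_angle_start, EX in G2.
  assert (G3 := Gain 0 b s3 T ltac:(lra) ltac:(lra) ltac:(lra)).
  replace (R0 s3) with x in G3 by lra. rewrite ET', EX0 in G3.
  assert (Q1 : atan (tau / b) <= 1 * a * (Th ta - Th s1)).
  { eapply Rle_trans; [|apply G1].
    - rewrite <- Rabs_Ropp, Ropp_minus_distr, Rminus_0_r. apply Rle_abs.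
    - intros u Hu. apply capK_lt_1. split; [apply Rlt_le, HRpos|].
      destruct (proj1 Hu) as [H| <-]; [specialize (As1 u ltac:(lra))|]; lra.
    - intros u Hu. specialize (As1 u ltac:(lra)). specialize (Hbta u ltac:(lra)).
      assert (B := HRpos u). split; [lra|].
      split; [apply Rlt_le, Hm'; lra|]. rewrite Rmult_1_l. apply cap_bound. lra. }
  assert (Q2 : atan (tau / b) <= 1 * a * (Th s2 - Th tb)).
  { eapply Rle_trans; [|apply G2].
    - rewrite Rminus_0_r. apply Rle_abs.
    - intros u Hu. apply capK_lt_1. split; [apply Rlt_le, HRpos|].
      destruct (proj2 Hu) as [H| ->]; [specialize (Bs2 u ltac:(lra))|]; lra.
    - intros u Hu. specialize (Bs2 u ltac:(lra)). specialize (Hafter u ltac:(lra)).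
      assert (B := HRpos u). split; [lra|].
      split; [apply Rlt_le, Hm'; lra|]. rewrite Rmult_1_l. apply cap_bound. lra. }
  assert (Q3 : model_angle 0 a (m y) - atan tau <= b * a * (Th T - Th s3)).
  { eapply Rle_trans; [|apply G3].
    - apply Rle_abs.
    - intros; lra.
    - intros u Hu. specialize (As3 u ltac:(lra)). specialize (Hafter u ltac:(lra)).
      assert (B := Hle u ltac:(lra)). split; [lra|].
      split; [apply Rlt_le, Hm'; lra|]. apply cone_bound. lra. }
  assert (L := model_angle_0_ge (PI * b) a (m x) (m y) Hal ltac:(lra) ltac:(lra)). fold tau in L.
  assert (C := cap_cone_angle b tau Hb Htau).
  assert (M1 := Mono 0 s1 ltac:(lra)). assert (M2 := Mono ta tb Htab). assert (M3 := Mono s2 s3 ltac:(lra)).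
  rewrite HTh0 in M1.
  assert (Q3' : / b * (model_angle 0 a (m y) - atan tau) <= a * (Th T - Th s3)).
  { apply Rmult_le_reg_l with b; [lra|].
    replace (b * (/ b * (model_angle 0 a (m y) - atan tau))) with (model_angle 0 a (m y) - atan tau) by (field; lra). lra. }
  assert (Q4 : / b * (atan (sqrt ((1 + tan (PI * b) ^ 2) * tau ^ 2 + tan (PI * b) ^ 2)) - atan tau)
     <= / b * (model_angle 0 a (m y) - atan tau)).
  { apply Rmult_le_compat_l; [apply Rlt_le, Rinv_0_lt_compat|]; lra. }
  assert (N1 : 0 <= a * Th s1) by nra.
  assert (N2 : a * Th ta <= a * Th tb) by (apply Rmult_le_compat_l; lra).
  assert (N3 : a * Th s2 <= a * Th s3) by (apply Rmult_le_compat_l; lra).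
  lra.
Qed.

End Escape.

(** * A shortcut past the origin *)

(* A primitive, in the comparison surface m' = B * sqrt (1 - K m^2), of 1/m^2:
   the infinitesimal variation of the meridians through a point. *)
Definition model_slope (K B u : R) : R := - (sqrt (1 - K * m u ^ 2) / (B * m u)).

(** Along the curve theta = e h(r) + phi the slope bound gives m^2 h' <= 1, so the speed sqrt(1 +
    e^2 m^2 h'^2) is at most 1 + e^2 h' / 2, whose integral is explicit. *)
Lemma rdist_polar_graph K B r1 r2 e phi : 0 < r1 <= r2 -> r2 <= y -> 0 < B ->
  (forall u, r1 <= u <= r2 -> K * m u ^ 2 < 1 /\ Derive m u <= B * sqrt (1 - K * m u ^ 2)) ->
  rdist m (r1 * cos (e * model_slope K B r1 + phi)) (r1 * sin (e * model_slope K B r1 + phi))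
          (r2 * cos (e * model_slope K B r2 + phi)) (r2 * sin (e * model_slope K B r2 + phi)) <=
  r2 - r1 + e ^ 2 / 2 * (model_slope K B r2 - model_slope K B r1).
Proof.
intros Hr1 Hr2 HB Hu. set (h := model_slope K B).
set (dh := fun u => Derive m u / (B * m u ^ 2 * sqrt (1 - K * m u ^ 2))).
assert (Hq : forall u, r1 <= u <= r2 -> 0 < sqrt (1 - K * m u ^ 2)).
{ intros u Hu'. apply sqrt_lt_R0. generalize (Hu u Hu'). lra. }
assert (Hmp : forall u, r1 <= u <= r2 -> 0 < m u) by (intros; apply m_pos; lra).
assert (Dh : forall u, r1 <= u <= r2 -> is_derive h u (dh u)).
{ intros u Hu'. specialize (Hq u Hu'). specialize (Hmp u Hu').
  assert (D1 := is_derive_pow m 2 u _ (is_derive_m u)).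
  assert (D2 := is_derive_minus _ _ _ _ _ (is_derive_Rconst 1 u) (is_derive_scal _ _ K _ D1)).
  assert (P : 0 < 1 - K * m u ^ 2) by (generalize (Hu u Hu'); lra).
  assert (D3 := is_derive_sqrt _ _ _ D2 P).
  assert (Dm := is_derive_scal _ _ B _ (is_derive_m u)).
  assert (D4 := is_derive_div _ _ _ _ _ D3 Dm ltac:(apply Rgt_not_eq; nra)).
  assert (D5 := is_derive_opp _ _ _ D4).
  apply (is_derive_eq _ _ _ _ D5). unfold dh, minus, plus, opp; simpl.
  assert (EQ : sqrt (1 - K * m u ^ 2) ^ 2 = 1 - K * m u ^ 2) by (apply pow2_sqrt; lra).
  simpl in Hq, EQ |- *. unfold minus, plus, opp; simpl. change (1 + - (K * (m u * (m u * 1)))) with (1 - K * (m u * (m u * 1))) in *.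
  set (Q := sqrt _) in *.
  transitivity (Derive m u * (Q * (Q * 1) + K * (m u * (m u * 1))) / (B * m u ^ 2 * Q)).
  - field. repeat split; lra.
  - rewrite EQ. field. repeat split; lra. }
assert (Cdh : forall u, r1 <= u <= r2 -> continuous dh u).
{ intros u Hu'. specialize (Hq u Hu'). specialize (Hmp u Hu').
  assert (Cm := continuous_m u). assert (Cm' := continuous_m' u).
  unfold dh, Rdiv. apply continuous_Rmult; [exact Cm'|]. apply continuous_Rinv_fun.
  - cont.
  - apply Rgt_not_eq. repeat apply Rmult_lt_0_compat; lra. }
assert (Bdh : forall u, r1 <= u <= r2 -> 0 <= dh u /\ m u ^ 2 * dh u <= 1).
{ intros u Hu'. specialize (Hq u Hu'). specialize (Hmp u Hu'). destruct (Hu u Hu') as [_ K2].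
  assert (M' : 0 < Derive m u) by (apply Hm'; lra).
  set (Q := sqrt _) in *.
  split.
  - unfold dh. apply Rlt_le, Rdiv_lt_0_compat; [exact M'|].
    apply Rmult_lt_0_compat; [|exact Hq]. apply Rmult_lt_0_compat; [exact HB|]. apply pow2_gt_0. lra.
  - unfold dh. fold Q. replace (m u ^ 2 * (Derive m u / (B * m u ^ 2 * Q))) with (Derive m u / (B * Q)) by (field; repeat split; lra).
    apply Rmult_le_reg_r with (B * Q); [nra|].
    replace (Derive m u / (B * Q) * (B * Q)) with (Derive m u) by (field; repeat split; lra). lra. }
set (al := fun u => e * h u + phi).
assert (Dal : forall u, r1 <= u <= r2 -> is_derive al u (e * dh u)).
{ intros u Hu'. apply (is_derive_eq _ _ _ _ (is_derive_plus _ _ _ _ _ (is_derive_scal _ _ e _ (Dh u Hu')) (is_derive_Rconst phi u))).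
  unfold plus; simpl. ring. }
assert (Cal : forall u, r1 <= u <= r2 -> continuous al u).
{ intros u Hu'. exact (is_derive_continuous _ _ _ (Dal u Hu')). }
assert (Ccos : forall u, r1 <= u <= r2 -> continuous (fun v => cos (al v)) u).
{ intros u Hu'. apply (continuous_Rcomp cos); [now apply Cal|]. exact (is_derive_continuous _ _ _ (is_derive_cos _)). }
assert (Csin : forall u, r1 <= u <= r2 -> continuous (fun v => sin (al v)) u).
{ intros u Hu'. apply (continuous_Rcomp sin); [now apply Cal|]. exact (is_derive_continuous _ _ _ (is_derive_sin _)). }
apply rdist_le; [apply m_profile|].
replace (r2 - r1 + e ^ 2 / 2 * (h r2 - h r1)) with (r2 + e ^ 2 / 2 * h r2 - (r1 + e ^ 2 / 2 * h r1)) by ring.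
apply (dist_le_param m r1 r2 (fun u => u * cos (al u)) (fun u => u * sin (al u))
  (fun u => cos (al u) - u * (e * dh u) * sin (al u)) (fun u => sin (al u) + u * (e * dh u) * cos (al u))
  (fun u => u + e ^ 2 / 2 * h u) (fun u => 1 + e ^ 2 / 2 * dh u)); [apply m_profile|lra|].
intros u Hu'.
assert (I : is_derive (fun v : R => v) u 1) by exact (is_derive_id u).
assert (K2 : forall (f g : R -> R) u df dg, is_derive f u df -> is_derive g u dg ->
  is_derive (fun v => f v * g v) u (df * g u + f u * dg)).
{ intros f g v df dg Hf Hg. apply (is_derive_mult f g v df dg); auto. intros; apply Rmult_comm. }
specialize (Ccos u Hu'). specialize (Csin u Hu'). specialize (Cdh u Hu').
split; [|split; [|split; [|split; [|split]]]].
- assert (Y := K2 _ _ _ _ _ I (is_derive_comp cos al u _ _ (is_derive_cos _) (Dal u Hu'))).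
  apply (is_derive_eq _ _ _ _ Y). unfold scal; simpl; unfold mult; simpl. ring.
- assert (Y := K2 _ _ _ _ _ I (is_derive_comp sin al u _ _ (is_derive_sin _) (Dal u Hu'))).
  apply (is_derive_eq _ _ _ _ Y). unfold scal; simpl; unfold mult; simpl. ring.
- cont.
- cont.
- exact (is_derive_plus (fun v : R => v) (fun v => e ^ 2 / 2 * h v) u _ _ I (is_derive_scal _ _ (e ^ 2 / 2) _ (Dh u Hu'))).
- destruct (Bdh u Hu') as [B1 B2]. specialize (Hmp u Hu').
  assert (SC := sin2_cos2 (al u)). unfold Rsqr in SC.
  set (C := cos (al u)) in *. set (S := sin (al u)) in *. set (w := e * dh u) in *.
  assert (ER : rad (u * C) (u * S) = u).
  { apply rad_unique; [lra|]. transitivity (u ^ 2 * (S * S + C * C)); [ring|rewrite SC; ring]. }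
  rewrite metric_polar; rewrite ER; [|lra].
  replace ((u * C * (C - u * w * S) + u * S * (S + u * w * C)) / u) with 1
    by (transitivity (S * S + C * C); [now rewrite SC|field; lra]).
  replace ((u * C * (S + u * w * C) - u * S * (C - u * w * S)) / u ^ 2) with w
    by (transitivity (w * (S * S + C * C)); [rewrite SC; ring|field; lra]).
  assert (B3 : (m u * w) ^ 2 <= e ^ 2 * dh u).
  { replace ((m u * w) ^ 2) with (e ^ 2 * dh u * (m u ^ 2 * dh u)) by (unfold w; ring).
    assert (0 <= e ^ 2 * dh u) by (apply Rmult_le_pos; [apply pow2_ge_0|exact B1]). nra. }
  assert (B4 : 0 <= e ^ 2 * dh u) by (apply Rmult_le_pos; [apply pow2_ge_0|exact B1]).
  rewrite <- (sqrt_pow2 (1 + e ^ 2 / 2 * dh u)) by lra. apply sqrt_le_1_alt. nra.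
Qed.

Lemma m_le_id u : 0 <= u <= x -> m u <= u.
Proof.
intros Hu. destruct (proj1 Hu) as [H0| <-]; [|rewrite m_0; lra].
destruct (MVT_open m (Derive m) 0 u H0) as (c & Hc & E).
- intros; apply continuous_m.
- intros; apply is_derive_m.
- rewrite m_0 in E. assert (B := cap_bound c ltac:(lra)).
  assert (sqrt (1 - capK * m c ^ 2) <= 1).
  { rewrite <- sqrt_1 at 2. apply sqrt_le_1_alt. generalize capK_pos (pow2_ge_0 (m c)). intros. nra. }
  nra.
Qed.

Lemma metric_le_euclid p1 p2 w1 w2 : rad p1 p2 <= x ->
  metric m p1 p2 w1 w2 w1 w2 <= w1 ^ 2 + w2 ^ 2.
Proof.
intros Hp. destruct (Req_dec (rad p1 p2) 0) as [E|E].
- unfold metric. rewrite E. destruct (Req_EM_T 0 0); [|lra]. right. ring.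
- rewrite metric_polar by exact E. assert (H0 := rad_nonneg p1 p2).
  assert (R2 := rad_sqr p1 p2). set (r := rad p1 p2) in *.
  assert (M0 : 0 < m r) by (apply m_pos; lra). assert (M1 : m r <= r) by (apply m_le_id; lra).
  replace (w1 ^ 2 + w2 ^ 2) with (((p1 * w1 + p2 * w2) / r) ^ 2 + (r * ((p1 * w2 - p2 * w1) / r ^ 2)) ^ 2).
  2:{ transitivity ((p1 ^ 2 + p2 ^ 2) * (w1 ^ 2 + w2 ^ 2) / r ^ 2); [field; exact E|rewrite <- R2; field; exact E]. }
  apply Rplus_le_compat_l. rewrite !Rpow_mult_distr.
  apply Rmult_le_compat_r; [apply pow2_ge_0|]. apply pow_incr. lra.
Qed.

(** The competitor is the straight segment: it stays within radius [del], where the metric is at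
    most the Euclidean one because m(r) <= r. *)
Lemma rdist_chord del t1 t2 : 0 < del <= x -> t1 <= t2 <= t1 + 2 * PI ->
  rdist m (del * cos t1) (del * sin t1) (del * cos t2) (del * sin t2) <= 2 * del * sin ((t2 - t1) / 2).
Proof.
intros Hd Ht. apply rdist_le; [apply m_profile|].
set (a1 := del * cos t1). set (a2 := del * sin t1). set (b1 := del * cos t2). set (b2 := del * sin t2).
set (C := 2 * del * sin ((t2 - t1) / 2)).
assert (HC : 0 <= C).
{ unfold C. apply Rmult_le_pos; [lra|]. apply sin_ge_0; lra. }
assert (EC : (b1 - a1) ^ 2 + (b2 - a2) ^ 2 = C ^ 2).
{ assert (S1 := sin2_cos2 t1). assert (S2 := sin2_cos2 t2). unfold Rsqr in S1, S2.
  assert (E := cos_minus t2 t1).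
  assert (E2 : cos (t2 - t1) = 1 - 2 * sin ((t2 - t1) / 2) * sin ((t2 - t1) / 2)).
  { rewrite <- cos_2a_sin. f_equal. field. }
  rewrite E2 in E.
  transitivity (del ^ 2 * ((sin t1 * sin t1 + cos t1 * cos t1) + (sin t2 * sin t2 + cos t2 * cos t2)
     - 2 * (cos t2 * cos t1 + sin t2 * sin t1))).
  - unfold a1, a2, b1, b2. ring.
  - rewrite S1, S2, <- E. unfold C. ring. }
assert (HL : forall (u v t : R), is_derive (fun t => u + t * v) t v).
{ intros u v t. auto_derive; [trivial|ring]. }
assert (K := dist_le_param m 0 1 (fun t => a1 + t * (b1 - a1)) (fun t => a2 + t * (b2 - a2))
  (fun _ => b1 - a1) (fun _ => b2 - a2) (fun t => 0 + t * C) (fun _ => C) m_profile ltac:(lra)).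
cbv beta in K.
replace (a1 + 0 * (b1 - a1)) with a1 in K by ring. replace (a2 + 0 * (b2 - a2)) with a2 in K by ring.
replace (a1 + 1 * (b1 - a1)) with b1 in K by ring. replace (a2 + 1 * (b2 - a2)) with b2 in K by ring.
replace (0 + 1 * C - (0 + 0 * C)) with C in K by ring.
apply K. intros t Ht'.
do 2 (split; [apply HL|]). do 2 (split; [apply continuous_const|]). split; [apply HL|].
rewrite <- (sqrt_pow2 C) by exact HC. apply sqrt_le_1_alt. rewrite <- EC. apply metric_le_euclid.
unfold rad. apply Rle_trans with del; [|lra].
rewrite <- (sqrt_pow2 del) by lra. apply sqrt_le_1_alt.
assert (N1 : a1 ^ 2 + a2 ^ 2 = del ^ 2).
{ assert (S1 := sin2_cos2 t1). unfold Rsqr in S1. transitivity (del ^ 2 * (sin t1 * sin t1 + cos t1 * cos t1)); [unfold a1, a2; ring|rewrite S1; ring]. }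
assert (N2 : b1 ^ 2 + b2 ^ 2 = del ^ 2).
{ assert (S1 := sin2_cos2 t2). unfold Rsqr in S1. transitivity (del ^ 2 * (sin t2 * sin t2 + cos t2 * cos t2)); [unfold b1, b2; ring|rewrite S1; ring]. }
assert (Cv : (a1 + t * (b1 - a1)) ^ 2 + (a2 + t * (b2 - a2)) ^ 2 =
  (1 - t) * (a1 ^ 2 + a2 ^ 2) + t * (b1 ^ 2 + b2 ^ 2) - t * (1 - t) * ((b1 - a1) ^ 2 + (b2 - a2) ^ 2)) by ring.
rewrite Cv, N1, N2, EC. assert (0 <= t * (1 - t)) by nra. assert (0 <= C ^ 2) by nra. nra.
Qed.

(** A lower bound with relative error v is enough: the drift will cost less than the chord saves by
    a factor 1 - 4v. *)
Lemma sin_lower v : 0 <= v <= 1 -> v * (1 - v) <= sin v.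
Proof.
intros Hv. destruct (proj1 Hv) as [H0| <-]; [|rewrite sin_0; lra].
destruct (MVT_open sin cos 0 v H0) as (c & Hc & E).
- intros t _. exact (is_derive_continuous _ _ _ (is_derive_sin t)).
- intros; apply is_derive_sin.
- rewrite sin_0 in E.
  destruct (MVT_open cos (fun t => - sin t) 0 c ltac:(lra)) as (c2 & Hc2 & E2).
  + intros t _. exact (is_derive_continuous _ _ _ (is_derive_cos t)).
  + intros; apply is_derive_cos.
  + rewrite cos_0 in E2. assert (sin c2 * c <= 1 * c).
    { apply Rmult_le_compat_r; [lra|apply SIN_bound]. }
    rewrite !Rminus_0_r, Rmult_comm in E. rewrite E. apply Rmult_le_compat_l; lra.
Qed.

(* Follow the meridian down to x, drift by the angle e * A down to a small
   radius del, cut along the straight chord, and drift up again by e * A and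
   e * C: to second order in e the drift costs e^2/2 * N and the chord saves
   del * (e * N)^2 / 4, with N = 2 * A + C > 2 / del. *)
Lemma rdist_through_origin rho : x <= rho <= z -> rdist m rho 0 (- y) 0 < rho + y.
Proof.
intros Hrho. assert (Hzy := z_lt_y). assert (Hb := b_bounds). assert (HK := capK_pos).
assert (Hal := angle_bounds).
assert (Hmx : 0 < m x) by (apply m_pos; lra). assert (Hmy : 0 < m y) by (apply m_pos; lra).
assert (Hpr := m_profile).
(* The part of the lower bound for N - 2 / del that does not depend on [del], namely C - 2 b / m(x).
   It is positive because m(x) / m(y) <= cos(PI b) < 1 - 2 b^2. *)
set (G := / (b * m x) * (1 - m x / m y - 2 * b ^ 2)).
assert (HG : 0 < G).
{ apply Rmult_lt_0_compat; [apply Rinv_0_lt_compat; nra|].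
  assert (m x <= cos (PI * b) * m y) by (rewrite <- Hmz; apply m_le; lra).
  assert (m x / m y <= cos (PI * b)).
  { apply Rmult_le_reg_r with (m y); [exact Hmy|]. replace (m x / m y * m y) with (m x) by (field; lra). assumption. }
  generalize (two_sqr_lt_1_sub_cos b Hb). lra. }
(* Small enough for the cap's correction [2 * capK * del] to use up at most half of G. *)
set (del := Rmin (x / 2) (G / (4 * capK))).
assert (Hd0 : 0 < del) by (apply Rmin_pos; [lra|apply Rdiv_lt_0_compat; lra]).
assert (Hdx : del <= x / 2) by apply Rmin_l.
assert (HdG : 2 * capK * del <= G / 2).
{ apply Rle_trans with (2 * capK * (G / (4 * capK))); [|right; field; lra].
  apply Rmult_le_compat_l; [lra|apply Rmin_r]. }
set (A := model_slope capK 1 x - model_slope capK 1 del).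
set (C := model_slope 0 b y - model_slope 0 b x).
assert (EC : C = / b * (/ m x - / m y)).
{ unfold C, model_slope. rewrite !Rmult_0_l, Rminus_0_r, sqrt_1. field. lra. }
assert (HA : / del - capK * del - b / m x <= A).
{ unfold A, model_slope. rewrite capK_x, sqrt_pow2, !Rmult_1_l by lra.
  assert (Hs : 0 < m del) by (apply m_pos; lra). assert (Hs2 : m del <= del) by (apply m_le_id; lra).
  assert (Hs3 := capK_lt_1 del ltac:(lra)).
  assert (1 - capK * m del ^ 2 <= sqrt (1 - capK * m del ^ 2)).
  { rewrite <- (sqrt_pow2 (1 - capK * m del ^ 2)) at 1 by lra. apply sqrt_le_1_alt.
    assert (0 <= capK * m del ^ 2) by nra. nra. }
  assert (/ m del - capK * m del <= sqrt (1 - capK * m del ^ 2) / m del).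
  { replace (/ m del - capK * m del) with ((1 - capK * m del ^ 2) / m del) by (field; lra).
    apply Rmult_le_compat_r; [apply Rlt_le, Rinv_0_lt_compat; lra|assumption]. }
  assert (/ del <= / m del) by (apply Rinv_le_contravar; lra).
  assert (capK * m del <= capK * del) by (apply Rmult_le_compat_l; lra). lra. }
set (N := 2 * A + C).
assert (HN : 2 / del + G / 2 <= N).
{ assert (EG : G = / b * (/ m x - / m y) - 2 * (b / m x)) by (unfold G; field; lra).
  unfold N. rewrite EC. unfold Rdiv at 1. lra. }
assert (HdN : 2 < del * N).
{ apply Rlt_le_trans with (del * (2 / del + G / 2)); [|apply Rmult_le_compat_l; lra].
  replace (del * (2 / del + G / 2)) with (2 + del * G / 2) by (field; lra). nra. }
assert (HNp : 0 < N) by nra.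
(* With total drift e N = 4v the drift costs 4 del v^2 (2 / (del N)), and the chord saves 4 del
   sin(v)^2 >= 4 del v^2 (1 - v)^2. This [v] makes the first factor 1 - 4v, which is below (1 -
   v)^2. *)
set (v := (1 - 2 / (del * N)) / 4).
assert (Hf : 0 < 2 / (del * N) < 1).
{ split; [apply Rdiv_lt_0_compat; lra|]. apply Rmult_lt_reg_r with (del * N); [lra|].
  replace (2 / (del * N) * (del * N)) with 2 by (field; split; lra). lra. }
assert (Hv : 0 < v < 1 / 4) by (unfold v; lra).
set (e := 4 * v / N). assert (He : e * N = 4 * v) by (unfold e; field; lra).
assert (capb : forall u, del <= u <= x -> capK * m u ^ 2 < 1 /\ Derive m u <= 1 * sqrt (1 - capK * m u ^ 2)).
{ intros u Hu. split; [apply capK_lt_1; lra|]. rewrite Rmult_1_l. apply cap_bound; lra. }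
assert (coneb : forall u, x <= u <= y -> 0 * m u ^ 2 < 1 /\ Derive m u <= b * sqrt (1 - 0 * m u ^ 2)).
{ intros u Hu. split; [lra|now apply cone_bound]. }
assert (P1 := rdist_polar_graph 0 b x rho 0 0 ltac:(lra) ltac:(lra) ltac:(lra)
  ltac:(intros u Hu; apply coneb; lra)).
assert (P2 := rdist_polar_graph capK 1 del x (- e) (e * model_slope capK 1 x) ltac:(lra) ltac:(lra) ltac:(lra) capb).
assert (P4 := rdist_polar_graph capK 1 del x e (PI - e * C - e * model_slope capK 1 x) ltac:(lra) ltac:(lra) ltac:(lra) capb).
assert (P5 := rdist_polar_graph 0 b x y e (PI - e * model_slope 0 b y) ltac:(lra) ltac:(lra) ltac:(lra) coneb).
fold A in P2, P4. fold C in P5.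
replace (0 * model_slope 0 b x + 0) with 0 in P1 by ring.
replace (0 * model_slope 0 b rho + 0) with 0 in P1 by ring.
rewrite sin_0, cos_0, !Rmult_0_r, !Rmult_1_r in P1.
replace (- e * model_slope capK 1 x + e * model_slope capK 1 x) with 0 in P2 by ring.
replace (- e * model_slope capK 1 del + e * model_slope capK 1 x) with (e * A) in P2 by (unfold A; ring).
rewrite sin_0, cos_0, Rmult_0_r, Rmult_1_r in P2.
replace (e * model_slope capK 1 x + (PI - e * C - e * model_slope capK 1 x)) with (PI - e * C) in P4 by ring.
replace (e * model_slope capK 1 del + (PI - e * C - e * model_slope capK 1 x)) with (PI - e * C - e * A) in P4 by (unfold A; ring).
replace (e * model_slope 0 b x + (PI - e * model_slope 0 b y)) with (PI - e * C) in P5 by (unfold C; ring).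
replace (e * model_slope 0 b y + (PI - e * model_slope 0 b y)) with PI in P5 by ring.
rewrite sin_PI, cos_PI, Rmult_0_r in P5. replace (y * -1) with (- y) in P5 by ring.
assert (Hpi := PI2_3_2).
assert (P3 := rdist_chord del (e * A) (PI - e * C - e * A) ltac:(lra)).
assert (EN : e * N = 2 * (e * A) + e * C) by (unfold N; ring).
assert (He0 : 0 < e) by (unfold e; apply Rdiv_lt_0_compat; lra).
specialize (P3 ltac:(lra)).
replace ((PI - e * C - e * A - e * A) / 2) with (PI / 2 - 2 * v) in P3 by lra.
rewrite sin_shift in P3.
assert (T1 := rdist_triangle m rho 0 x 0 (- y) 0 Hpr).
assert (T2 := rdist_triangle m x 0 (del * cos (e * A)) (del * sin (e * A)) (- y) 0 Hpr).
assert (T3 := rdist_triangle m (del * cos (e * A)) (del * sin (e * A))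
  (del * cos (PI - e * C - e * A)) (del * sin (PI - e * C - e * A)) (- y) 0 Hpr).
assert (T4 := rdist_triangle m (del * cos (PI - e * C - e * A)) (del * sin (PI - e * C - e * A))
  (x * cos (PI - e * C)) (x * sin (PI - e * C)) (- y) 0 Hpr).
assert (S1 := rdist_sym m rho 0 x 0 Hpr).
assert (S2 := rdist_sym m x 0 (del * cos (e * A)) (del * sin (e * A)) Hpr).
assert (Hcos : cos (2 * v) = 1 - 2 * sin v * sin v) by apply cos_2a_sin.
assert (Hsin := sin_lower v ltac:(lra)).
assert (Hsin2 : (v * (1 - v)) ^ 2 <= sin v * sin v).
{ replace (sin v * sin v) with (sin v ^ 2) by ring. apply pow_incr. split; [nra|exact Hsin]. }
assert (Key : e ^ 2 / 2 * N < 4 * del * (sin v * sin v)).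
{ apply Rlt_le_trans with (4 * del * (v * (1 - v)) ^ 2); [|apply Rmult_le_compat_l; lra].
  replace (e ^ 2 / 2 * N) with (4 * del * v ^ 2 * (2 / (del * N))) by (unfold e; field; lra).
  replace (2 / (del * N)) with (1 - 4 * v) by (unfold v; field; lra).
  replace (4 * del * (v * (1 - v)) ^ 2) with (4 * del * v ^ 2 * (1 - v) ^ 2) by ring.
  apply Rmult_lt_compat_l; [|nra]. apply Rmult_lt_0_compat; nra. }
assert (EN2 : e ^ 2 / 2 * N = 2 * (e ^ 2 / 2 * A) + e ^ 2 / 2 * C) by (unfold N; ring).
replace ((- e) ^ 2) with (e ^ 2) in P2 by ring.
rewrite Hcos in P3.
replace (0 ^ 2 / 2) with 0 in P1 by field. rewrite Rmult_0_l in P1.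
replace (2 * del * (1 - 2 * sin v * sin v)) with (2 * del - 4 * del * (sin v * sin v)) in P3 by ring.
lra.
Qed.

End Profile.

(** * The inward direction and the conclusion *)

(** The argument may lie outside [-1, 1], since [in_Cm] does not record that the initial velocity
    has length 1; [acos] is then PI or 0. *)
Lemma acos_le_PI2 u : acos u <= PI / 2 -> 0 <= u.
Proof.
intros H. apply Rnot_lt_le. intros Hu. assert (Hpi := PI_RGT_0). revert H. unfold acos.
destruct (Rle_dec u (-1)); [lra|]. destruct (Rle_dec 1 u); [lra|]. intros H.
assert (S : 0 < sqrt (1 - u²)) by (apply sqrt_lt_R0; unfold Rsqr; nra).
assert (A : atan (u / sqrt (1 - u²)) < atan 0).
{ apply atan_increasing. unfold Rdiv. apply Rmult_lt_reg_r with (sqrt (1 - u²)); [exact S|].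
  rewrite Rmult_assoc, Rinv_l by lra. lra. }
rewrite atan_0 in A. lra.
Qed.

Lemma metric_inward m q1 q2 w1 w2 : 0 < rad q1 q2 ->
  metric m q1 q2 (- q1 / rad q1 q2) (- q2 / rad q1 q2) w1 w2 = - (q1 * w1 + q2 * w2) / rad q1 q2.
Proof.
intros Hr. unfold metric. destruct (Req_EM_T (rad q1 q2) 0) as [E|_]; [lra|].
assert (R2 := rad_sqr q1 q2). set (r := rad q1 q2) in *.
replace ((q1 * (- q1 / r) + q2 * (- q2 / r)) / r) with (-1).
2:{ transitivity (- (q1 ^ 2 + q2 ^ 2) / r ^ 2); [rewrite <- R2; field; lra|field; lra]. }
field. lra.
Qed.

Theorem theorem6p3 (m : R -> R) (x y : R) :
  model_fun m -> von_mangoldt m ->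
  0 < x -> x < y ->
  (forall t, 0 <= t <= y -> 0 < Derive m t) ->
  (forall t, x <= t <= y -> Derive m t < 1 / 2) ->
  forall b : R,
  (exists t, x <= t <= y /\ Derive m t = b) ->
  (forall t, x <= t <= y -> Derive m t <= b) ->
  forall z : R, 0 <= z <= y -> m z = cos (PI * b) * m y ->
  x <= z ->
  forall q1 q2 : R, in_Cm m q1 q2 -> ~ (x <= rad q1 q2 <= z).
Proof.
intros Hmodel Hvm Hx Hxy Hm' Hhalf b Hbmax Hb' z Hz Hmz Hxz q1 q2 HC Hrho.
assert (Hr : 0 < rad q1 q2) by lra.
destruct (HC (- q1 / rad q1 q2) (- q2 / rad q1 q2)) as (g1 & g2 & w1 & w2 & Hray & E1 & E2 & Hw1 & Hw2 & Hang).
{ rewrite metric_inward by exact Hr.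
  replace (q1 * (- q1 / rad q1 q2) + q2 * (- q2 / rad q1 q2)) with (- rad q1 q2).
  - field. lra.
  - apply Rmult_eq_reg_r with (rad q1 q2); [|lra].
    replace (- rad q1 q2 * rad q1 q2) with (- (rad q1 q2 ^ 2)) by ring. rewrite rad_sqr at 1. field. lra. }
unfold angle in Hang. rewrite metric_inward in Hang by exact Hr. apply acos_le_PI2 in Hang.
subst q1 q2. change (rad (g1 0) (g2 0)) with (radius g1 g2 0) in *.
assert (Hdot : g1 0 * w1 + g2 0 * w2 <= 0).
{ assert (0 <= - (g1 0 * w1 + g2 0 * w2) / radius g1 g2 0 * radius g1 g2 0) by (apply Rmult_le_pos; lra).
  replace (- (g1 0 * w1 + g2 0 * w2) / radius g1 g2 0 * radius g1 g2 0) with (- (g1 0 * w1 + g2 0 * w2)) in H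
    by (field; lra). lra. }
assert (Hm := m_profile m Hmodel).
assert (Hpos : forall r, 0 < r -> 0 < m r) by apply Hmodel.
destruct (Classical_Prop.classic (exists t, 0 < t /\ radius g1 g2 t <> 0 /\ clairaut m g1 g2 t <> 0))
  as [(t & Ht & Hrt & Hc)|Hno].
- set (c := clairaut m g1 g2 t) in *.
  assert (Hcl : forall s, 0 < s -> radius g1 g2 s <> 0 -> clairaut m g1 g2 s = c).
  { intros s Hs Hrs. now apply (clairaut_const m g1 g2 Hm Hray). }
  destruct (sweep_reaches_PI m x y b z Hmodel Hvm Hx Hxy Hm' Hhalf Hbmax Hb' Hz Hmz
    (cradius g1 g2) (radvel g1 g2) (sweep m g1 g2) (Rabs c) (radius g1 g2 0)) as (T & HT & HPI).
  + now apply Rabs_pos_lt.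
  + intros; now apply (continuous_cradius m g1 g2 w1 w2).
  + intros s Hs. apply (is_derive_cradius m); auto.
    apply Rgt_not_eq. apply (r_pos m g1 g2 w1 w2 c); auto; lra.
  + intros s Hs. now apply (radvel_sqr m g1 g2 w1 w2 c).
  + intros s. now apply (is_derive_sweep m g1 g2 w1 w2 c).
  + apply RInt_point_R.
  + intros s. now apply (cradius_pos m g1 g2 w1 w2 c).
  + intros s. now apply (m_cradius_ge m g1 g2 w1 w2 c).
  + apply cradius_pos_eq. lra.
  + exact Hrho.
  + intros sig d Hs Hd. now apply (cradius_inward g1 g2 w1 w2).
  + assert (L := sweep_lt_PI m g1 g2 w1 w2 c Hm Hpos Hray Hw1 Hw2 Hr Hc Hcl T HT). lra.
- assert (Hcl : forall t, 0 < t -> radius g1 g2 t <> 0 -> clairaut m g1 g2 t = 0).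
  { intros t Ht Hrt. apply Classical_Prop.NNPP. intros Hc. apply Hno. now exists t. }
  assert (K := radial_ray m g1 g2 w1 w2 Hm Hpos Hray Hw1 Hw2 Hr Hdot Hcl y ltac:(lra)).
  assert (L := rdist_through_origin m x y b z Hmodel Hvm Hx Hxy Hm' Hhalf Hbmax Hb' Hz Hmz
    (radius g1 g2 0) Hrho).
  set (rho := radius g1 g2 0) in *.
  assert (R2 : rho ^ 2 = g1 0 ^ 2 + g2 0 ^ 2) by apply rad_sqr.
  (* The rotation taking (rho, 0) to g(0), and (-y, 0) to the point of the opposite meridian at
     radius y. *)
  assert (I := rdist_isometry m (g1 0 / rho) (g2 0 / rho) 1 rho 0 (- y) 0 Hm).
  replace (g1 0 / rho * rho - 1 * (g2 0 / rho) * 0) with (g1 0) in I by (field; lra).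
  replace (g2 0 / rho * rho + 1 * (g1 0 / rho) * 0) with (g2 0) in I by (field; lra).
  replace (g1 0 / rho * - y - 1 * (g2 0 / rho) * 0) with (- y / rho * g1 0) in I by (field; lra).
  replace (g2 0 / rho * - y + 1 * (g1 0 / rho) * 0) with (- y / rho * g2 0) in I by (field; lra).
  assert (rdist m (g1 0) (g2 0) (- y / rho * g1 0) (- y / rho * g2 0) <= rdist m rho 0 (- y) 0).
  { apply I; [|ring]. transitivity ((g1 0 ^ 2 + g2 0 ^ 2) / rho ^ 2); [field; lra|].
    rewrite <- R2. field. lra. }
  lra.
Qed.
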